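(* Let $q\in[0,1)$ be a fixed constant. Suppose the $k$-th candidate model is correct for $k=K^*,\dots,K_{ne}$ and the remaining candidate models are wrong, and that $\tilde w^*$ is the unique minimizer of $\mathbb E L(Y_1,\langle\tilde B^*\tilde w,X_1\rangle)$ over $\tilde w\in\mathcal W^{K_0}$. Assume: (i) $\mu\mapsto\inf_{y\in\mathcal Y}\partial_\mu^2L(y,\mu)$ is positive and continuous, and there is a constant $L_u>0$ such that $|\partial_\mu L(y,\mu_1)-\partial_\mu L(y,\mu_2)|\le L_u|\mu_1-\mu_2|$ for all $y\in\mathcal Y$, $\mu_1,\mu_2\in\mathbb R$; (ii) $X_1$ is sub-gaussian with $\|X_1\|_{\psi_2}=K_x$, $\partial_\mu L(Y_1,0)$ is sub-gaussian with $\|\partial_\mu L(Y_1,0)\|_{\psi_2}=K_y$, and $\lambda_{\min}(\mathbf\Sigma)\ge\kappa_l$, where $\mathbf\Sigma$ is the covariance matrix of $X_1$ and $K_x,K_y,\kappa_l$ are positive constants; (iii) $\|\beta^*_{(k)}\|_2\le K_\beta$ for all $k\in[K]$ with a constant $K_\beta>0$; and for each $k\in[K]$ and $\delta\in(0,1)$, with probability at least $1-4\exp(-n\delta^2)$, the bounds $\|\hat\beta_{(k)}-\beta^*_{(k)}\|_2\le T^{(2)}_{n,q}(\delta)$ and $\|\hat\beta_{(k)}-\beta^*_{(k)}\|_1\le T^{(1)}_{n,q}(\delta)$ hold simultaneously; and likewise for each $k\in[K]$, $m\in[J]$, $\delta\in(0,1)$, the same two bounds hold simultaneously for $\hat\beta^{[-m]}_{(k)}-\beta^*_{(k)}$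 with probability at least $1-4\exp(-n_{-1}\delta^2)$. Then there exist positive constants $c_0,c_1,c,C_1,C_2$, not depending on $n$, such that if (iv) either $\inf_{\mu\in\mathbb R}\inf_{y\in\mathcal Y}\partial_\mu^2L(y,\mu)\ge\eta_l$ for a constant $\eta_l>0$, or the following sparsity condition holds: $s_u\le c_0(\log(pK))^{-1}\sqrt n$ if $q=0$, and $h_{q,u}\le c_0(\log(pK))^{\frac{q-3}{2q}}n^{\frac{1-q}{2q}}$ if $q\in(0,1)$; (v) $\Psi_{n,q}\le c_1\tilde\phi^2$; then with probability greater than $1-C_2(pK)^{-1}-C_2e^{-cn}$, $$1-\sum_{k=K^*}^{K_{ne}}\hat w_k\le C_1T_{n,q}/\tilde\phi^2.$$
   Context: Notation: $[N]=\{1,\dots,N\}$; $a\vee b=\max(a,b)$; $\|v\|_0$ is the number of nonzero entries, $\|v\|_q=(\sum_j|v_j|^q)^{1/q}$ for $q\in(0,\infty)$; $\partial_\mu L,\partial^2_\mu L$ are derivatives of $L(y,\mu)$ in $\mu$. For a random variable $u$, $\|u\|_{\psi_2}=\inf\{t>0:\mathbb E\exp(u^2/t^2)\le2\}$; for a random vector $V$, $\|V\|_{\psi_2}=\sup_{\|v\|_2=1}\|\langle V,v\rangle\|_{\psi_2}$. ''Constants'' do not depend on $n$; $p,K$, the index sets and the distribution may depend on $n$. Data: $(Y_i,\mathbf x_i)$, $1\le i\le n$, are i.i.d., $\mathbf x_i=(\mathrm x_{i1},\mathrm x_{i2},\dots)^\top$ infinite-dimensional, $Y_i=g(\sum_{j\ge1}\beta_j\mathrm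 x_{ij},\varepsilon_i)\in\mathcal Y$ with $g$ a known function, $\varepsilon_i$ independent of $\mathbf x_i$, $\boldsymbol\beta=(\beta_1,\beta_2,\dots)^\top$ unknown. $L:\mathcal Y\times\mathbb R\to\mathbb R$ is convex in the second argument, and $\boldsymbol\beta$ minimizes $\mathbb E L(Y_1,\sum_j\theta_j\mathrm x_{1j})$ over $\{\theta\in\mathbb R^{\mathbb N}:\sum_j\theta_j^2<\infty\}$. Observed covariates: $X_i=(\mathrm x_{i1},\dots,\mathrm x_{ip})^\top$. Candidate models: $[p]$ is partitioned into groups $\mathcal M_1,\dots,\mathcal M_K$, the first $K_{ne}$ of size $d_1$ and the others of size $d_2$; the nested part is $\mathcal A_k=\mathcal M_1\cup\dots\cup\mathcal M_k$ for $k\le K_{ne}$, and the non-nested part is $\mathcal A_k=\mathcal M_k$ for $K_{ne}<k\le K$. With a coordinatewise-additive regularizer $r_\lambda(\beta)=\sum_{j=1}^pr_\lambda(\beta_j)$ and tuning parameters $\lambda_{n,k}$, $\lambda^{[-m]}_{n,k}$, $$\hat\beta_{(k)}=\operatorname{argmin}_{\beta\in\mathbb R^p,\ \beta_{\mathcal A_k^c}=0}\frac1n\sum_{i=1}^nL(Y_i,\langle\beta,X_i\rangle)+r_{\lambda_{n,k}}(\beta).$$ Split $[n]$ into a fixed number $J\ge2$ of folds $\mathcal I_1,\dots,\mathcal I_J$ of equal size $n_1=n/J$, $n_{-1}=n-n_1$, and let $$\hat\beta_{(k)}^{[-m]}=\operatorname{argmin}_{\beta\in\mathbb R^p,\ \beta_{\mathcal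 A_k^c}=0}\frac1{n_{-1}}\sum_{i\in[n]\setminus\mathcal I_m}L(Y_i,\langle\beta,X_i\rangle)+r_{\lambda^{[-m]}_{n,k}}(\beta),\quad \hat B^{[-m]}=(\hat\beta^{[-m]}_{(1)},\dots,\hat\beta^{[-m]}_{(K)}).$$ $\mathcal W^K=\{w\in[0,1]^K:\sum_kw_k=1\}$, $CV(w)=\sum_{m=1}^J\sum_{i\in\mathcal I_m}L(Y_i,\langle\hat B^{[-m]}w,X_i\rangle)$, and $\hat w\in\operatorname{argmin}_{w\in\mathcal W^K}CV(w)$. Pseudo-true values: $\beta^*_{(k)}=\operatorname{argmin}_{\beta\in\mathbb R^p,\beta_{\mathcal A_k^c}=0}\mathbb E L(Y_1,\langle\beta,X_1\rangle)$, $B^*=(\beta^*_{(1)},\dots,\beta^*_{(K)})$, $w^*\in\operatorname{argmin}_{w\in\mathcal W^K}\mathbb E L(Y_1,\langle B^*w,X_1\rangle)$. Model $k$ is correct if $\beta_j=0$ for all $j>p$ and $\beta^*_{(k)}=\beta^*:=(\beta_1,\dots,\beta_p)^\top$; otherwise it is wrong. Merged quantities: $K_0=K-(K_{ne}-K^* )$, $\tilde B^*=(\beta^*_{(1)},\dots,\beta^*_{(K^* )},\beta^*_{(K_{ne}+1)},\dots,\beta^*_{(K)})$, $\tilde w^*=(w_1^*,\dots,w^*_{K^*-1},\sum_{k=K^*}^{K_{ne}}w_k^*,w^*_{K_{ne}+1},\dots,w^*_K)$ (consequently $\tilde w^*_{K^*}=1$), and $$\tilde\phi^2=\min\Big\{\frac{\|\tilde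 B^*\Delta\|_2^2}{|\Delta_{K^*}|^2}:\ \Delta\in\mathcal W^{K_0}-\tilde w^*\Big\}$$ (over $\Delta\ne0$). Rates: $p_u=\max_k|\mathcal A_k|$, $s_u=\max_k\|\beta^*_{(k)}\|_0$, $h_{q,u}=\max_k\|\beta^*_{(k)}\|_q$. With a positive constant $C_0$: for $q=0$, $T^{(2)}_{n,0}(\delta)=C_0\sqrt{s_u}(\delta+\sqrt{\log p_u/n})$, $T^{(1)}_{n,0}(\delta)=C_0s_u(\delta+\sqrt{\log p_u/n})$; for $q\in(0,1)$, $T^{(2)}_{n,q}(\delta)=C_0h_{q,u}^{q/2}(\delta+\sqrt{\log p_u/n})^{1-q/2}$, $T^{(1)}_{n,q}(\delta)=C_0h_{q,u}^q(\delta+\sqrt{\log p_u/n})^{1-q}$. For $q=0$: $T_{n,0}=\Psi_{n,0}=\sqrt{s_u}\sqrt{\log(pK)/n}$. For $q\in(0,1)$: $T_{n,q}=h_{q,u}^{q/2}(\log(pK)/n)^{1/2-q/4}$ and $\Psi_{n,q}=\big(h_{q,u}^{2/(2-q)}\sqrt{\log(pK)/n}\big)\vee T_{n,q}$. *)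

(* Defs.v *)
From HB Require Import structures.
From mathcomp Require Import all_boot all_order all_algebra.
From mathcomp Require Import all_classical all_reals all_analysis.

Set Implicit Arguments.
Unset Strict Implicit.
Unset Printing Implicit Defensive.

Import Order.TTheory GRing.Theory Num.Theory.
Import numFieldNormedType.Exports.

Local Open Scope classical_set_scope.
Local Open Scope ring_scope.

Definition argmin {d : Order.disp_t} {T : Type} {V : porderType d}
    (A : set T) (f : T -> V) : set T :=
  [set a | A a /\ forall b, A b -> (f a <= f b)%O].

Definition dotp {R : realType} {p : nat} (u v : 'cV[R]_p) : R :=
  \sum_j u j 0 * v j 0.

Definition lqnorm {R : realType} {p : nat} (q : R) (v : 'cV[R]_p) : R :=
  (\sum_j `|v j 0| `^ q) `^ q^-1.

Definition l0norm {R : realType} {p : nat} (v : 'cV[R]_p) : nat :=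
  #|[pred j | v j 0 != 0]|.

Definition simplex {R : realType} (K : nat) : set 'cV[R]_K :=
  [set w | (forall k, 0 <= w k 0 <= 1) /\ \sum_k w k 0 = 1].
Arguments simplex {R} K.

Definition lambda_min {R : realType} {p : nat} (A : 'M[R]_p) : R :=
  inf [set a | eigenvalue A a].

(* Valued in \bar R: +oo for a variable that is not sub-gaussian. *)
Definition psi2norm {R : realType} {d : measure_display}
    {T : measurableType d} (P : probability T R) (u : T -> R) : \bar R :=
  ereal_inf [set t%:E | t in
    [set t : R | 0 < t /\
                 ('E_P[(fun w => expR (u w ^+ 2 / t ^+ 2))] <= 2%:E)%E]].

Definition psi2norm_vec {R : realType} {d : measure_display}
    {T : measurableType d} (P : probability T R) {p : nat}
    (V : T -> 'cV[R]_p) : \bar R :=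
  ereal_sup [set psi2norm P (fun w => dotp (V w) v) | v in
    [set v : 'cV[R]_p | lqnorm 2 v = 1]].

Definition covmx {R : realType} {d : measure_display}
    {T : measurableType d} (P : probability T R) {p : nat}
    (V : T -> 'cV[R]_p) : 'M[R]_p :=
  \matrix_(i, j) fine (covariance P (fun w => V w i 0) (fun w => V w j 0)).

(* The family is indexed by a finite type and the A i may be setT, so the
   product rule over the whole family gives it for every subfamily. *)
Definition mutually_independent {R : realType} {d d' : measure_display}
    {T : measurableType d} {E : measurableType d'} (P : probability T R)
    {I : finType} (Z : I -> T -> E) : Prop :=
  forall A : I -> set E, (forall i, measurable (A i)) ->
    fine (P [set w | forall i, A i (Z i w)]) =
    \prod_i fine (P (Z i @^-1` A i)).

Definition identically_distributed {R : realType} {d d' : measure_display}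
    {T : measurableType d} {E : measurableType d'} (P : probability T R)
    {I : Type} (Z : I -> T -> E) : Prop :=
  forall i i' (A : set E), measurable A ->
    P (Z i @^-1` A) = P (Z i' @^-1` A).

Definition independent2 {R : realType} {d d1 d2 : measure_display}
    {T : measurableType d} {E1 : measurableType d1} {E2 : measurableType d2}
    (P : probability T R) (U : T -> E1) (V : T -> E2) : Prop :=
  forall (A : set E1) (B : set E2), measurable A -> measurable B ->
    P (U @^-1` A `&` V @^-1` B) = (P (U @^-1` A) * P (V @^-1` B))%E.

Definition cylinders (R : realType) : set (set (nat -> R)) :=
  [set C | exists j (B : set R), measurable B /\ C = (fun s => s j) @^-1` B].

(* R^N with its product sigma-algebra *)
Definition seqspace (R : realType) := g_sigma_algebraType (@cylinders R).

Definition ell2 {R : realType} (theta : nat -> R) : Prop :=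
  cvgn (series (fun j => theta j ^+ 2)).

Definition dL {R : realType} {Y : Type} (L : Y -> R -> R) (y : Y) (mu : R) : R :=
  derive1 (L y : R -> R^o) mu.

Definition d2L {R : realType} {Y : Type} (L : Y -> R -> R) (y : Y) (mu : R) : R :=
  derive1 (dL L y : R -> R^o) mu.

(* inf is the real infimum, equal to 0 on sets that are not bounded below. *)
Definition inf_d2L {R : realType} {Y : Type} (L : Y -> R -> R) (mu : R) : R :=
  inf (range (fun y => d2L L y mu)).

(* One sample of size nobs with its candidate models and J-fold split.
   Observations, coordinates, models and folds are numbered from 0, so that
   the (k+1)-th candidate model is k : 'I_nmod; Kne and Kstar keep their usual
   1-based value, so model k is nested iff k < Kne. *)
Record experiment (R : realType) (dY : measure_display)
    (Ycal : measurableType dY) (J : nat) := Experiment {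
  nobs : nat;
  nobs_gt0 : (0 < nobs)%N;
  dOmega : measure_display;
  Omega : measurableType dOmega;
  Prob : probability Omega R;
  dnoise : measure_display;
  noise : measurableType dnoise;
  Yobs : 'I_nobs -> Omega -> Ycal;
  xcov : 'I_nobs -> Omega -> seqspace R;
  eps : 'I_nobs -> Omega -> noise;
  link : R -> noise -> Ycal;
  beta : nat -> R;
  pdim : nat;
  nmod : nat;
  Kne : nat;
  Kstar : nat;
  Kstar_gt0 : (0 < Kstar)%N;
  Kstar_le : (Kstar <= Kne)%N;
  Kne_le : (Kne <= nmod)%N;
  d1 : nat;
  d2 : nat;
  grp : 'I_pdim -> 'I_nmod;                      (* j is in M_(grp j) *)
  fold_of : 'I_nobs -> 'I_J;                     (* i is in I_(fold_of i) *)
  reg : R -> R -> R;                             (* r_lambda(t) *)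
  lam : 'I_nmod -> R;
  lam_cv : 'I_J -> 'I_nmod -> R;
  Bhat : Omega -> 'M[R]_(pdim, nmod);            (* k-th column: model k *)
  Bhat_cv : 'I_J -> Omega -> 'M[R]_(pdim, nmod);
  what : Omega -> 'cV[R]_nmod;
  Bstar : 'M[R]_(pdim, nmod);
  wstar : 'cV[R]_nmod
}.

Section Experiment.
Context {R : realType} {dY : measure_display} {Ycal : measurableType dY}.
Context {J : nat}.
Implicit Types (L : Ycal -> R -> R) (S : experiment R Ycal J).

Definition first_obs S : 'I_(nobs S) := Ordinal (nobs_gt0 S).

Definition Xobs S (i : 'I_(nobs S)) (w : Omega S) : 'cV[R]_(pdim S) :=
  \col_j xcov i w j.

Definition linpred S (theta : nat -> R) (i : 'I_(nobs S)) (w : Omega S) :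
  nat -> R := series (fun j => theta j * xcov i w j).

(* The infinite linear predictor is the almost sure limit of its partial sums. *)
Definition linpred_cvg S (theta : nat -> R) (i : 'I_(nobs S)) : Prop :=
  {ae (Prob S), forall w, cvgn (linpred theta i w)}.

Definition seq_risk L S (theta : nat -> R) : \bar R :=
  'E_(Prob S)[(fun w => L (Yobs (first_obs S) w)
                          (limn (linpred theta (first_obs S) w)))]%E.

Definition risk L S (b : 'cV[R]_(pdim S)) : \bar R :=
  'E_(Prob S)[(fun w => L (Yobs (first_obs S) w)
                          (dotp b (Xobs (first_obs S) w)))]%E.

Definition data_model L S : Prop :=
  [/\ (forall i, measurable_fun setT (@Yobs _ _ _ _ S i)) /\
      (forall i, measurable_fun setT (@xcov _ _ _ _ S i)) /\
      (forall i, measurable_fun setT (@eps _ _ _ _ S i)),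
      let Z := fun (i : 'I_(nobs S)) (w : Omega S) => (Yobs i w, xcov i w) in
      mutually_independent (Prob S) Z /\ identically_distributed (Prob S) Z,
      forall i : 'I_(nobs S), independent2 (Prob S) (eps i) (xcov i),
      forall i : 'I_(nobs S), linpred_cvg (beta S) i /\
        {ae (Prob S), forall w,
          Yobs i w = link (limn (linpred (beta S) i w)) (eps i w)} &
      argmin [set theta | ell2 theta /\ linpred_cvg theta (first_obs S)]
             (seq_risk L S) (beta S)].

(* Each group is nonempty, as a block of a partition. *)
Definition group_sizes S : Prop :=
  [/\ (0 < d1 S)%N, (0 < d2 S)%N &
      forall k : 'I_(nmod S),
        #|[pred j | grp j == k]| = if (k < Kne S)%N then d1 S else d2 S].

Definition fold_sizes S : Prop :=
  forall m : 'I_J,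
    (#|[pred i : 'I_(nobs S) | fold_of i == m]| * J)%N = nobs S.

Definition Amod S (k : 'I_(nmod S)) : {set 'I_(pdim S)} :=
  if (k < Kne S)%N then [set j | (grp j <= k)%N]%SET
  else [set j | grp j == k]%SET.

Definition supported S (k : 'I_(nmod S)) : set 'cV[R]_(pdim S) :=
  [set b | forall j, j \notin Amod k -> b j 0 = 0].

Definition n_fold S : nat := (nobs S %/ J)%N.
Definition n_train S : nat := (nobs S - n_fold S)%N.

Definition penalty S (l : R) (b : 'cV[R]_(pdim S)) : R :=
  \sum_j reg S l (b j 0).

Definition objective L S (k : 'I_(nmod S)) (w : Omega S)
    (b : 'cV[R]_(pdim S)) : R :=
  (nobs S)%:R^-1 * (\sum_(i < nobs S) L (Yobs i w) (dotp b (Xobs i w)))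
  + penalty (lam k) b.

Definition objective_cv L S (m : 'I_J) (k : 'I_(nmod S)) (w : Omega S)
    (b : 'cV[R]_(pdim S)) : R :=
  (n_train S)%:R^-1 *
    (\sum_(i < nobs S | fold_of i != m) L (Yobs i w) (dotp b (Xobs i w)))
  + penalty (lam_cv m k) b.

Definition CV L S (om : Omega S) (w : 'cV[R]_(nmod S)) : R :=
  \sum_(m < J) \sum_(i < nobs S | fold_of i == m)
    L (Yobs i om) (dotp (Bhat_cv m om *m w) (Xobs i om)).

Definition estimators L S : Prop :=
  [/\ (forall j k, measurable_fun setT (fun w : Omega S => Bhat w j k)) /\
      (forall m j k, measurable_fun setT (fun w : Omega S => Bhat_cv m w j k)) /\
      (forall k, measurable_fun setT (fun w : Omega S => what w k 0)),
      forall k (w : Omega S),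
        argmin (supported k) (objective L k w) (col k (Bhat w)),
      forall m k (w : Omega S),
        argmin (supported k) (objective_cv L m k w) (col k (Bhat_cv m w)) &
      forall w : Omega S, argmin (simplex (nmod S)) (CV L w) (what w)].

Definition pseudo_true L S : Prop :=
  (forall k, argmin (supported k) (risk L (S := S)) (col k (Bstar S))) /\
  argmin (simplex (nmod S)) (fun w => risk L (Bstar S *m w)) (wstar S).

Definition correct S (k : 'I_(nmod S)) : Prop :=
  (forall j, (pdim S <= j)%N -> beta S j = 0) /\
  col k (Bstar S) = \col_j beta S j.

Definition in_correct_range S (k : 'I_(nmod S)) : bool :=
  (Kstar S <= k.+1 <= Kne S)%N.

Definition nmerged S : nat := (nmod S - (Kne S - Kstar S))%N.

Lemma merged_subproof S (a : 'I_(nmerged S)) :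
  ((if a < Kstar S then nat_of_ord a else a + (Kne S - Kstar S)) < nmod S)%N.
Proof.
case: a => a /= ha; case: ifP => _; last by rewrite addnC -ltn_subRL.
by apply: leq_trans ha _; rewrite leq_subr.
Qed.

(* Merging keeps models 1, ..., Kstar, Kne + 1, ..., nmod (1-based). *)
Definition unmerge S (a : 'I_(nmerged S)) : 'I_(nmod S) :=
  Ordinal (merged_subproof a).

Lemma merged_star_subproof S : ((Kstar S).-1 < nmerged S)%N.
Proof.
have := Kstar_gt0 S; have := Kstar_le S; have := Kne_le S.
rewrite /nmerged; case: (Kstar S) => // s /= hK hs _.
by rewrite ltn_subRL (leq_trans _ hK)// -addnS subnK.
Qed.

Definition merged_star S : 'I_(nmerged S) := Ordinal (merged_star_subproof S).

Definition Btilde S : 'M[R]_(pdim S, nmerged S) :=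
  \matrix_(j, a) Bstar S j (unmerge a).

Definition wtilde S : 'cV[R]_(nmerged S) :=
  \col_a if a == merged_star S
         then \sum_(k | in_correct_range k) wstar S k 0
         else wstar S (unmerge a) 0.

Definition wtilde_unique_min L S : Prop :=
  argmin (simplex (nmerged S)) (fun w => risk L (Btilde S *m w)) =
  [set wtilde S].

(* The minimum defining tilde phi^2; when nmerged S = 1 no direction is
   available and the value is inf set0 = 0. *)
Definition phi2 S : R :=
  inf [set lqnorm 2 (Btilde S *m D) ^+ 2 / `|D (merged_star S) 0| ^+ 2 |
       D in [set D | D != 0 /\
               exists2 w, simplex (nmerged S) w & D = w - wtilde S]].

Definition p_u S : nat := \max_(k < nmod S) #|Amod k|.

Definition s_u S : nat := \max_(k < nmod S) l0norm (col k (Bstar S)).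

Definition h_u S (q : R) : R :=
  \big[Num.max/0]_(k < nmod S) lqnorm q (col k (Bstar S)).

Definition log_pK S : R := ln (pdim S * nmod S)%:R.

Definition rate2 S (q C0 delta : R) : R :=
  let r := delta + Num.sqrt (ln (p_u S)%:R / (nobs S)%:R) in
  if q == 0 then C0 * Num.sqrt (s_u S)%:R * r
  else C0 * h_u S q `^ (q / 2) * r `^ (1 - q / 2).

Definition rate1 S (q C0 delta : R) : R :=
  let r := delta + Num.sqrt (ln (p_u S)%:R / (nobs S)%:R) in
  if q == 0 then C0 * (s_u S)%:R * r
  else C0 * h_u S q `^ q * r `^ (1 - q).

Definition Tn S (q : R) : R :=
  if q == 0 then Num.sqrt (s_u S)%:R * Num.sqrt (log_pK S / (nobs S)%:R)
  else h_u S q `^ (q / 2) * (log_pK S / (nobs S)%:R) `^ (1 / 2 - q / 4).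

Definition Psin S (q : R) : R :=
  if q == 0 then Tn S q
  else Num.max (h_u S q `^ (2 / (2 - q)) * Num.sqrt (log_pK S / (nobs S)%:R))
               (Tn S q).

Definition close_event S (B : Omega S -> 'M[R]_(pdim S, nmod S))
    (k : 'I_(nmod S)) (q C0 delta : R) : set (Omega S) :=
  [set w | lqnorm 2 (col k (B w) - col k (Bstar S)) <= rate2 S q C0 delta /\
           lqnorm 1 (col k (B w) - col k (Bstar S)) <= rate1 S q C0 delta].

Definition subgaussian_design L S (Kx Ky kappal : R) : Prop :=
  [/\ psi2norm_vec (Prob S) (Xobs (first_obs S)) = Kx%:E,
      psi2norm (Prob S) (fun w => dL L (Yobs (first_obs S) w) 0) = Ky%:E &
      kappal <= lambda_min (covmx (Prob S) (Xobs (first_obs S)))].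

Definition estimation_rates S (q C0 Kbeta : R) : Prop :=
  [/\ forall k, lqnorm 2 (col k (Bstar S)) <= Kbeta,
      forall k (delta : R), 0 < delta < 1 ->
        ((1 - 4 * expR (- ((nobs S)%:R * delta ^+ 2)))%:E
          <= Prob S (close_event (@Bhat _ _ _ _ S) k q C0 delta))%E &
      forall k (m : 'I_J) (delta : R), 0 < delta < 1 ->
        ((1 - 4 * expR (- ((n_train S)%:R * delta ^+ 2)))%:E
          <= Prob S (close_event (@Bhat_cv _ _ _ _ S m) k q C0 delta))%E].

Definition sparsity S (q c0 : R) : Prop :=
  if q == 0 then (s_u S)%:R <= c0 * (log_pK S)^-1 * Num.sqrt (nobs S)%:R
  else h_u S q <= c0 * log_pK S `^ ((q - 3) / (2 * q))
                     * (nobs S)%:R `^ ((1 - q) / (2 * q)).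

Definition strong_convexity L : Prop :=
  exists2 etal : R, 0 < etal & etal <= inf (range (inf_d2L L)).

Definition wrong_weight S (w : Omega S) : R :=
  1 - \sum_(k | in_correct_range k) what w k 0.

End Experiment.

(* Main.v *)
Require Import Defs.
From HB Require Import structures.
From mathcomp Require Import all_boot all_order all_algebra.
From mathcomp Require Import all_classical all_reals all_analysis.
From mathcomp Require Import measurable_realfun ring lra zify.

Set Implicit Arguments.
Unset Strict Implicit.
Unset Printing Implicit Defensive.

Import Order.TTheory GRing.Theory Num.Theory.
Import numFieldNormedType.Exports.

Local Open Scope classical_set_scope.
Local Open Scope ring_scope.

(* Write x_k for the excess beta*_(k) - beta*, tau for the total weight that w-hat puts on wrong
   models and b for the convex combination of the x_k with the normalised wrong weights.
   Comparing CV(w-hat) with CV at the weight obtained by moving the mass tau to the correct model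
   K*, and expanding the loss around beta*, gives tau^2 n phi2 <= C tau n T, where
   a = sqrt(log(pK)/n) and T = T_{n,q}, once the following holds for the sample.
   - Curvature: L(y,v) - L(y,u) - L'(y,u)(v - u) >= eta min(|v - u|,1)^2 for |u| <= M. Because of
     the cap at 1, this follows from continuity and positivity of the infimal second derivative,
     without strong convexity and without a bound on the predictors. The capped curvature
     of the sample in direction b is at least c n |b|^2 >= c n phi2: a small-ball estimate for
     the averages of m ~ a^{-2} of the x_k, a finite family within empirical distance
     O(a) of b by Maurey's argument.
   - Gradients: the gradient of the sample loss at beta* in the directions x_k, and in each
     coordinate on each fold, is O(n a), since the risk is stationary at beta*.
   - Training errors: the estimates of the folds may depend on all observations, so their
     empirical norm is controlled uniformly, by sum_i <d,X_i>^2 <= C n (|d|_2^2 + a^2 |d|_1^2) for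
     all d; this is again Maurey's argument, with the signed coordinate vectors as the finite
     family. *)

(** * Independence and tail bounds *)

(** The risk is an extended real and the loss at the truth carries no moment assumption, so
    stationarity at beta* is delicate. By uniqueness of the minimizer, the vertex of the merged
    simplex at a wrong model has strictly larger risk; two losses differ by an integrable function,
    and a strict inequality between their integrals then makes the smaller one finite. If no model
    is wrong, the wrong weight is 0. Smallness of a and T comes from Psi <= c1 phi2: with s the
    largest l2-norm of a pseudo-true vector, phi2 <= 4 s^2, while s is at most K_beta and, for q >
    0, at most h_q; comparing powers of s and h leaves a bound on a of order c1. Probabilities are
    counted in powers of p K, as exp(-n a^2) = 1/(p K). Gradient and estimation tails are taken at
    (p K)^-2, so that a union over coordinates or models leaves (p K)^-1; the m-tuples are paid for
    by tails exponential in n. Maurey's argument is an induction on the number of draws, valid for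
    indefinite symmetric forms as well; hence it applies to D |v|_2^2 - sum_i <v,X_i>^2. *)

Section independence.
Context {R : realType} {d d' : measure_display} {T : measurableType d}
  {E : measurableType d'} (P : probability T R) {I : finType}.
Variable Z : I -> T -> E.
Hypothesis mZ : forall i, measurable_fun setT (Z i).
Hypothesis indepZ : mutually_independent P Z.

Lemma bigcap_fin_measurable (A : I -> set T) : (forall i, measurable (A i)) ->
  measurable [set w | forall i, A i w].
Proof.
move=> mA.
have -> : [set w | forall i, A i w] = \big[setI/setT]_(i <- enum I) A i.
  rewrite -bigcap_seq; apply/seteqP; split => w /= h i; first by move=> _; exact: h.
  by apply: h; rewrite /= mem_enum.
by apply: bigsetI_measurable => i _.
Qed.

Import HBNNSimple.

Lemma nnsfun_finite_expansion (s : seq R) (g : {nnsfun E >-> R}) :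
  uniq s -> (forall z, g z \in s) ->
  forall z, g z = \sum_(j < size s) s`_j * \1_(g @^-1` [set s`_j]) z.
Proof.
move=> us gs z.
have iz : (index (g z) s < size s)%N by rewrite index_mem.
rewrite (bigD1 (Ordinal iz))//= nth_index// indicE mem_set// mulr1 big1 ?addr0//.
move=> j jz; rewrite indicE memNset ?mulr0//= => gz.
by case/eqP: jz; apply: val_inj; rewrite /= gz index_uniq.
Qed.

(** One list of values serves the whole family, so that a product of expansions distributes over the
    functions from [I] to positions in this list. *)
Lemma nnsfun_range_seq (g : I -> {nnsfun E >-> R}) :
  exists s : seq R, uniq s /\ forall i z, g i z \in s.
Proof.
have /choice[r rE] : forall i, exists r : seq R, range (g i) = [set` r].
  by move=> i; apply/finite_seqP; exact: fimfunP.
exists (undup (flatten [seq r i | i <- enum I])); split; first exact: undup_uniq.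
move=> i z; rewrite mem_undup; apply/flattenP.
exists (r i); first by apply/mapP; exists i; rewrite ?mem_enum.
by have : range (g i) (g i z) by []; rewrite rE.
Qed.

(** Distributing the product writes the integrand as a combination of indicators of rectangles, and
    on rectangles independence is the product rule itself. *)
Lemma indep_nnsfun_prod (g : I -> {nnsfun E >-> R}) :
  (\int[P]_w (\prod_i g i (Z i w))%:E)%E =
  (\prod_i fine (\int[P]_w (g i (Z i w))%:E)%E)%:E.
Proof.
have [s [us gs]] := nnsfun_range_seq g.
have mgs i (x : R) : measurable (g i @^-1` [set x]).
  by rewrite -[X in measurable X]setTI; exact: measurable_funP.
have mgZ i (x : R) : measurable (Z i @^-1` (g i @^-1` [set x])).
  by rewrite -[X in measurable X]setTI; exact: mZ.
(* A listed value that [g i] never takes has unknown sign, but its indicator vanishes. *)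
have sge0 i (c : R) w : 0 <= c * \1_(g i @^-1` [set c]) (Z i w).
  have [[z _ <-]|nz] := pselect (range (g i) c).
    by rewrite mulr_ge0// ?fun_ge0// indicE.
  rewrite indicE memNset ?mulr0//= => gz.
  by apply: nz; exists (Z i w).
have one i : fine (\int[P]_w (g i (Z i w))%:E)%E =
    \sum_(j < size s) s`_j * fine (P (Z i @^-1` (g i @^-1` [set s`_j]))).
  rewrite (_ : (\int[P]_w _)%E = (\sum_(j < size s)
      (s`_j)%:E * P (Z i @^-1` (g i @^-1` [set s`_j])))%E).
    rewrite -sum_fine//; last first.
      by move=> j _; rewrite fin_numM// fin_num_measure.
    by apply: eq_bigr => j _; rewrite fineM// fin_num_measure.
  under eq_integral do rewrite (nnsfun_finite_expansion us (gs i)) -sumEFin.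
  rewrite ge0_integral_sum//; last 2 first.
  - move=> j; apply/measurable_EFinP; apply: measurable_funM => //.
    by apply: (measurableT_comp (measurable_indic _)).
  - by move=> j w _; rewrite lee_fin.
  apply: eq_bigr => j _.
  transitivity (\int[P]_w (s`_j * \1_(Z i @^-1` (g i @^-1` [set s`_j])) w)%:E)%E.
    by apply: eq_integral => w _; rewrite !indicE; congr (_ * _)%:E.
  under eq_integral do rewrite EFinM.
  rewrite integralZl//; first by rewrite integral_indic// setIT.
  by apply/integrable_indic.
under [in RHS]eq_bigr do rewrite one.
rewrite bigA_distr_bigA /=.
transitivity (\int[P]_w (\sum_(f : {ffun I -> 'I_(size s)})
   (\prod_i s`_(f i) * \1_[set w | forall i, g i (Z i w) = s`_(f i)] w)%:E))%E.
  apply: eq_integral => w _; rewrite sumEFin; congr EFin.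
  under eq_bigr do rewrite (nnsfun_finite_expansion us (gs _)).
  rewrite bigA_distr_bigA /=; apply: eq_bigr => f _.
  rewrite big_split /=; congr (_ * _).
  rewrite indicE; have [h|h] := pselect (forall i, g i (Z i w) = s`_(f i)).
    rewrite [in RHS]mem_set//= big1// => i _.
    by rewrite indicE mem_set//; exact: h.
  rewrite [in RHS]memNset//=.
  move/existsNP : h => [i hi].
  by rewrite (bigD1 i)//= indicE memNset ?mul0r.
have mint (f : {ffun I -> 'I_(size s)}) :
    measurable [set w | forall i, g i (Z i w) = s`_(f i)].
  by apply: (@bigcap_fin_measurable (fun i => Z i @^-1` (g i @^-1` [set s`_(f i)]))).
rewrite ge0_integral_sum//; last 2 first.
- by move=> f; apply/measurable_EFinP; apply: measurable_funM.
- move=> f w _; rewrite lee_fin.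
  have [h|h] := pselect (forall i, g i (Z i w) = s`_(f i)); last first.
    by rewrite indicE memNset//= mulr0.
  apply: mulr_ge0; last by rewrite indicE.
  by apply: prodr_ge0 => i _; rewrite -h fun_ge0.
rewrite -sumEFin; apply: eq_bigr => f _.
under eq_integral do rewrite EFinM.
rewrite integralZl//; last by apply/integrable_indic.
rewrite integral_indic// setIT big_split/= EFinM; congr (_ * _)%E.
rewrite -[RHS]/((\prod_i fine (P (Z i @^-1` (g i @^-1` [set s`_(f i)]))))%:E).
rewrite -(indepZ (A := fun i => g i @^-1` [set s`_(f i)]))//.
rewrite fineK//; exact: fin_num_measure (mint f).
Qed.

(** Monotone convergence from simple functions below each [f i]; the products increase because all
    factors are nonnegative. The bounds [B i] make every integral finite, so that [fine] loses
    nothing. *)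
Lemma indep_prod_le (f : I -> E -> R) (B : I -> R) :
  (forall i, measurable_fun setT (f i)) -> (forall i z, 0 <= f i z) ->
  (forall i, (\int[P]_w (f i (Z i w))%:E <= (B i)%:E)%E) ->
  (\int[P]_w (\prod_i f i (Z i w))%:E <= (\prod_i B i)%:E)%E.
Proof.
move=> mf f0 fB.
have mEf i : measurable_fun setT (EFin \o f i) by apply/measurable_EFinP.
pose g i := nnsfun_approx measurableT (mEf i).
have g_cvg i z : (g i n z)%:E @[n --> \oo] --> (f i z)%:E.
  exact: (cvg_nnsfun_approx measurableT (mEf i) (fun x _ => f0 i x)).
have g_nd i z : nondecreasing_seq (fun n => g i n z).
  by move=> m n mn; have /lefP := nd_nnsfun_approx measurableT (mEf i) mn; apply.
have g_le i n z : g i n z <= f i z.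
  have /fine_cvg/= cv := g_cvg i z.
  rewrite -(cvg_lim _ cv)//; apply: (nondecreasing_cvgn_le (g_nd i z)).
  by apply/cvg_ex; exists (f i z).
have prod_cvg w : (\prod_i g i n (Z i w)) @[n --> \oo] --> \prod_i f i (Z i w).
  elim: (index_enum I) => [|i r IH].
    by under eq_fun do rewrite big_nil; rewrite big_nil; exact: cvg_cst.
  under eq_fun do rewrite big_cons; rewrite big_cons; apply: cvgM => //.
  exact: fine_cvg (g_cvg i (Z i w)).
have mgZ i n : measurable_fun setT (fun w => g i n (Z i w)).
  by apply: measurableT_comp.
have mprod n : measurable_fun setT (fun w => \prod_i g i n (Z i w)).
  by apply: measurable_prod.
have pr_nd w : nondecreasing_seq (fun n => \prod_i g i n (Z i w)).
  by move=> m n mn; apply: ler_prod => i _; rewrite fun_ge0/= g_nd.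
have := @cvg_monotone_convergence _ _ _ P setT measurableT
  (fun n w => (\prod_i g i n (Z i w))%:E).
have -> : (fun x => limn ((fun n w => (\prod_i g i n (Z i w))%:E)^~ x)) =
    (fun w => (\prod_i f i (Z i w))%:E).
  apply/funext => w; apply/cvg_lim => //.
  by apply: cvg_EFin; [exact: nearW|exact: prod_cvg].
move=> cvint; apply: (cvge_to_le (cvint _ _ _)) => //.
- by move=> n; apply/measurable_EFinP.
- by move=> n w _; rewrite lee_fin prodr_ge0// => i _; rewrite fun_ge0.
- by move=> w _ m n mn; rewrite lee_fin pr_nd.
apply: nearW => n; rewrite indep_nnsfun_prod lee_fin; apply: ler_prod => i _.
have gi_le : (\int[P]_w (g i n (Z i w))%:E <= (B i)%:E)%E.
  apply: le_trans (fB i); apply: ge0_le_integral => //.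
  - by move=> w _; rewrite lee_fin fun_ge0.
  - exact/measurable_EFinP.
  - by apply/measurable_EFinP; apply: measurableT_comp.
  - by move=> w _; rewrite lee_fin.
have gi_ge : (0 <= \int[P]_w (g i n (Z i w))%:E)%E.
  by apply: integral_ge0 => w _; rewrite lee_fin fun_ge0.
rewrite fine_ge0//= -lee_fin fineK//.
by rewrite ge0_fin_numE// (le_lt_trans gi_le)// ltry.
Qed.
End independence.

Lemma measurable_ler_set {d : measure_display} {T : measurableType d} {R : realType}
  (f g : T -> R) : measurable_fun setT f -> measurable_fun setT g ->
  measurable [set w | f w <= g w].
Proof. by move=> mf mg; rewrite -[X in measurable X]setTI; exact: measurable_fun_le. Qed.

Lemma measurable_ltr_set {d : measure_display} {T : measurableType d} {R : realType}
  (f g : T -> R) : measurable_fun setT f -> measurable_fun setT g ->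
  measurable [set w | f w < g w].
Proof.
move=> mf mg; rewrite (_ : [set w | _] = ~` [set w | g w <= f w]).
  by apply: measurableC; exact: measurable_ler_set.
by apply/funext => w /=; rewrite real_ltNge ?num_real//; apply/propext; split => /negP.
Qed.

Lemma measurable_sum_cond {d : measure_display} {T : measurableType d}
  {R : realType} {I : Type} (s : seq I) (Q : pred I) (h : I -> T -> R) :
  (forall i, measurable_fun setT (h i)) ->
  measurable_fun setT (fun x => \sum_(i <- s | Q i) h i x).
Proof. by move=> mh; under eq_fun do rewrite -big_filter; exact: measurable_sum. Qed.

Lemma bigcup_fin_measurable {d : measure_display} {T : measurableType d}
  {I : finType} (A : I -> set T) : (forall i, measurable (A i)) ->
  measurable [set w | exists i, A i w].
Proof.
move=> mA.
have -> : [set w | exists i, A i w] = \big[setU/set0]_(i <- enum I) A i.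
  rewrite -bigcup_seq; apply/seteqP; split => w /=.
    by move=> [i Ai]; exists i; rewrite //= mem_enum.
  by move=> [i _ Ai]; exists i.
by apply: bigsetU_measurable => i _.
Qed.

Section probability.
Context {R : realType} {d : measure_display} {T : measurableType d}
  (P : probability T R).

Lemma prob_setU_le (A B : set T) (a b : R) : measurable A -> measurable B ->
  (P A <= a%:E)%E -> (P B <= b%:E)%E -> (P (A `|` B) <= (a + b)%:E)%E.
Proof.
move=> mA mB Aa Bb; apply: le_trans (measureU2 _ mA mB) _.
by rewrite EFinD leeD.
Qed.

Lemma prob_exists_le {I : finType} (A : I -> set T) (b : R) :
  (forall i, measurable (A i)) -> (forall i, (P (A i) <= b%:E)%E) ->
  (P [set w | exists i, A i w] <= (#|I|%:R * b)%:E)%E.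
Proof.
move=> mA Ab.
have -> : [set w | exists i, A i w] = \big[setU/set0]_(i <- enum I) A i.
  rewrite -bigcup_seq; apply/seteqP; split => w /=.
    by move=> [i Ai]; exists i; rewrite //= mem_enum.
  by move=> [i _ Ai]; exists i.
rewrite cardE; elim: (enum I) => [|i s IH]; first by rewrite big_nil measure0 mul0r.
rewrite big_cons /= -natr1 mulrDl mul1r addrC; apply: prob_setU_le => //.
exact: bigsetU_measurable.
Qed.

Lemma markov_expR (X : T -> R) (s B : R) : measurable_fun setT X ->
  (\int[P]_w (expR (X w))%:E <= B%:E)%E ->
  (P [set w | (s <= X w)%R] <= (expR (- s) * B)%:E)%E.
Proof.
move=> mX XB.
have mA : measurable [set w | s <= X w].
  exact: measurable_ler_set.
rewrite -[X in P X]setIT -integral_indic//.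
rewrite [leRHS]EFinM.
apply: (@le_trans _ _ ((expR (- s))%:E * \int[P]_w (expR (X w))%:E)%E); last first.
  by rewrite lee_pmul2l// lte_fin expR_gt0.
rewrite -ge0_integralZl//; last first.
  by apply/measurable_EFinP; apply: measurableT_comp.
apply: ge0_le_integral => //.
- by apply/measurable_EFinP.
- apply/measurable_EFinP; apply: measurable_funM => //.
  by apply: measurableT_comp.
move=> w _; rewrite -EFinM lee_fin -expRD indicE.
have [/[!inE]/= sX|_] := boolP (w \in _); last exact: expR_ge0.
by rewrite -expR0 ler_expR addrC subr_ge0.
Qed.

End probability.

Section iid.
Context {R : realType} {d d' : measure_display} {T : measurableType d}
  {E : measurableType d'} (P : probability T R) {I : finType}.
Variable Z : I -> T -> E.
Hypothesis mZ : forall i, measurable_fun setT (Z i).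
Hypothesis indepZ : mutually_independent P Z.
Hypothesis identZ : identically_distributed P Z.

Lemma ident_ge0_integral (f : E -> R) i i' :
  measurable_fun setT f -> (forall z, 0 <= f z) ->
  (\int[P]_w (f (Z i w))%:E = \int[P]_w (f (Z i' w))%:E)%E.
Proof.
move=> mf f0.
have mEf : measurable_fun setT (EFin \o f) by apply/measurable_EFinP.
have pf k : (\int[P]_w (f (Z k w))%:E = \int[pushforward P (Z k)]_z (f z)%:E)%E.
  by rewrite ge0_integral_pushforward// => z _; rewrite lee_fin.
rewrite !pf; apply: eq_measure_integral => A mA _.
exact: identZ.
Qed.

Lemma iid_chernoff (Q : pred I) (h : E -> R) (i0 : I) (s B : R) :
  measurable_fun setT h -> (\int[P]_w (expR (h (Z i0 w)))%:E <= B%:E)%E ->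
  (P [set w | (s <= \sum_(i | Q i) h (Z i w))%R]
    <= (expR (- s) * B ^+ #|Q|)%:E)%E.
Proof.
move=> mh hB; apply: markov_expR.
  by apply: measurable_sum_cond => i; apply: measurableT_comp.
(* Indices outside [Q] get the factor 1, so independence of the full family covers a sum over a
   fold. *)
pose f i z := if Q i then expR (h z) else 1.
have := @indep_prod_le R _ _ T E P I Z mZ indepZ f (fun i => if Q i then B else 1).
have -> : (\prod_i (if Q i then B else 1)) = B ^+ #|Q|.
  by rewrite -big_mkcond /= prodr_const.
rewrite (_ : (\int[P]_w (\prod_i f i (Z i w))%:E =
  \int[P]_w (expR (\sum_(i | Q i) h (Z i w)))%:E)%E); last first.
  by apply: eq_integral => w _; rewrite expR_sum [in RHS]big_mkcond.
apply.
- move=> i; rewrite /f; case: (Q i) => //.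
  by apply: measurableT_comp.
- by move=> i z; rewrite /f; case: ifP => // _; exact: expR_ge0.
- move=> i; rewrite /f; case: (Q i).
    rewrite (@ident_ge0_integral (fun z => expR (h z)) i i0)//.
      by apply: measurableT_comp.
  rewrite integral_cst /= ?measurableT // ?probability_setT ?mul1e ?mule1 //.
Qed.

End iid.

(** * The loss function *)

Section loss.
Context {R : realType} {Y : Type} (L : Y -> R -> R).
Hypothesis dL1 : forall y mu, derivable (L y : R -> R^o) mu 1.
Hypothesis dL2 : forall y mu, derivable (dL L y : R -> R^o) mu 1.
Hypothesis d2L_gt0 : forall mu, 0 < inf_d2L L mu.

Lemma dL_is_derive y (mu : R) : is_derive mu 1 (L y : R -> R^o) (dL L y mu).
Proof. by rewrite /dL derive1E; exact/derivableP. Qed.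

Lemma d2L_is_derive y (mu : R) : is_derive mu 1 (dL L y : R -> R^o) (d2L L y mu).
Proof. by rewrite /d2L derive1E; exact/derivableP. Qed.

Lemma loss_continuous y : continuous (L y : R -> R).
Proof. by move=> mu; apply/differentiable_continuous/derivable1_diffP/dL1. Qed.

Lemma dL_continuous y : continuous (dL L y : R -> R).
Proof. by move=> mu; apply/differentiable_continuous/derivable1_diffP/dL2. Qed.

Lemma loss_MVT y (a b : R) : a < b ->
  exists2 c, a < c < b & L y b - L y a = dL L y c * (b - a).
Proof.
move=> ab; have [] := @MVT R (L y) (dL L y) a b ab.
- by move=> x _; exact: dL_is_derive.
- exact/continuous_subspaceT/loss_continuous.
by move=> c; rewrite in_itv/=; exists c.
Qed.

Lemma dL_MVT y (a b : R) : a < b ->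
  exists2 c, a < c < b & dL L y b - dL L y a = d2L L y c * (b - a).
Proof.
move=> ab; have [] := @MVT R (dL L y) (d2L L y) a b ab.
- by move=> x _; exact: d2L_is_derive.
- exact/continuous_subspaceT/dL_continuous.
by move=> c; rewrite in_itv/=; exists c.
Qed.

(* [inf] is [0] on a set that is not bounded below, so positivity of [inf_d2L]
   also says that the second derivatives are bounded below. *)
Lemma inf_d2L_le y mu : inf_d2L L mu <= d2L L y mu.
Proof.
apply: ge_inf; last by exists y.
apply/not_notP => nb; have := d2L_gt0 mu.
rewrite /inf_d2L inf_out ?ltxx// => -[_ hb]; exact: nb.
Qed.

Lemma d2L_gt0_pt y mu : 0 < d2L L y mu.
Proof. exact: lt_le_trans (d2L_gt0 mu) (inf_d2L_le y mu). Qed.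

Lemma dL_ler y (a b : R) : a <= b -> dL L y a <= dL L y b.
Proof.
rewrite le_eqVlt => /predU1P[->//|ab].
have [c _ e] := dL_MVT y ab.
by rewrite -subr_ge0 e mulr_ge0// ?subr_ge0 ltW// d2L_gt0_pt.
Qed.

Lemma dL_strong_mono (M eta : R) : (forall mu, - M <= mu <= M -> eta <= inf_d2L L mu) ->
  forall y a b, - M <= a -> a <= b -> b <= M ->
    eta * (b - a) <= dL L y b - dL L y a.
Proof.
move=> hM y a b Ma; rewrite le_eqVlt => /predU1P[->|ab] bM; first by rewrite !subrr mulr0.
have [c /andP[ac cb] ->] := dL_MVT y ab.
apply: ler_wpM2r; first by rewrite subr_ge0 ltW.
by rewrite (le_trans _ (inf_d2L_le y c))// hM// (le_trans Ma (ltW ac)) (le_trans (ltW cb) bM).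
Qed.

(** Split at [c], half a capped step to the right of [a]: on [[a, c]], inside the region of
    curvature [eta], the derivative gains [eta * s / 2], and by convexity this gain persists on the
    rest, whose length is at least [s / 2]. *)
Lemma loss_curvature_right (M eta : R) : 0 <= eta ->
  (forall mu, - (M + 1) <= mu <= M + 1 -> eta <= inf_d2L L mu) ->
  forall y a b, `|a| <= M -> a <= b ->
  eta / 4 * Num.min (b - a) 1 ^+ 2 <= L y b - L y a - dL L y a * (b - a).
Proof.
move=> eta0 hM y a b aM; rewrite le_eqVlt => /predU1P[->|ab].
  by rewrite !subrr mulr0 subr0 /Num.min ltr01 expr0n/= mulr0.
set s := Num.min (b - a) 1.
have s0 : 0 < s by rewrite lt_min subr_gt0 ab ltr01.
have sba : s <= b - a by rewrite ge_min lexx.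
have s1 : s <= 1 by rewrite ge_min lexx orbT.
pose c := a + s / 2.
have ac : a < c by rewrite /c ltrDl divr_gt0.
have cb : c < b by rewrite /c; lra.
move: aM; rewrite ler_norml => /andP[aM1 aM2].
have [u /andP[au uc] eu] := loss_MVT y ac.
have [v /andP[cv vb] ev] := loss_MVT y cb.
have h1 : dL L y a <= dL L y u by apply: dL_ler; exact: ltW.
have h2 : dL L y c <= dL L y v by apply: dL_ler; exact: ltW.
have h3 : eta * (c - a) <= dL L y c - dL L y a.
  have lo : - (M + 1) <= a by lra.
  have hi : c <= M + 1 by rewrite /c; lra.
  exact: (dL_strong_mono hM y lo (ltW ac) hi).
have -> : L y b - L y a = dL L y v * (b - c) + dL L y u * (c - a) by rewrite -eu -ev; ring.
have k1 : dL L y a * (c - a) <= dL L y u * (c - a) by apply: ler_wpM2r => //; rewrite subr_ge0 ltW.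
have k2 : (dL L y a + eta * (c - a)) * (b - c) <= dL L y v * (b - c).
  by apply: ler_wpM2r; [rewrite subr_ge0 ltW|lra].
have k3 : eta * (s / 2) * (s / 2) <= eta * (c - a) * (b - c).
  have -> : c - a = s / 2 by rewrite /c; ring.
  apply: ler_wpM2l; [rewrite mulr_ge0// divr_ge0// ltW//|rewrite /c; lra].
rewrite expr2; nra.
Qed.

Lemma loss_curvature_left (M eta : R) : 0 <= eta ->
  (forall mu, - (M + 1) <= mu <= M + 1 -> eta <= inf_d2L L mu) ->
  forall y a b, `|a| <= M -> b <= a ->
  eta / 4 * Num.min (a - b) 1 ^+ 2 <= L y b - L y a - dL L y a * (b - a).
Proof.
move=> eta0 hM y a b aM; rewrite le_eqVlt => /predU1P[->|ba].
  by rewrite !subrr mulr0 subr0 /Num.min ltr01 expr0n/= mulr0.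
set s := Num.min (a - b) 1.
have s0 : 0 < s by rewrite lt_min subr_gt0 ba ltr01.
have sba : s <= a - b by rewrite ge_min lexx.
have s1 : s <= 1 by rewrite ge_min lexx orbT.
pose c := a - s / 2.
have ca : c < a by rewrite /c ltrBlDr ltrDl divr_gt0.
have bc : b < c by rewrite /c; lra.
move: aM; rewrite ler_norml => /andP[aM1 aM2].
have [u /andP[cu ua] eu] := loss_MVT y ca.
have [v /andP[bv vc] ev] := loss_MVT y bc.
have h1 : dL L y u <= dL L y a by apply: dL_ler; exact: ltW.
have h2 : dL L y v <= dL L y c by apply: dL_ler; exact: ltW.
have h3 : eta * (a - c) <= dL L y a - dL L y c.
  have lo : - (M + 1) <= c by rewrite /c; lra.
  have hi : a <= M + 1 by lra.
  exact: (dL_strong_mono hM y lo (ltW ca) hi).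
have -> : L y b - L y a = - (dL L y v * (c - b) + dL L y u * (a - c)) by rewrite -eu -ev; ring.
have k1 : dL L y u * (a - c) <= dL L y a * (a - c) by apply: ler_wpM2r => //; rewrite subr_ge0 ltW.
have k2 : dL L y v * (c - b) <= (dL L y a - eta * (a - c)) * (c - b).
  by apply: ler_wpM2r; [rewrite subr_ge0 ltW|lra].
have k3 : eta * (s / 2) * (s / 2) <= eta * (a - c) * (c - b).
  have -> : a - c = s / 2 by rewrite /c; ring.
  apply: ler_wpM2l; [rewrite mulr_ge0// divr_ge0// ltW//|rewrite /c; lra].
rewrite expr2; nra.
Qed.

Lemma loss_gap_ge0 y a b : 0 <= L y b - L y a - dL L y a * (b - a).
Proof.
have [ab|ba|->] := ltgtP a b; last by rewrite !subrr mulr0 subr0.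
  have [c /andP[ac _] ->] := loss_MVT y ab.
  by rewrite -mulrBl mulr_ge0 ?subr_ge0 ?(ltW ab)// dL_ler// ltW.
have [c /andP[_ ca] e] := loss_MVT y ba.
rewrite -[L y b - L y a]opprB e -mulrN opprB -mulrBl mulr_le0// subr_le0 ?(ltW ba)//.
by rewrite dL_ler// ltW.
Qed.

Hypothesis inf_d2L_cont : continuous (inf_d2L L : R -> R).

(* The cap at [1] makes a lower bound on [inf_d2L] near [a] sufficient: beyond
   distance [1], convexity propagates the gap already gained. *)
Lemma loss_curvature (M : R) : 0 <= M -> exists2 eta : R, 0 < eta &
  forall y a b, `|a| <= M ->
  eta * Num.min `|b - a| 1 ^+ 2 <= L y b - L y a - dL L y a * (b - a).
Proof.
move=> M0.
have M1 : - (M + 1) <= M + 1 by lra.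
have [c _ hc] := @EVT_min R (inf_d2L L) _ _ M1
  (continuous_subspaceT inf_d2L_cont).
exists (inf_d2L L c / 4); first by rewrite divr_gt0.
have hM mu : - (M + 1) <= mu <= M + 1 -> inf_d2L L c <= inf_d2L L mu.
  by move=> h; apply: hc; rewrite in_itv.
have c0 := ltW (d2L_gt0 c).
move=> y a b aM; have [ab|ba] := leP a b.
  by rewrite ger0_norm ?subr_ge0//; exact: (loss_curvature_right c0 hM).
by rewrite distrC gtr0_norm ?subr_gt0//; apply: (loss_curvature_left c0 hM) => //; exact: ltW.
Qed.

End loss.

Section smooth_loss.
Context {R : realType} {Y : Type} (L : Y -> R -> R) (Lu : R).
Hypothesis dL1 : forall y mu, derivable (L y : R -> R^o) mu 1.
Hypothesis dL_lip :
  forall y mu1 mu2, `|dL L y mu1 - dL L y mu2| <= Lu * `|mu1 - mu2|.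

Lemma loss_quadratic_bound (y : Y) (a b : R) : 0 <= Lu ->
  `|L y b - L y a - dL L y a * (b - a)| <= Lu * (b - a) ^+ 2.
Proof.
move=> Lu0.
(* The base point [x] is free in the interval, so either endpoint can serve and both orders of [a]
   and [b] are covered. *)
have H u v : u < v -> forall x, u <= x <= v ->
    `|L y v - L y u - dL L y x * (v - u)| <= Lu * (v - u) ^+ 2.
  move=> uv x /andP[ux xv]; have [c /andP[uc cv] ->] := loss_MVT dL1 y uv.
  rewrite -mulrBl normrM (gtr0_norm (_ : 0 < v - u)) ?subr_gt0//.
  rewrite expr2 mulrA; apply: ler_wpM2r; first by rewrite subr_ge0 ltW.
  apply: le_trans (dL_lip _ _ _) _; apply: ler_wpM2l => //.
  rewrite ler_norml; lra.
have [ab|ba|->] := ltgtP a b; last by rewrite !subrr mulr0 subr0 normr0 expr0n/= mulr0.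
  by apply: H => //; rewrite lexx ltW.
rewrite -normrN opprB; have -> : dL L y a * (b - a) - (L y b - L y a) =
  L y a - L y b - dL L y a * (a - b) by ring.
rewrite (_ : (b - a) ^+ 2 = (a - b) ^+ 2); last by ring.
by apply: H => //; rewrite lexx ltW.
Qed.

Lemma dL_growth (y : Y) (mu : R) : `|dL L y mu| <= `|dL L y 0| + Lu * `|mu|.
Proof.
have := dL_lip y mu 0; rewrite subr0 => h.
rewrite -[X in `|X| <= _](subrK (dL L y 0)) addrC.
by apply: le_trans (ler_normD _ _) _; rewrite lerD2l.
Qed.

End smooth_loss.

(** * The smallest eigenvalue of a symmetric matrix bounds its quadratic form *)

Section spectral_bound.
Context {R : realType} {p : nat} (A : 'M[R]_p.+1).
Hypothesis symA : A^T = A.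

Let bil (u v : 'rV[R]_p.+1) : R := (u *m A *m v^T) 0 0.
Let ip (u v : 'rV[R]_p.+1) : R := (u *m v^T) 0 0.

Let bilDl u u' v : bil (u + u') v = bil u v + bil u' v.
Proof. by rewrite /bil !mulmxDl !mxE. Qed.
Let bilDr u v v' : bil u (v + v') = bil u v + bil u v'.
Proof. by rewrite /bil linearD/= mulmxDr !mxE. Qed.
Let bilZl t u v : bil (t *: u) v = t * bil u v.
Proof. by rewrite /bil -!scalemxAl !mxE. Qed.
Let bilZr t u v : bil u (t *: v) = t * bil u v.
Proof. by rewrite /bil linearZ/= -scalemxAr !mxE. Qed.
Let bilC u v : bil u v = bil v u.
Proof. by rewrite /bil -[in LHS](trmxK (u *m A *m v^T)) mxE !trmx_mul trmxK symA mulmxA. Qed.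
Let ipDl u u' v : ip (u + u') v = ip u v + ip u' v.
Proof. by rewrite /ip !mulmxDl !mxE. Qed.
Let ipDr u v v' : ip u (v + v') = ip u v + ip u v'.
Proof. by rewrite /ip linearD/= mulmxDr !mxE. Qed.
Let ipZl t u v : ip (t *: u) v = t * ip u v.
Proof. by rewrite /ip -!scalemxAl !mxE. Qed.
Let ipZr t u v : ip u (t *: v) = t * ip u v.
Proof. by rewrite /ip linearZ/= -scalemxAr !mxE. Qed.
Let ipC u v : ip u v = ip v u.
Proof. by rewrite /ip -[in LHS](trmxK (u *m v^T)) mxE !trmx_mul trmxK. Qed.
Let ipE u v : ip u v = \sum_i u 0 i * v 0 i.
Proof. by rewrite /ip mxE; apply: eq_bigr => i _; rewrite mxE. Qed.
Let ip_ge0 u : 0 <= ip u u.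
Proof. by rewrite ipE sumr_ge0// => i _; rewrite -expr2 sqr_ge0. Qed.
Let ip_gt0 u : u != 0 -> 0 < ip u u.
Proof.
move=> u0; rewrite lt_neqAle ip_ge0 andbT eq_sym; apply: contra u0 => /eqP h.
apply/eqP/rowP => i; rewrite mxE; apply/eqP.
rewrite -sqrf_eq0 expr2; apply/eqP.
by move: h; rewrite ipE => /psumr_eq0P -> // j _; rewrite -expr2 sqr_ge0.
Qed.

Let sphere : set 'rV[R]_p.+1 := [set v | ip v v = 1].

Let sum_continuous (I : Type) (s : seq I) (f : I -> 'rV[R]_p.+1 -> R) :
  (forall i, continuous (f i)) -> continuous (fun v => \sum_(i <- s) f i v).
Proof.
move=> hf; elim: s => [|i s IH].
  have -> : (fun v => \sum_(j <- [::]) f j v) = cst 0 by apply/funext => v; rewrite big_nil.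
  exact: cst_continuous.
have -> : (fun v => \sum_(j <- i :: s) f j v) = f i \+ (fun v => \sum_(j <- s) f j v).
  by apply/funext => v; rewrite big_cons.
by move=> v; apply: continuousD; [exact: hf|exact: IH].
Qed.

Let ip_continuous : continuous (fun v => ip v v).
Proof.
under eq_fun do rewrite ipE.
apply: sum_continuous => i v; apply: continuousM; exact: coord_continuous.
Qed.

Let bil_continuous : continuous (fun v => bil v v).
Proof.
rewrite (_ : (fun v => bil v v) =
  (fun v => \sum_j (\sum_i v 0 i * A i j) * v 0 j)); last first.
  by apply/funext => v; rewrite /bil mxE; apply: eq_bigr => j _; rewrite !mxE.
apply: sum_continuous => j v; apply: continuousM; last exact: coord_continuous.
apply: sum_continuous => i {}v; apply: continuousM; [exact: coord_continuous|exact: cst_continuous].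
Qed.

Let sphere_compact : compact sphere.
Proof.
apply: (subclosed_compact _ (rV_compact (fun i : 'I_p.+1 => @segment_compact R (-1) 1))).
  apply: (@preimage_closed _ _ (fun v => ip v v) [set 1]); last exact: closed_eq.
  by move=> v _; exact: ip_continuous.
move=> v; rewrite /sphere/= ipE => v1 i.
rewrite in_itv/= -ler_norml -(@expr_le1 _ 2)// -normrX ger0_norm ?sqr_ge0// expr2 -v1.
by rewrite (bigD1 i)//= lerDl sumr_ge0// => j _; rewrite -expr2 sqr_ge0.
Qed.

(** The form attains its minimum [mu] on the compact unit sphere, and a minimizer is an eigenvector;
    hence [lambda_min A <= mu], while [mu] bounds the form by homogeneity. *)
Lemma lambda_min_quadratic_form (v : 'rV[R]_p.+1) :
  lambda_min A * (v *m v^T) 0 0 <= (v *m A *m v^T) 0 0.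
Proof.
have sphere0 : sphere !=set0.
  exists (delta_mx 0 0); rewrite /sphere/= ipE (bigD1 0)//= !mxE !eqxx mulr1 big1 ?addr0//.
  by move=> j j0; rewrite mxE (negbTE j0) andbF mul0r.
have [v0] := compact_EVT_min sphere0 sphere_compact (continuous_subspaceT bil_continuous).
rewrite inE /sphere/= => v01 minv0.
set mu := bil v0 v0.
have lower u : mu * ip u u <= bil u u.
  have [->|u0] := eqVneq u 0.
    by rewrite -(scale0r (0 : 'rV_p.+1)) ipZl bilZl !mul0r mulr0.
  have iu := ip_gt0 u0; pose c := Num.sqrt (ip u u).
  have c0 : 0 < c by rewrite sqrtr_gt0.
  have cc : c ^+ 2 = ip u u by rewrite sqr_sqrtr// ltW.
  have : bil v0 v0 <= bil (c^-1 *: u) (c^-1 *: u).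
    by apply: minv0; rewrite inE/= ipZl ipZr -cc; field; rewrite gt_eqF.
  rewrite bilZl bilZr -/mu -cc => /(ler_wpM2l (sqr_ge0 c)).
  rewrite mulrC; congr (_ <= _).
  by field; rewrite gt_eqF.
(* First variation: along [v0 + t *: u] the excess of the form over [mu] is a nonnegative quadratic
   in [t] without constant term, so its linear coefficient [2 * g] vanishes; [t = - g / (h + 1)]
   would make it negative. *)
have eigv0 u : bil v0 u = mu * ip v0 u.
  apply/eqP; rewrite -subr_eq0; set g := _ - _; apply/negPn/negP => g0.
  have key t : 0 <= 2 * t * g + t ^+ 2 * (bil u u - mu * ip u u).
    have := lower (v0 + t *: u).
    rewrite !(bilDl, bilDr, bilZl, bilZr, ipDl, ipDr, ipZl, ipZr) v01 -/mu.
    rewrite (bilC u v0) (ipC u v0) /g -subr_ge0; congr (0 <= _); ring.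
  set h := bil u u - mu * ip u u in key.
  have h0 : 0 <= h by rewrite subr_ge0.
  have := key (- g / (h + 1)).
  have -> : 2 * (- g / (h + 1)) * g + (- g / (h + 1)) ^+ 2 * h =
      - (g ^+ 2 * (h + 2)) / (h + 1) ^+ 2 by field; rewrite gt_eqF// ltr_wpDl.
  apply/negP; rewrite -ltNge mulNr oppr_lt0 divr_gt0 ?exprn_gt0 ?ltr_wpDl//.
  by rewrite mulr_gt0 ?ltr_wpDl// exprn_even_gt0.
have v0n0 : v0 != 0.
  by apply/eqP => e; move/eqP: v01; rewrite e -(scale0r (0 : 'rV_p.+1)) ipZl mul0r eq_sym oner_eq0.
have eig : eigenvalue A mu.
  apply/eigenvalueP; exists v0 => //; apply/rowP => j.
  have := eigv0 (delta_mx 0 j); rewrite /bil /ip !trmx_delta -!colE.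
  by rewrite !mxE.
apply: le_trans (lower v); apply: ler_wpM2r; first exact: ip_ge0.
(* [inf] lies below the elements only of a set bounded below; [mu] itself bounds all eigenvalues. *)
apply: ge_inf => //; exists mu => a /eigenvalueP[u uA u0].
have := lower u; rewrite /bil uA -scalemxAl mxE -/(ip u u) ler_pM2r//.
exact: ip_gt0.
Qed.

End spectral_bound.

Lemma lambda_min_sum_le {R : realType} {p : nat} (A : 'M[R]_p) (b : 'cV[R]_p) :
  A^T = A -> lambda_min A * dotp b b <= \sum_i \sum_j b i 0 * b j 0 * A i j.
Proof.
case: p => [|p] in A b *; first by rewrite /dotp !big_ord0 mulr0.
move=> symA; have := lambda_min_quadratic_form symA b^T; rewrite trmxK.
congr (_ * _ <= _).
  by rewrite mxE; apply: eq_bigr => j _; rewrite mxE.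
rewrite mxE exchange_big/=; apply: eq_bigr => j _; rewrite mxE mulr_suml.
by apply: eq_bigr => i _; rewrite mxE; ring.
Qed.

(** * Measurability of the loss and its derivative at random predictors *)

Section caratheodory.
Context {R : realType} {d dY : measure_display} {T : measurableType d}
  {Y : measurableType dY}.

Import HBSimple.

(* Simple functions [g n] tend to [U], and [F (V w) (g n w)] is measurable
   since [g n] takes finitely many values. *)
Lemma caratheodory_measurable (F : Y -> R -> R) (V : T -> Y) (U : T -> R) :
  (forall mu, measurable_fun setT (F^~ mu)) -> (forall y, continuous (F y)) ->
  measurable_fun setT V -> measurable_fun setT U ->
  measurable_fun setT (fun w => F (V w) (U w)).
Proof.
move=> mF cF mV mU.
have mEU : measurable_fun setT (EFin \o U) by apply/measurable_EFinP.
have [g gU] := approximation_sfun measurableT mEU.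
refine (measurable_fun_cvg (h := fun n w => F (V w) (g n w)) _ _); last first.
  move=> w _; have /fine_cvg/= cg := gU w I.
  exact: continuous_cvg (cF (V w) (U w)) cg.
move=> n; have /finite_seqP[s rs] : finite_set (range (g n)) by exact: fimfunP.
have -> : (fun w => F (V w) (g n w)) =
    (fun w => \sum_(c <- undup s) \1_(g n @^-1` [set c]) w * F (V w) c).
  apply/funext => w.
  have gs : g n w \in undup s.
    by rewrite mem_undup; have : range (g n) (g n w) by []; rewrite rs.
  rewrite (bigD1_seq (g n w))//= ?undup_uniq// indicE mem_set// mul1r big1 ?addr0//.
  by move=> c cg; rewrite indicE memNset ?mul0r//= => /esym/eqP; rewrite (negbTE cg).
apply: measurable_sum => c; apply: measurable_funM.
  by apply: measurable_indic; rewrite -[X in measurable X]setTI; exact: measurable_funP.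
by apply: (measurableT_comp (mF c)).
Qed.

(** The derivative is the pointwise limit of the difference quotients with increments
    [harmonic n]. *)
Lemma dL_measurable (L : Y -> R -> R) (mu : R) :
  (forall nu, measurable_fun setT (L^~ nu)) ->
  (forall y nu, derivable (L y : R -> R^o) nu 1) ->
  measurable_fun setT (fun y => dL L y mu).
Proof.
move=> mL dL1.
refine (measurable_fun_cvg
  (h := fun n y => (harmonic n : R)^-1 * (L y (harmonic n + mu) - L y mu)) _ _).
  by move=> n; apply: measurable_funM => //; exact: measurable_funB.
move=> y _.
have dq : h^-1 * (L y (h + mu) - L y mu) @[h --> 0^'] --> dL L y mu.
  have := dL1 y mu; rewrite /derivable /dL /derive1.
  by under eq_fun do rewrite /= /GRing.scale/= mulr1.
apply: ((cvgr_dnbhsP _ 0 _).1 dq harmonic); split; last exact: cvg_harmonic.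
by move=> n; rewrite gt_eqF// harmonic_gt0.
Qed.

End caratheodory.

Lemma seqspace_coord_measurable {R : realType} (j : nat) :
  measurable_fun setT (fun s : seqspace R => s j).
Proof.
move=> _ B mB; rewrite setTI; apply: sub_sigma_algebra.
by exists j, B.
Qed.

(** One step of the method of conditional expectations. The index must have positive weight, so that
    the tuples built from it use only the models present in the combination, that is, the wrong
    ones. *)
Lemma exists_le_average {R : realFieldType} {I : finType} (om f : I -> R) :
  (forall k, 0 <= om k) -> \sum_k om k = 1 ->
  exists2 k, 0 < om k & f k <= \sum_k om k * f k.
Proof.
move=> om0 om1; apply: contrapT => nk; set a := \sum_k _ in nk.
have H k : 0 <= om k * (f k - a).
  have [->|omk] := eqVneq (om k) 0; first by rewrite !mul0r.
  rewrite mulr_ge0// subr_ge0; apply/ltW; rewrite ltNge; apply/negP => fk.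
  by apply: nk; exists k => //; rewrite lt_neqAle eq_sym omk om0.
have : \sum_k om k * (f k - a) = 0.
  under eq_bigr do rewrite mulrBr.
  by rewrite big_split/= sumrN -mulr_suml om1 mul1r subrr.
move/psumr_eq0P => /(_ (fun k _ => H k)) Z.
have : \sum_k om k = 0; last by move/eqP; rewrite om1 oner_eq0.
apply: big1 => k _; apply/eqP; apply/negPn/negP => omk.
have ok : 0 < om k by rewrite lt_neqAle eq_sym omk om0.
apply: nk; exists k => //; rewrite -subr_le0.
by have /eqP := Z k isT; rewrite mulf_eq0 (negbTE omk)/= => /eqP ->.
Qed.

(** * Empirical norms *)

Section maurey.
Context {R : realFieldType} {V : lmodType R} (bil : V -> V -> R).
Hypothesis bilDl : forall u u' v, bil (u + u') v = bil u v + bil u' v.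
Hypothesis bilZl : forall t u v, bil (t *: u) v = t * bil u v.
Hypothesis bilC : forall u v, bil u v = bil v u.

Lemma bil_sumr {I : Type} (s : seq I) (om : I -> R) (x : I -> V) u :
  bil u (\sum_(k <- s) om k *: x k) = \sum_(k <- s) om k * bil u (x k).
Proof.
elim: s => [|k s IH]; first by rewrite !big_nil bilC -(scale0r (0 : V)) bilZl mul0r.
by rewrite !big_cons bilC bilDl bilZl -IH !(bilC _ u).
Qed.

(* Maurey's empirical method, derandomised by conditional expectations: the
   right-hand side is the mean of [bil] over [m] independent draws from [om]. *)
Lemma maurey {I : finType} (om : I -> R) (x : I -> V) :
  (forall k, 0 <= om k) -> \sum_k om k = 1 ->
  forall (m : nat) (z : V), exists2 t : m.-tuple I, {in t, forall k, 0 < om k} &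
  let mu := \sum_k om k *: x k in
  let zt := z + \sum_(k <- t) x k in
  bil zt zt <= bil z z + 2 * m%:R * bil z mu + m%:R * (m%:R - 1) * bil mu mu
               + m%:R * \sum_k om k * bil (x k) (x k).
Proof.
move=> om0 om1; set mu := \sum_k om k *: x k; elim=> [|m IH] z.
  exists [tuple] => //=; rewrite big_nil addr0; lra.
(* [F k] is the bound for the remaining [m] draws once the first is [k]; its mean over [om] is the
   bound for [m.+1] draws. *)
pose F k := bil (z + x k) (z + x k) + 2 * m%:R * bil (z + x k) mu
            + m%:R * (m%:R - 1) * bil mu mu + m%:R * \sum_k om k * bil (x k) (x k).
have [k ok Fk] := exists_le_average F om0 om1.
have [t tpos tle] := IH (z + x k).
exists [tuple of k :: t].
  by move=> l; rewrite inE => /predU1P[->//|/tpos].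
rewrite /= big_cons addrA; apply: le_trans tle _; apply: le_trans Fk _.
have zmu : bil z mu = \sum_k om k * bil z (x k) by rewrite bil_sumr.
have mumu : bil mu mu = \sum_k om k * bil (x k) mu.
  by rewrite {2}/mu bil_sumr; under eq_bigr do rewrite bilC.
have -> : \sum_k om k * F k =
   \sum_k (om k * (bil z z + 2 * m%:R * bil z mu + m%:R * (m%:R - 1) * bil mu mu
            + m%:R * \sum_k om k * bil (x k) (x k)) + 2 * (om k * bil z (x k))
    + om k * bil (x k) (x k) + 2 * m%:R * (om k * bil (x k) mu)).
  apply: eq_bigr => l _; rewrite /F !bilDl !(bilC _ (z + x l)) !bilDl (bilC (x l) z).
  ring.
rewrite !big_split/= -!mulr_suml -!mulr_sumr -zmu -mumu om1 -natr1.
set S := \sum_k _; rewrite le_eqVlt; apply/orP; left; apply/eqP; ring.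
Qed.

End maurey.

Section restricted_eigenvalue.
Context {R : realType} {p n : nat} (X : 'I_n -> 'cV[R]_p).

Lemma dotpDl (u u' v : 'cV[R]_p) : dotp (u + u') v = dotp u v + dotp u' v.
Proof. by rewrite /dotp -big_split; apply: eq_bigr => j _; rewrite mxE mulrDl. Qed.

Lemma dotpZl t (u v : 'cV[R]_p) : dotp (t *: u) v = t * dotp u v.
Proof. by rewrite /dotp mulr_sumr; apply: eq_bigr => j _; rewrite mxE mulrA. Qed.

Lemma dotpC (u v : 'cV[R]_p) : dotp u v = dotp v u.
Proof. by apply: eq_bigr => j _; rewrite mulrC. Qed.

Lemma dotp_ge0 (u : 'cV[R]_p) : 0 <= dotp u u.
Proof. by apply: sumr_ge0 => j _; rewrite -expr2 sqr_ge0. Qed.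

Lemma dotp_delta (v : 'cV[R]_p) j : dotp (delta_mx j 0) v = v j 0.
Proof.
rewrite /dotp (bigD1 j)//= mxE !eqxx mul1r big1 ?addr0// => k kj.
by rewrite mxE (negbTE kj) mul0r.
Qed.

Lemma dotp0l (v : 'cV[R]_p) : dotp 0 v = 0.
Proof. by rewrite -(scale0r (0 : 'cV[R]_p)) dotpZl mul0r. Qed.

Lemma dotpNl (u v : 'cV[R]_p) : dotp (- u) v = - dotp u v.
Proof. by rewrite -scaleN1r dotpZl mulN1r. Qed.

Lemma dotpBl (u u' v : 'cV[R]_p) : dotp (u - u') v = dotp u v - dotp u' v.
Proof. by rewrite dotpDl dotpNl. Qed.

Lemma dotp_suml {I : Type} (s : seq I) (Q : pred I) (x : I -> 'cV[R]_p) v :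
  dotp (\sum_(k <- s | Q k) x k) v = \sum_(k <- s | Q k) dotp (x k) v.
Proof. by apply: (big_morph (dotp^~ v)) => [u u'|]; rewrite ?dotpDl ?dotp0l. Qed.

Definition emp_form (u v : 'cV[R]_p) : R := \sum_i dotp u (X i) * dotp v (X i).

Lemma emp_formDl u u' v : emp_form (u + u') v = emp_form u v + emp_form u' v.
Proof. by rewrite /emp_form -big_split; apply: eq_bigr => i _; rewrite dotpDl mulrDl. Qed.

Lemma emp_formZl t u v : emp_form (t *: u) v = t * emp_form u v.
Proof. by rewrite /emp_form mulr_sumr; apply: eq_bigr => i _; rewrite dotpZl mulrA. Qed.

Lemma emp_formC u v : emp_form u v = emp_form v u.
Proof. by apply: eq_bigr => i _; rewrite mulrC. Qed.

Lemma emp_form_ge0 u : 0 <= emp_form u u.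
Proof. by apply: sumr_ge0 => i _; rewrite -expr2 sqr_ge0. Qed.

(** The vertices of the l1 unit ball, encoded by a coordinate and a sign bit. *)
Definition sgn_basis (t : 'I_p * bool) : 'cV[R]_p := (-1) ^+ t.2 *: delta_mx t.1 0.

Definition norm1 (v : 'cV[R]_p) : R := \sum_j `|v j 0|.

(** Maurey's inequality for the form [D * dotp - emp_form], which may be indefinite. It is
    nonnegative at every sum of [m] vertices and at most [D] at a vertex; this leaves at least
    [- D / (m - 1)] at their mean [v / norm1 v]. *)
Lemma emp_form_le_norm1 (D : R) (m : nat) : (1 < m)%N -> 0 <= D ->
  (forall t : m.-tuple ('I_p * bool), let z := \sum_(k <- t) sgn_basis k in
     emp_form z z <= D * dotp z z) ->
  forall v, emp_form v v <= D * (dotp v v + norm1 v ^+ 2 / (m%:R - 1)).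
Proof.
move=> m1 D0 Ht v.
have m10 : (0 : R) < m%:R - 1 by rewrite subr_gt0 ltr1n.
have [n0|n0] := eqVneq (norm1 v) 0.
  have -> : v = 0.
    apply/matrixP => j k; rewrite (ord1 k) mxE; apply/eqP; rewrite -normr_eq0; apply/eqP.
    by move: n0; rewrite /norm1 => /psumr_eq0P -> .
  rewrite -(scale0r (0 : 'cV_p)) emp_formZl mul0r mulr_ge0// addr_ge0//.
    exact: dotp_ge0.
  by rewrite divr_ge0 ?sqr_ge0// ltW.
have n1 : 0 < norm1 v by rewrite lt_neqAle eq_sym n0 sumr_ge0.
(* Mass [|v_j| / norm1 v] on the vertex with the sign of [v_j], so that the mean is
   [v / norm1 v]. *)
pose om (t : 'I_p * bool) : R :=
  if (v t.1 0 < 0) == t.2 then `|v t.1 0| / norm1 v else 0.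
have om0 t : 0 <= om t by rewrite /om; case: ifP => // _; rewrite divr_ge0// ltW.
have sum_om (W : lmodType R) (f : 'I_p * bool -> W) : \sum_t om t *: f t =
    \sum_j (`|v j 0| / norm1 v) *: f (j, v j 0 < 0).
  transitivity (\sum_j \sum_b om (j, b) *: f (j, b)).
    by rewrite pair_big; apply: eq_bigr => -[].
  apply: eq_bigr => j _; rewrite (bigD1 (v j 0 < 0))//= {1}/om/= eqxx.
  by rewrite big1 ?addr0// => b /negbTE; rewrite /om/= eq_sym => ->; rewrite scale0r.
have om1 : \sum_t om t = 1.
  have := sum_om R^o (fun _ => 1); rewrite /GRing.scale/=.
  under eq_bigr do rewrite mulr1; move=> ->.
  by under eq_bigr do rewrite mulr1; rewrite -mulr_suml mulfV.
pose bil u w := D * dotp u w - emp_form u w.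
have bilDl u u' w : bil (u + u') w = bil u w + bil u' w.
  by rewrite /bil dotpDl emp_formDl; ring.
have bilZl a u w : bil (a *: u) w = a * bil u w.
  by rewrite /bil dotpZl emp_formZl; ring.
have bilC u w : bil u w = bil w u by rewrite /bil dotpC emp_formC.
have [t _ /=] := @maurey R _ bil bilDl bilZl bilC _ om sgn_basis om0 om1 m 0.
have -> : \sum_k om k *: sgn_basis k = (norm1 v)^-1 *: v.
  rewrite sum_om; apply/matrixP => j k; rewrite (ord1 k) summxE (bigD1 j)//= !mxE !eqxx.
  rewrite big1 => [|i ij]; last by rewrite !mxE eq_sym (negbTE ij) !mulr0.
  rewrite addr0 mulr1 mulrAC mulrC [in RHS](numEsg (v j 0)); congr (_ * _).
  by rewrite mulrC; have [v0|v0|->] := ltgtP (v j 0) 0;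
    rewrite ?(ltr0_sg v0) ?(gtr0_sg v0) ?normr0 ?mulr0.
rewrite add0r; have -> : bil 0 0 = 0 by rewrite -(scale0r (0 : 'cV_p)) bilZl mul0r.
have -> u : bil 0 u = 0 by rewrite -(scale0r (0 : 'cV_p)) bilZl mul0r.
have : 0 <= bil (\sum_(k <- t) sgn_basis k) (\sum_(k <- t) sgn_basis k).
  by rewrite /bil subr_ge0; exact: Ht.
have : \sum_k om k * bil (sgn_basis k) (sgn_basis k) <= D.
  rewrite -[leRHS]mul1r -om1 mulr_suml; apply: ler_sum => k _; rewrite ler_wpM2l//.
  rewrite /bil lerBlDr; apply: ler_wpDr; first exact: emp_form_ge0.
  rewrite /sgn_basis dotpZl dotpC dotpZl dotp_delta mxE !eqxx mulr1 -expr2 sqrr_sign mulr1//.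
set q := \sum_k om k * _; rewrite bilZl bilC bilZl; set Z := bil (\sum_(k <- t) _) _.
move=> qD Z0 Zle.
have m0 : (0 : R) < m%:R by rewrite ltr0n (ltn_trans _ m1).
set N := norm1 v in n1 n0 *.
have : 0 <= (m%:R - 1) * (N^-1 * (N^-1 * bil v v)) + D.
  rewrite -(pmulr_rge0 _ m0); apply: le_trans Z0 _; apply: le_trans Zle _.
  have := ler_wpM2l (ltW m0) qD; nra.
move=> H; rewrite -subr_ge0.
have -> : D * (dotp v v + N ^+ 2 / (m%:R - 1)) - emp_form v v =
    ((m%:R - 1) * (N^-1 * (N^-1 * bil v v)) + D) * (N ^+ 2 / (m%:R - 1)).
  by rewrite /bil; field; rewrite n0 gt_eqF.
by rewrite mulr_ge0// divr_ge0 ?sqr_ge0// ltW.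
Qed.

(** Maurey's inequality started at [- m *: b]: the terms in [emp_form b b] add up to
    [- m * emp_form b b <= 0], leaving [m * r], and rescaling by [m] divides this by [m ^+ 2]. *)
Lemma emp_form_approx {I : finType} (om : I -> R) (x : I -> 'cV[R]_p) (r : R) (m : nat) :
  (0 < m)%N -> (forall k, 0 <= om k) -> \sum_k om k = 1 ->
  (forall k, emp_form (x k) (x k) <= r) ->
  exists2 t : m.-tuple I, {in t, forall k, 0 < om k} &
    let w := \sum_k om k *: x k - m%:R^-1 *: \sum_(k <- t) x k in
    emp_form w w <= r / m%:R.
Proof.
move=> m0 om0 om1 xr; set b := \sum_k om k *: x k.
have m0R : (0 : R) < m%:R by rewrite ltr0n.
have [t tpos /=] := maurey emp_formDl emp_formZl emp_formC x om0 om1 m (- (m%:R *: b)).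
rewrite -/b => H; exists t => //=; set u := b - _.
have e : - (m%:R *: b) + \sum_(k <- t) x k = (- m%:R) *: u.
  by rewrite /u scalerBr !scaleNr scalerA mulfV ?gt_eqF// scale1r opprK.
have : emp_form ((- m%:R) *: u) ((- m%:R) *: u) <= m%:R * r.
  rewrite -e; apply: le_trans H _; rewrite -scaleNr !emp_formZl (emp_formC b) emp_formZl.
  have := emp_form_ge0 b.
  have : \sum_k om k * emp_form (x k) (x k) <= r.
    by rewrite -[leRHS]mul1r -om1 mulr_suml; apply: ler_sum => k _; rewrite ler_wpM2l.
  move=> /(ler_wpM2l (ltW m0R)); nra.
rewrite emp_formZl emp_formC emp_formZl mulrA => h.
rewrite -(ler_pM2l (_ : 0 < - m%:R * - m%:R :> R)); last by rewrite mulrNN mulr_gt0.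
by apply: le_trans h _; rewrite mulrNN -mulrA ler_pM2l// mulrCA mulfV ?mulr1// gt_eqF.
Qed.

End restricted_eigenvalue.

Section capped.
Context {R : realFieldType}.

(** Carries the small-ball bound from the Maurey average [y] to the true direction [x] with training
    error [z]: the triangle inequality survives the cap, and 3 is the cost of squaring three
    terms. *)
Lemma capped_sqr_le (x y z : R) :
  Num.min `|y| 1 ^+ 2 <= 3 * (Num.min `|x + z| 1 ^+ 2 + (x - y) ^+ 2 + z ^+ 2).
Proof.
set u := Num.min `|x + z| 1.
have u0 : 0 <= u by rewrite le_min normr_ge0 ler01.
have v0 : 0 <= Num.min `|y| 1 by rewrite le_min normr_ge0 ler01.
have h : Num.min `|y| 1 <= u + `|x - y| + `|z|.
  have [c|c] := leP `|x + z| 1.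
    have -> : u = `|x + z| by rewrite /u; apply/min_idPl.
    rewrite ge_min; apply/orP; left.
    rewrite {1}(_ : y = (x + z) - (x - y) - z); last by ring.
    by apply: le_trans (ler_normB _ _) _; rewrite lerD2r; apply: ler_normB.
  have -> : u = 1 by rewrite /u; apply/min_idPr; exact: ltW.
  by rewrite ge_min; apply/orP; right; rewrite -addrA lerDl addr_ge0.
have := ler_pM v0 v0 h h; rewrite -expr2 => /le_trans; apply.
rewrite -(real_normK (num_real (x - y))) -(real_normK (num_real z)).
set a := `|x - y|; set b := `|z|; rewrite -subr_ge0.
have -> : 3 * (u ^+ 2 + a ^+ 2 + b ^+ 2) - (u + a + b) * (u + a + b) =
  (u - a) ^+ 2 + (u - b) ^+ 2 + (a - b) ^+ 2 by ring.
by rewrite !addr_ge0// sqr_ge0.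
Qed.

Lemma capped_sqr_scale (t x : R) : 0 <= t <= 1 ->
  t ^+ 2 * Num.min `|x| 1 ^+ 2 <= Num.min `|t * x| 1 ^+ 2.
Proof.
move=> /andP[t0 t1].
have m0 z : 0 <= Num.min `|z| 1 :> R by rewrite le_min normr_ge0 ler01.
rewrite -exprMn ler_pXn2r// ?nnegrE ?m0 ?mulr_ge0// le_min.
apply/andP; split.
  by rewrite normrM (ger0_norm t0) ler_wpM2l// ge_min lexx.
by rewrite -[leRHS]mulr1 ler_pM// ge_min lexx orbT.
Qed.

End capped.

(** * The comparison inequality in terms of the scalar predictors *)

Section core_inequality.
Context {R : realFieldType} {n : nat}.
(** Predictions at observation [i]: [mu] at the truth, [s] for the training error of the comparison
    weight, [al] for the wrong direction, [alt] for its Maurey average, [r] for the training error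
    in that direction. The fitted weight predicts [mu + s + tau * (al + r)]. *)
Variables (Lf dLf : 'I_n -> R -> R) (mu s al r alt : 'I_n -> R).
Variables (tau eta Lu M N T phi c C eps : R).
Hypotheses (eta0 : 0 < eta) (T0 : 0 < T) (T1 : T <= 1) (N0 : 0 < N) (Lu0 : 0 <= Lu).
Hypotheses (C0 : 0 <= C) (tau01 : 0 <= tau <= 1).
Hypothesis curv : forall i a b, `|a| <= M + 1 ->
  eta * Num.min `|b - a| 1 ^+ 2 <= Lf i b - Lf i a - dLf i a * (b - a).
Hypothesis convx : forall i a b, 0 <= Lf i b - Lf i a - dLf i a * (b - a).
Hypothesis lip : forall i a b, `|dLf i a - dLf i b| <= Lu * `|a - b|.
Hypothesis opt : \sum_i Lf i (mu i + s i + tau * (al i + r i)) <= \sum_i Lf i (mu i + s i).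
Hypothesis Hs : \sum_i s i ^+ 2 <= C * N * T ^+ 2.
Hypothesis Hr : \sum_i r i ^+ 2 <= C * N * T ^+ 2.
Hypothesis Hal : \sum_i al i ^+ 2 <= C * N.
Hypothesis Happ : \sum_i (al i - alt i) ^+ 2 <= eps * N * phi.
Hypothesis Hlow : c * N * phi <= \sum_(i | `|mu i| <= M) Num.min `|alt i| 1 ^+ 2.
Hypothesis Hg1 : `|\sum_i dLf i (mu i) * al i| <= C * N * T.
Hypothesis Hg2 : `|\sum_i dLf i (mu i) * r i| <= C * N * T.
Hypothesis small : eps * phi + 2 * C * T ^+ 2 <= c * phi / 6.

(** Dividing [capped_sqr_le] by 3 leaves [c * phi / 3]; by [small], the Maurey error and the two
    training errors use up at most half of it. *)
Lemma core_lower : N * (c * phi / 6) <=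
  \sum_(i | `|mu i| <= M) Num.min `|al i + r i| 1 ^+ 2 - \sum_i s i ^+ 2.
Proof.
have : \sum_(i | `|mu i| <= M) Num.min `|alt i| 1 ^+ 2 <=
  3 * (\sum_(i | `|mu i| <= M) Num.min `|al i + r i| 1 ^+ 2 +
       \sum_i (al i - alt i) ^+ 2 + \sum_i r i ^+ 2).
  apply: (@le_trans _ _ (\sum_(i | `|mu i| <= M) 3 * (Num.min `|al i + r i| 1 ^+ 2 +
        (al i - alt i) ^+ 2 + r i ^+ 2))).
    by apply: ler_sum => i _; exact: capped_sqr_le.
  rewrite -mulr_sumr ler_pM2l// !big_split/= -!addrA lerD2l.
  by apply: lerD; rewrite big_mkcond/=; apply: ler_sum => i _; case: ifP => // _; exact: sqr_ge0.
move: Hlow Happ Hr Hs; set A := \sum_(i | _) _; set A' := \sum_(i | _) _.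
set B := \sum_i _; set D := \sum_i r i ^+ 2; set E := \sum_i s i ^+ 2.
move=> h1 h2 h3 h4 h5.
have := ler_wpM2l (ltW N0) small; nra.
Qed.

(** The expansion point is [mu + s], where curvature is known only up to [M + 1]. If [mu + s] lies
    beyond while [mu] is within [M], then [s] is at least 1 in absolute value, and subtracting
    [s ^+ 2] makes the left side nonpositive, so convexity suffices. *)
Lemma core_gap i :
  eta * tau ^+ 2 * ((if `|mu i| <= M then Num.min `|al i + r i| 1 ^+ 2 else 0) - s i ^+ 2)
  <= Lf i (mu i + s i + tau * (al i + r i)) - Lf i (mu i + s i)
     - dLf i (mu i + s i) * (tau * (al i + r i)).
Proof.
set x := al i + r i; set a := mu i + s i.
have ab : tau * x = a + tau * x - a by ring.
have s20 : 0 <= s i ^+ 2 by exact: sqr_ge0.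
have et : 0 <= eta * tau ^+ 2 by rewrite mulr_ge0 ?sqr_ge0// ltW.
have cv : 0 <= Lf i (a + tau * x) - Lf i a - dLf i a * (tau * x).
  by rewrite [in dLf i a * _]ab; exact: convx.
case: ifP => muM; last first.
  by apply: le_trans cv; rewrite mulr_ge0_le0// sub0r oppr_le0.
have [aM|aM] := leP `|a| (M + 1).
  apply: (@le_trans _ _ (eta * Num.min `|a + tau * x - a| 1 ^+ 2)); last first.
    by apply: le_trans (curv i (a + tau * x) aM) _; rewrite -ab.
  rewrite -ab -mulrA ler_pM2l//; apply: le_trans (capped_sqr_scale x tau01).
  by rewrite ler_wpM2l ?sqr_ge0// gerBl.
apply: le_trans cv; rewrite mulr_ge0_le0// subr_le0.
have s1 : 1 <= `|s i|.
  have := ler_normD (mu i) (s i); rewrite -/a => h.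
  by rewrite -(lerD2l M) ltW// (lt_le_trans aM)// (le_trans h)// lerD2r.
apply: (@le_trans _ _ 1).
  by rewrite exprn_ile1// ?ge_min ?lexx ?orbT// le_min normr_ge0 ler01.
by rewrite -(real_normK (num_real (s i))) exprn_ege1.
Qed.

Lemma core_inequality : eta * (c * phi / 6) * tau <= (2 + 3 * Lu) * C * T.
Proof.
have /andP[tau0 tau1] := tau01.
have [->|taun0] := eqVneq tau 0.
  by rewrite mulr0 !mulr_ge0// ?addr_ge0// ?mulr_ge0// ltW.
have taup : 0 < tau by rewrite lt_neqAle eq_sym taun0.
pose D i := Lf i (mu i + s i + tau * (al i + r i)) - Lf i (mu i + s i)
     - dLf i (mu i + s i) * (tau * (al i + r i)).
have sumD : eta * tau ^+ 2 * (N * (c * phi / 6)) <= \sum_i D i.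
  apply: (@le_trans _ _ (\sum_i eta * tau ^+ 2 * ((if `|mu i| <= M then
      Num.min `|al i + r i| 1 ^+ 2 else 0) - s i ^+ 2))); last first.
    by apply: ler_sum => i _; exact: core_gap.
  rewrite -mulr_sumr ler_wpM2l ?mulr_ge0 ?sqr_ge0// ?(ltW eta0)//.
  by rewrite big_split/= sumrN -big_mkcond; exact: core_lower.
have first i : - (dLf i (mu i + s i) * (tau * (al i + r i))) <=
   tau * (- (dLf i (mu i) * al i) - dLf i (mu i) * r i
          + Lu * (s i ^+ 2 / T / 2 + T * (al i ^+ 2 + r i ^+ 2))).
  rewrite mulrCA -mulrN ler_pM2l//.
  set x := al i + r i.
  have -> : - (dLf i (mu i + s i) * x) =
    - (dLf i (mu i) * x) - (dLf i (mu i + s i) - dLf i (mu i)) * x by ring.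
  have -> : - (dLf i (mu i) * al i) - dLf i (mu i) * r i = - (dLf i (mu i) * x) by rewrite /x; ring.
  rewrite lerD2l; apply: le_trans (ler_norm _) _; rewrite normrN normrM.
  apply: (@le_trans _ _ (Lu * `|s i| * `|x|)).
    rewrite ler_wpM2r//; apply: le_trans (lip _ _ _) _.
    by rewrite [mu i + _]addrC addrK.
  rewrite -mulrA ler_wpM2l//.
  (* Young's inequality with weight [T]: as the sum of [s ^+ 2] is of order [N * T ^+ 2] and that of
     [x ^+ 2] of order [N], both halves are of order [N * T]. *)
  apply: (@le_trans _ _ (s i ^+ 2 / T / 2 + T * x ^+ 2 / 2)).
    rewrite -(real_normK (num_real (s i))) -(real_normK (num_real x)) -subr_ge0.
    have -> : `|s i| ^+ 2 / T / 2 + T * `|x| ^+ 2 / 2 - `|s i| * `|x| =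
      T / 2 * (`|s i| / T - `|x|) ^+ 2 by field; rewrite gt_eqF.
    by rewrite mulr_ge0 ?sqr_ge0// divr_ge0// ltW.
  rewrite lerD2l -mulrA ler_pM2l// -subr_ge0.
  have -> : al i ^+ 2 + r i ^+ 2 - x ^+ 2 / 2 = (al i - r i) ^+ 2 / 2 by rewrite /x; field.
  by rewrite divr_ge0// sqr_ge0.
have sumD2 : \sum_i D i <= tau * ((2 + 3 * Lu) * C * T * N).
  apply: (@le_trans _ _ (\sum_i - (dLf i (mu i + s i) * (tau * (al i + r i))))).
    by rewrite /D big_split/= gerDr big_split/= sumrN subr_le0; exact: opt.
  apply: le_trans (ler_sum _ (fun i _ => first i)) _.
  rewrite -mulr_sumr ler_pM2l// !big_split/= !sumrN -mulr_sumr big_split/= -mulr_sumr big_split/=.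
  rewrite -!mulr_suml.
  have h1 := le_trans (ler_norm _) (eq_ind_r (fun z => z <= _) Hg1 (normrN _)).
  have h2 := le_trans (ler_norm _) (eq_ind_r (fun z => z <= _) Hg2 (normrN _)).
  have h3 : (\sum_i s i ^+ 2) / T / 2 <= C * N * T / 2.
    rewrite ler_pM2r// ler_pdivrMr//; apply: le_trans Hs _; rewrite expr2; lra.
  have h4 : T * (\sum_i al i ^+ 2 + \sum_i r i ^+ 2) <= T * (2 * (C * N)).
    rewrite ler_pM2l//.
    have : C * N * T ^+ 2 <= C * N * 1.
      by rewrite ler_wpM2l ?mulr_ge0 ?(ltW N0)// exprn_ile1// ltW.
    by move: Hal Hr; lra.
  (* The gradient terms contribute 1 each and the shift of the gradient [1 / 2 + 2 <= 3] times [Lu];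
     this is [2 + 3 * Lu]. *)
  have h5 := ler_wpM2l Lu0 (lerD h3 h4).
  have h6 : 0 <= Lu * (C * N * T) by rewrite !mulr_ge0// ltW.
  by move: h1 h2 h5 h6; lra.
have := le_trans sumD sumD2.
rewrite expr2 -(ler_pM2l taup) => h.
rewrite -(ler_pM2r (_ : 0 < tau * N)) ?mulr_gt0//.
rewrite -(ler_pM2l taup); nra.
Qed.

End core_inequality.

(** * Sub-gaussian moments *)

Section real_expectation.
Context {R : realType} {d : measure_display} {T : measurableType d}
  (P : probability T R).

Implicit Types (f g : T -> R) (k : R).

Definition intg (f : T -> R) : Prop := P.-integrable setT (EFin \o f).

Definition expect (f : T -> R) : R := fine (\int[P]_w (f w)%:E)%E.

Lemma intg_measurable f : intg f -> measurable_fun setT f.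
Proof. by move=> /measurable_int/measurable_EFinP. Qed.

Lemma integral_expect f : intg f -> (\int[P]_w (f w)%:E)%E = (expect f)%:E.
Proof. by move=> If; rewrite fineK// integrable_fin_num. Qed.

Lemma intgD f g : intg f -> intg g -> intg (fun w => f w + g w).
Proof. by move=> If Ig; exact: (integrableD measurableT If Ig). Qed.

Lemma intgB f g : intg f -> intg g -> intg (fun w => f w - g w).
Proof. by move=> If Ig; exact: (integrableB measurableT If Ig). Qed.

Lemma intgZ (k : R) f : intg f -> intg (fun w => k * f w).
Proof. by move=> If; exact: (integrableZl measurableT k If). Qed.

Lemma intg_cst (k : R) : intg (fun _ => k).
Proof. exact: finite_measure_integrable_cst. Qed.

Lemma intg_sum {I : Type} (s : seq I) (f : I -> T -> R) :
  (forall i, intg (f i)) -> intg (fun w => \sum_(i <- s) f i w).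
Proof.
move=> If; elim: s => [|i s IH].
  by under eq_fun do rewrite big_nil; exact: intg_cst.
by under eq_fun do rewrite big_cons; exact: intgD.
Qed.

Lemma intg_dominated f g : measurable_fun setT f -> (forall w, `|f w| <= g w) ->
  intg g -> intg f.
Proof.
move=> mf fg Ig; apply: (le_integrable measurableT _ _ Ig).
  exact/measurable_EFinP.
move=> w _; rewrite /= lee_fin; apply: le_trans (fg w) (ler_norm _).
Qed.

Lemma ge0_integral_le_intg f (B : R) : measurable_fun setT f -> (forall w, 0 <= f w) ->
  (\int[P]_w (f w)%:E <= B%:E)%E -> intg f.
Proof.
move=> mf f0 fB; apply/integrableP; split; first exact/measurable_EFinP.
under eq_integral do rewrite /= ger0_norm//.
by apply: le_lt_trans fB _; rewrite ltry.
Qed.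

Lemma expectD f g : intg f -> intg g ->
  expect (fun w => f w + g w) = expect f + expect g.
Proof. by move=> If Ig; exact: (RintegralD measurableT If Ig). Qed.

Lemma expectB f g : intg f -> intg g ->
  expect (fun w => f w - g w) = expect f - expect g.
Proof. by move=> If Ig; exact: (RintegralB measurableT If Ig). Qed.

Lemma expectZ k f : intg f -> expect (fun w => k * f w) = k * expect f.
Proof. by move=> If; exact: (RintegralZl k measurableT If). Qed.

Lemma expect_cst k : expect (fun _ => k) = k.
Proof.
by rewrite /expect -[fun _ => _]/(cst k%:E) integral_cst//= probability_setT mule1.
Qed.

Lemma expect_le f g : intg f -> intg g -> (forall w, f w <= g w) ->
  expect f <= expect g.
Proof. by move=> If Ig fg; exact: (le_Rintegral measurableT If Ig). Qed.

Lemma expect_sum {I : Type} (s : seq I) (f : I -> T -> R) :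
  (forall i, intg (f i)) ->
  expect (fun w => \sum_(i <- s) f i w) = \sum_(i <- s) expect (f i).
Proof.
move=> If; elim: s => [|i s IH].
  by under eq_fun do rewrite big_nil; rewrite expect_cst big_nil.
under eq_fun do rewrite big_cons; rewrite expectD//; first by rewrite IH big_cons.
exact: intg_sum.
Qed.

Lemma expect_le_integral f (B : R) : (\int[P]_w (f w)%:E <= B%:E)%E -> intg f ->
  expect f <= B.
Proof. by move=> fB If; rewrite -lee_fin -integral_expect. Qed.

(** An infimum yields an admissible [t] strictly below any larger number, here [2 * K], and the
    moment decreases in [t]. This is the source of the factors [2 * Kx] and [2 * Ky]. *)
Lemma psi2norm_expR (u : T -> R) (K : R) : 0 < K -> measurable_fun setT u ->
  (psi2norm P u <= K%:E)%E ->
  (\int[P]_w (expR (u w ^+ 2 / (2 * K) ^+ 2))%:E <= 2%:E)%E.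
Proof.
move=> K0 mu uK.
have : (psi2norm P u < (2 * K)%:E)%E.
  by apply: le_lt_trans uK _; rewrite lte_fin ltr_pMl// ltr1n.
rewrite /psi2norm => /ereal_inf_lt[_ [t /= [t0 ht] <-]]; rewrite lte_fin => tK.
apply: le_trans ht; rewrite unlock; apply: ge0_le_integral => //.
- by apply/measurable_EFinP; apply: measurableT_comp => //; apply: measurable_funM => //;
    apply: measurable_funX.
- by apply/measurable_EFinP; apply: measurableT_comp => //; apply: measurable_funM => //;
    apply: measurable_funX.
move=> w _; rewrite lee_fin ler_expR ler_wpM2l ?sqr_ge0//.
by rewrite lef_pV2 ?posrE ?exprn_gt0 ?mulr_gt0// ler_pXn2r// ?nnegrE ltW// mulr_gt0.
Qed.

End real_expectation.

Lemma lqnorm2E {R : realType} {p : nat} (v : 'cV[R]_p) :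
  lqnorm 2 v = Num.sqrt (dotp v v).
Proof.
rewrite /lqnorm powR12_sqrt; last by rewrite sumr_ge0// => j _; rewrite powR_ge0.
congr Num.sqrt; apply: eq_bigr => j _.
by rewrite powR_mulrn// real_normK ?num_real// expr2.
Qed.

Section subgaussian_vector.
Context {R : realType} {d : measure_display} {T : measurableType d}
  (P : probability T R) {p : nat} (X : T -> 'cV[R]_p) (Kx : R).
Hypothesis mX : forall j, measurable_fun setT (fun w => X w j 0).
Hypothesis Kx0 : 0 < Kx.
Hypothesis psiX : psi2norm_vec P X = Kx%:E.

Lemma dotp_measurable b : measurable_fun setT (fun w => dotp b (X w)).
Proof.
by rewrite /dotp; apply: measurable_sum => j; apply: measurable_funM.
Qed.

(** [sg] is only an upper bound of the squared norm, which admits [b = 0]; otherwise [b] is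
    normalised to a unit vector. *)
Lemma dotp_expR (b : 'cV[R]_p) (sg : R) : 0 < sg -> dotp b b <= sg ->
  (\int[P]_w (expR (dotp b (X w) ^+ 2 / ((2 * Kx) ^+ 2 * sg)))%:E <= 2%:E)%E.
Proof.
move=> sg0 bsg; have [b0|bn0] := eqVneq (dotp b b) 0.
  have -> : b = 0.
    apply/matrixP => j k; rewrite (ord1 k) mxE; apply/eqP; rewrite -sqrf_eq0 expr2; apply/eqP.
    by move: b0 => /psumr_eq0P -> // i _; rewrite -expr2 sqr_ge0.
  under eq_integral do rewrite dotp0l expr0n/= mul0r expR0.
  by rewrite -[fun _ => _]/(cst 1%:E) integral_cst//= probability_setT mule1 lee_fin ler1n.
have bp : 0 < dotp b b by rewrite lt_neqAle eq_sym bn0 dotp_ge0.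
pose c := Num.sqrt (dotp b b); have c0 : 0 < c by rewrite sqrtr_gt0.
have cc : c ^+ 2 = dotp b b by rewrite sqr_sqrtr// ltW.
pose v := c^-1 *: b.
have vv : dotp v v = 1.
  by rewrite /v dotpZl dotpC dotpZl -cc; field; rewrite gt_eqF.
have psiv : (psi2norm P (fun w => dotp (X w) v) <= Kx%:E)%E.
  rewrite -psiX; apply: ereal_sup_ubound; exists v => //=.
  by rewrite lqnorm2E vv sqrtr1.
have mv : measurable_fun setT (fun w => dotp (X w) v).
  by under eq_fun do rewrite dotpC; exact: dotp_measurable.
apply: le_trans (psi2norm_expR Kx0 mv psiv).
apply: ge0_le_integral => //.
- by apply/measurable_EFinP; apply: measurableT_comp => //; apply: measurable_funM => //;
    apply: measurable_funX; exact: dotp_measurable.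
- by apply/measurable_EFinP; apply: measurableT_comp => //; apply: measurable_funM => //;
    apply: measurable_funX.
move=> w _; rewrite lee_fin ler_expR.
rewrite (_ : dotp (X w) v = c^-1 * dotp b (X w)); last by rewrite /v dotpC dotpZl.
rewrite [(c^-1 * _) ^+ 2]exprMn exprVn cc; set u := dotp b (X w) ^+ 2; set k := (2 * Kx) ^+ 2.
have k0 : 0 < k by rewrite exprn_gt0// mulr_gt0.
have -> : (dotp b b)^-1 * u / k = u / k * (dotp b b)^-1 by ring.
rewrite invfM mulrA ler_wpM2l ?divr_ge0 ?sqr_ge0// ?(ltW k0)//.
by rewrite lef_pV2.
Qed.

End subgaussian_vector.

Section exponential_bounds.
Context {R : realType}.

Lemma expR_sub1_le (x : R) : expR x - 1 <= x * expR x.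
Proof.
have := expR_ge1Dx (- x); rewrite expRN => h.
have := ler_wpM2l (ltW (expR_gt0 x)) h; rewrite mulfV ?gt_eqF ?expR_gt0//; lra.
Qed.

Lemma expR_le_quadratic (x : R) : expR x <= 1 + x + x ^+ 2 * expR `|x|.
Proof.
have [x0|x0] := leP 0 x.
  have h := expR_sub1_le x.
  have := ler_wpM2l x0 h; rewrite ger0_norm//; nra.
have h : `|x| * (1 - expR x) <= `|x| * `|x|.
  by rewrite ler_wpM2l// ltr0_norm//; have := expR_ge1Dx x; lra.
have h2 := expR_sub1_le x.
have h3 : 1 <= expR `|x| by rewrite -expR0 ler_expR.
have h4 : x ^+ 2 <= x ^+ 2 * expR `|x| by rewrite ler_peMr// sqr_ge0.
move: h h4; rewrite ltr0_norm// => h h4; nra.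
Qed.

Lemma expRN_le_quadratic (z : R) : 0 <= z -> expR (- z) <= 1 - z + z ^+ 2.
Proof.
move=> z0; rewrite expRN.
have h : 1 + z <= expR z := expR_ge1Dx z.
apply: (@le_trans _ _ (1 + z)^-1).
  by rewrite lef_pV2// posrE ?expR_gt0// ltr_wpDr.
rewrite -[leLHS]mul1r ler_pdivrMr ?ltr_wpDr//.
have : 0 <= z ^+ 3 by rewrite exprn_ge0.
rewrite (_ : (1 - z + z ^+ 2) * (1 + z) = 1 + z ^+ 3); last by ring.
by rewrite lerDl.
Qed.

Lemma sqr_le_expR (t : R) : 0 <= t -> t ^+ 2 <= 2 * expR t.
Proof.
by move=> t0; have := expR_ge1Dxn 1 t0; rewrite (_ : 2`!%:R = 2); [lra|].
Qed.

(** A third of a sum is at most the largest summand. This replaces Hölder's inequality for a product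
    of three exponentials. *)
Lemma expRD3_le (x y z s : R) : s * 3 <= 1 -> 0 <= s -> 0 <= x -> 0 <= y -> 0 <= z ->
  expR (s * (x + y + z)) <= expR x + expR y + expR z.
Proof.
move=> s3 s0 x0 y0 z0.
have H a : x <= a -> y <= a -> z <= a -> expR (s * (x + y + z)) <= expR a.
  move=> xa ya za; rewrite ler_expR; have a0 := le_trans x0 xa.
  have := ler_wpM2l s0 (lerD (lerD xa ya) za); have := ler_wpM2r a0 s3; lra.
have ex := expR_gt0 x; have ey := expR_gt0 y; have ez := expR_gt0 z.
have [xy|yx] := leP x y; have [yz|zy] := leP y z.
- have := H z (le_trans xy yz) yz (lexx _); lra.
- have := H y xy (lexx _) (ltW zy); lra.
- have [xz|zx] := leP x z.
    have := H z xz yz (lexx _); lra.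
  have := H x (lexx _) (ltW yx) (ltW zx); lra.
- have := H x (lexx _) (ltW yx) (le_trans (ltW zy) (ltW yx)); lra.
Qed.

End exponential_bounds.

(** * Exponential moments of centred variables and the small-ball estimate *)

Section mgf.
Context {R : realType} {d : measure_display} {T : measurableType d}
  (P : probability T R).

Lemma expect_expR_bound (f g : T -> R) (B : R) : measurable_fun setT f ->
  intg P g -> (forall w, expR (f w) <= g w) -> expect P g <= B ->
  (\int[P]_w (expR (f w))%:E <= B%:E)%E.
Proof.
move=> mf Ig fg gB.
have If : intg P (fun w => expR (f w)).
  apply: (intg_dominated _ _ Ig); first by apply: measurableT_comp.
  by move=> w; rewrite ger0_norm ?expR_ge0.
by rewrite integral_expect// lee_fin (le_trans _ gB)// expect_le.
Qed.

Lemma mgf_centered (W : T -> R) (s B l : R) : 0 < s -> measurable_fun setT W ->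
  (\int[P]_w (expR (s * `|W w|))%:E <= B%:E)%E -> expect P W = 0 -> `|l| <= s / 2 ->
  (\int[P]_w (expR (l * W w))%:E <= (expR (8 * B / s ^+ 2 * l ^+ 2))%:E)%E.
Proof.
move=> s0 mW WB W0 ls.
have mE : measurable_fun setT (fun w => expR (s * `|W w|)).
  by apply: measurableT_comp => //; apply: measurable_funM => //; apply: measurableT_comp.
have IE : intg P (fun w => expR (s * `|W w|)).
  by apply: (ge0_integral_le_intg mE _ WB) => w; exact: expR_ge0.
have IW : intg P W.
  apply: (@intg_dominated _ _ _ _ _ (fun w => s^-1 * expR (s * `|W w|))) => //.
    move=> w; rewrite -ler_pdivrMl ?invr_gt0// invrK.
    by apply: le_trans (expR_ge1Dx _); rewrite lerDr.
  exact: intgZ.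
(* Since [|l| <= s / 2], half of the exponent [s * |W|] remains to absorb [W ^+ 2]:
   [t ^+ 2 <= 2 * expR t] at [t = s / 2 * |W|] gives the factor [8 / s ^+ 2]. Centring removes the
   linear term. *)
pose g w := 1 + l * W w + 8 / s ^+ 2 * l ^+ 2 * expR (s * `|W w|).
have Ig : intg P g.
  apply: intgD; last exact: intgZ.
  by apply: intgD; [exact: intg_cst|exact: intgZ].
apply: (expect_expR_bound (g := g)) => //.
- exact: measurable_funM.
- move=> w; apply: le_trans (expR_le_quadratic _) _; rewrite /g lerD2l.
  set a := `|W w|.
  have a0 : 0 <= a by exact: normr_ge0.
  have h1 : expR `|l * W w| <= expR (s / 2 * a).
    by rewrite ler_expR normrM ler_wpM2r.
  have h2 : (s / 2 * a) ^+ 2 <= 2 * expR (s / 2 * a).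
    by apply: sqr_le_expR; rewrite mulr_ge0// divr_ge0// ltW.
  have -> : expR (s * a) = expR (s / 2 * a) * expR (s / 2 * a).
    by rewrite -expRD; congr expR; field.
  have Wa : (l * W w) ^+ 2 = l ^+ 2 * a ^+ 2 by rewrite exprMn -(real_normK (num_real (W w))).
  set e := expR (s / 2 * a) in h1 h2 *.
  have e0 : 0 < e by exact: expR_gt0.
  have a2 : a ^+ 2 <= 8 / s ^+ 2 * e.
    rewrite mulrAC ler_pdivlMr ?exprn_gt0//; nra.
  rewrite Wa (_ : _ * (e * e) = l ^+ 2 * (8 / s ^+ 2 * e) * e); last by ring.
  apply: ler_pM => //.
  - by rewrite mulr_ge0 ?sqr_ge0.
  - by rewrite ler_wpM2l ?sqr_ge0.
rewrite /g expectD ?expectD ?expectZ//; [|exact: intg_cst|exact: intgZ|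
  by apply: intgD; [exact: intg_cst|exact: intgZ]|exact: intgZ].
rewrite W0 mulr0 addr0 expect_cst.
apply: le_trans (expR_ge1Dx _); rewrite lerD2l.
have EB := expect_le_integral WB IE.
have c0 : 0 <= 8 / s ^+ 2 * l ^+ 2 by rewrite mulr_ge0 ?sqr_ge0// divr_ge0 ?sqr_ge0.
have -> : 8 * B / s ^+ 2 * l ^+ 2 = 8 / s ^+ 2 * l ^+ 2 * B by ring.
exact: ler_wpM2l.
Qed.

Lemma fourth_moment (x : T -> R) (b : R) : 0 < b -> measurable_fun setT x ->
  (\int[P]_w (expR (x w ^+ 2 / b))%:E <= 2%:E)%E ->
  intg P (fun w => x w ^+ 4) /\ expect P (fun w => x w ^+ 4) <= 4 * b ^+ 2.
Proof.
move=> b0 mx xb.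
have mE : measurable_fun setT (fun w => expR (x w ^+ 2 / b)).
  by apply: measurableT_comp => //; apply: measurable_funM => //; exact: measurable_funX.
have IE : intg P (fun w => expR (x w ^+ 2 / b)).
  by apply: (ge0_integral_le_intg mE _ xb) => w; exact: expR_ge0.
have le w : x w ^+ 4 <= 2 * b ^+ 2 * expR (x w ^+ 2 / b).
  have h : (x w ^+ 2 / b) ^+ 2 <= 2 * expR (x w ^+ 2 / b).
    by apply: sqr_le_expR; rewrite divr_ge0 ?sqr_ge0// ltW.
  rewrite -mulrA mulrCA -ler_pdivrMl ?exprn_gt0//; apply: le_trans h.
  by rewrite expr_div_n -exprM mulrC.
have I4 : intg P (fun w => x w ^+ 4).
  apply: (@intg_dominated _ _ _ _ _ (fun w => 2 * b ^+ 2 * expR (x w ^+ 2 / b))).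
  - exact: measurable_funX.
  - by move=> w; rewrite ger0_norm// exprn_even_ge0.
  - exact: intgZ.
split => //; apply: le_trans (expect_le I4 (intgZ _ IE) le) _.
rewrite expectZ//; have := expect_le_integral xb IE.
by move=> /(ler_wpM2l (_ : 0 <= 2 * b ^+ 2)) h; apply: le_trans (h _) _;
  [rewrite mulr_ge0 ?sqr_ge0|rewrite le_eqVlt; apply/orP; left; apply/eqP; ring].
Qed.

(** Exchanges the cap for a fourth moment, small for large [H]; beyond 1 it is the
    arithmetic-geometric bound [x ^+ 2 <= H + x ^+ 4 / H]. *)
Lemma capped_sqr_lower (H x : R) : 1 <= H -> x ^+ 2 - x ^+ 4 / H <= H * Num.min `|x| 1 ^+ 2.
Proof.
move=> H1; have H0 : 0 < H by exact: lt_le_trans H1.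
have [x1|x1] := leP `|x| 1.
  rewrite real_normK ?num_real//; apply: (@le_trans _ _ (x ^+ 2)).
    by rewrite gerBl divr_ge0 ?exprn_even_ge0// ltW.
  by rewrite ler_peMl// sqr_ge0.
rewrite expr1n mulr1 lerBlDr -subr_ge0.
have -> : H + x ^+ 4 / H - x ^+ 2 = ((H - x ^+ 2 / 2) ^+ 2 + 3 / 4 * x ^+ 4) / H.
  by field; rewrite gt_eqF.
by rewrite divr_ge0 ?(ltW H0)// addr_ge0 ?sqr_ge0// mulr_ge0 ?exprn_even_ge0.
Qed.

(** One summand of the capped curvature: [x] is the prediction in the tested direction, [m] the one
    at the truth, outside [[-M, M]] of which the observation is discarded. *)
Definition ball_weight (M x m : R) : R :=
  if `|m| <= M then Num.min `|x| 1 ^+ 2 else 0.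

Lemma ball_weight_lower (H M x m : R) : 1 <= H -> 0 < M ->
  x ^+ 2 - x ^+ 4 / H - x ^+ 2 * m ^+ 2 / M ^+ 2 <= H * ball_weight M x m.
Proof.
move=> H1 M0; rewrite /ball_weight; case: ifPn => mM.
  apply: le_trans (capped_sqr_lower x H1); rewrite gerBl.
  by rewrite divr_ge0 ?sqr_ge0// mulr_ge0 ?sqr_ge0.
rewrite mulr0; apply: (@le_trans _ _ (x ^+ 2 - x ^+ 2 * m ^+ 2 / M ^+ 2)).
  rewrite lerB// gerBl divr_ge0 ?exprn_even_ge0//.
  by rewrite (le_trans ler01).
rewrite subr_le0 -mulrA ler_peMr ?sqr_ge0// ler_pdivlMr ?exprn_gt0// mul1r.
rewrite -ltNge in mM; rewrite -(real_normK (num_real m)) ler_pXn2r ?nnegrE ?(ltW M0)//.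
exact: ltW.
Qed.

Lemma ball_weight_bounds (M x m : R) :
  0 <= ball_weight M x m /\ ball_weight M x m <= x ^+ 2.
Proof.
rewrite /ball_weight; case: ifP => _; last by rewrite lexx sqr_ge0.
split; first by rewrite sqr_ge0.
rewrite -(real_normK (num_real x)) ler_pXn2r ?nnegrE ?le_min ?normr_ge0 ?ler01//.
by rewrite ge_min lexx.
Qed.

Lemma ball_weight_measurable (M : R) (x m : T -> R) : measurable_fun setT x ->
  measurable_fun setT m -> measurable_fun setT (fun w => ball_weight M (x w) (m w)).
Proof.
move=> mx mm; rewrite /ball_weight; apply: measurable_fun_ifT => //.
  by apply: measurable_fun_ler => //; exact: measurableT_comp.
apply: measurable_funX; apply: measurable_minr => //; exact: measurableT_comp.
Qed.

(** A lower tail needs only two moments of the weight, through [expR (- z) <= 1 - z + z ^+ 2]. The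
    conditions on [H] and [M] make each correction in [ball_weight_lower] cost a quarter of
    [kap * sg], and [th] makes the quadratic term half of the linear one. *)
Lemma small_ball_mgf (x m : T -> R) (k kap sg bet H M th : R) :
  0 < k -> 0 < kap -> 0 < sg -> 0 < bet -> 1 <= H -> 0 < M ->
  measurable_fun setT x -> measurable_fun setT m ->
  (\int[P]_w (expR (x w ^+ 2 / (k * sg)))%:E <= 2%:E)%E ->
  (\int[P]_w (expR (m w ^+ 2 / (k * bet)))%:E <= 2%:E)%E ->
  kap * sg <= expect P (fun w => x w ^+ 2) ->
  16 * k ^+ 2 * sg <= kap * H -> 8 * k ^+ 2 * (1 + bet ^+ 2) <= kap * M ^+ 2 ->
  th = kap / (16 * H * k ^+ 2) ->
  (\int[P]_w (expR (- (th / sg * ball_weight M (x w) (m w))))%:E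
     <= (expR (- (th * kap / (4 * H))))%:E)%E.
Proof.
move=> k0 kap0 sg0 bet0 H1 M0 mx mm Ex Em x2 hH hM thE.
have H0 : 0 < H by exact: lt_le_trans H1.
have ksg : 0 < k * sg by rewrite mulr_gt0.
have kbet : 0 < k * bet by rewrite mulr_gt0.
have th0 : 0 < th by rewrite thE divr_gt0// !mulr_gt0 ?exprn_gt0.
have l0 : 0 <= th / sg by rewrite divr_ge0// ltW.
have [Ix4 x4] := fourth_moment ksg mx Ex.
have [Im4 m4] := fourth_moment kbet mm Em.
have Ix2 : intg P (fun w => x w ^+ 2).
  apply: (@intg_dominated _ _ _ _ _ (fun w => 1 + x w ^+ 4)).
  - exact: measurable_funX.
  - move=> w; rewrite ger0_norm ?sqr_ge0//; have := sqr_ge0 (x w ^+ 2 - 1).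
    rewrite (_ : (x w ^+ 2 - 1) ^+ 2 = x w ^+ 4 - 2 * x w ^+ 2 + 1); last by ring.
    by have := sqr_ge0 (x w); lra.
  - by apply: intgD => //; exact: intg_cst.
(* With these weights both fourth moments contribute multiples of [sg], which keeps the estimate
   homogeneous in the direction. *)
have xm_le w : x w ^+ 2 * m w ^+ 2 <= (2 * sg)^-1 * x w ^+ 4 + sg / 2 * m w ^+ 4.
  rewrite -subr_ge0.
  have -> : (2 * sg)^-1 * x w ^+ 4 + sg / 2 * m w ^+ 4 - x w ^+ 2 * m w ^+ 2 =
    (x w ^+ 2 - sg * m w ^+ 2) ^+ 2 / (2 * sg) by field; rewrite gt_eqF.
  by rewrite divr_ge0 ?sqr_ge0// mulr_ge0// ltW.
have Ixm : intg P (fun w => x w ^+ 2 * m w ^+ 2).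
  apply: (@intg_dominated _ _ _ _ _ (fun w => (2 * sg)^-1 * x w ^+ 4 + sg / 2 * m w ^+ 4)).
  - by apply: measurable_funM; exact: measurable_funX.
  - by move=> w; rewrite ger0_norm// mulr_ge0 ?sqr_ge0.
  - by apply: intgD; exact: intgZ.
have Exm : expect P (fun w => x w ^+ 2 * m w ^+ 2) <= 2 * sg * k ^+ 2 * (1 + bet ^+ 2).
  apply: le_trans (expect_le Ixm (intgD (intgZ _ Ix4) (intgZ _ Im4)) xm_le) _.
  rewrite expectD ?expectZ//; try exact: intgZ.
  have a1 := ler_wpM2l (_ : 0 <= (2 * sg)^-1) x4.
  have a2 := ler_wpM2l (_ : 0 <= sg / 2) m4.
  apply: le_trans (lerD (a1 _) (a2 _)) _.
  - by rewrite invr_ge0 mulr_ge0// ltW.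
  - by rewrite divr_ge0// ltW.
  - by rewrite le_eqVlt; apply/orP; left; apply/eqP; field; rewrite gt_eqF.
pose l := th / sg.
pose g w := 1 + l ^+ 2 * x w ^+ 4 - l / H * (x w ^+ 2 - H^-1 * x w ^+ 4
              - (M ^+ 2)^-1 * (x w ^+ 2 * m w ^+ 2)).
have I1 : intg P (fun w => x w ^+ 2 - H^-1 * x w ^+ 4) by apply: intgB => //; exact: intgZ.
have I2 : intg P (fun w => x w ^+ 2 - H^-1 * x w ^+ 4 - (M ^+ 2)^-1 * (x w ^+ 2 * m w ^+ 2)).
  by apply: intgB => //; exact: intgZ.
have I3 : intg P (fun w => 1 + l ^+ 2 * x w ^+ 4) by apply: intgD; [exact: intg_cst|exact: intgZ].
have Ig : intg P g by apply: intgB => //; exact: intgZ.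
apply: (expect_expR_bound (g := g)) => //.
- apply: measurableT_comp => //; apply: measurable_funM => //; exact: ball_weight_measurable.
- move=> w; have [b0 b1] := ball_weight_bounds M (x w) (m w).
  set b := ball_weight _ _ _ in b0 b1 *.
  apply: le_trans (expRN_le_quadratic _) _; first by rewrite mulr_ge0.
  rewrite -/l /g -addrA [leRHS]addrAC -addrA lerD2l addrC [leRHS]addrC.
  apply: lerD.
    rewrite exprMn ler_wpM2l ?sqr_ge0// (_ : x w ^+ 4 = (x w ^+ 2) ^+ 2); last by rewrite -exprM.
    by rewrite ler_pXn2r ?nnegrE ?sqr_ge0.
  rewrite lerN2 -mulrA ler_wpM2l// -(ler_pM2l H0) mulrA mulfV ?gt_eqF// mul1r.
  have := ball_weight_lower (x w) (m w) H1 M0; rewrite -/b.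
  by rewrite [_ / H]mulrC [_ / M ^+ 2]mulrC.
rewrite /g expectB ?expectD ?expectZ ?expectB ?expectZ//; try exact: intgZ; try exact: intg_cst.
rewrite expect_cst; apply: le_trans (expR_ge1Dx _).
set e4 := expect _ _ in x4 *; set e2 := expect _ _ in x2 *; set em := expect _ _ in Exm *.
have lg : 0 < l by rewrite divr_gt0.
have b1 : e2 - H^-1 * e4 - (M ^+ 2)^-1 * em >= kap * sg / 2.
  have c1 : H^-1 * e4 <= kap * sg / 4.
    rewrite ler_pdivrMl//; apply: le_trans x4 _.
    have -> : 4 * (k * sg) ^+ 2 = (16 * k ^+ 2 * sg) * (sg / 4) by field.
    have -> : H * (kap * sg / 4) = kap * H * (sg / 4) by ring.
    by rewrite ler_wpM2r// divr_ge0// ltW.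
  have c2 : (M ^+ 2)^-1 * em <= kap * sg / 4.
    rewrite ler_pdivrMl ?exprn_gt0//; apply: le_trans Exm _.
    have -> : 2 * sg * k ^+ 2 * (1 + bet ^+ 2) = 8 * k ^+ 2 * (1 + bet ^+ 2) * (sg / 4) by field.
    have -> : M ^+ 2 * (kap * sg / 4) = kap * M ^+ 2 * (sg / 4) by ring.
    by rewrite ler_wpM2r// divr_ge0// ltW.
  lra.
have b2 := ler_wpM2l (_ : 0 <= l / H) b1.
have b3 := ler_wpM2l (sqr_ge0 l) x4.
have lH : 0 <= l / H by rewrite divr_ge0// ltW.
move: (b2 lH) b3; set D := l / H * (e2 - _ - _); move=> d1 d2.
have e1 : l / H * (kap * sg / 2) = 2 * (th * kap / (4 * H)).
  by rewrite /l; field; rewrite !gt_eqF.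
have e3 : l ^+ 2 * (4 * (k * sg) ^+ 2) = th * kap / (4 * H).
  by rewrite /l {1}thE; rewrite thE; field; rewrite !gt_eqF.
rewrite e1 in d1; rewrite e3 in d2; lra.
Qed.

End mgf.

(** * Integrability and stationarity at a minimizer of the risk *)

Section risk_minimizer.
Context {R : realType} {d : measure_display} {T : measurableType d}
  (P : probability T R).

(** If the negative part of [f0] had infinite integral, so would that of [f1], whose integral would
    be [-oo] by convention, and nothing is below [-oo]. The positive part is then finite because the
    integral of [f0] is below [+oo]. *)
Lemma integrable_of_lt_expectation (f0 f1 g : T -> R) :
  measurable_fun setT f0 -> measurable_fun setT f1 -> intg P g ->
  (forall w, `|f1 w - f0 w| <= g w) ->
  (\int[P]_w (f0 w)%:E < \int[P]_w (f1 w)%:E)%E -> intg P f0.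
Proof.
move=> m0 m1 Ig fg lt.
have g0 w : 0 <= g w by apply: le_trans (fg w).
have E0 : measurable_fun setT (EFin \o f0) by apply/measurable_EFinP.
have E1 : measurable_fun setT (EFin \o f1) by apply/measurable_EFinP.
have mg : measurable_fun setT (EFin \o g) by apply/measurable_EFinP/(intg_measurable Ig).
have neg0 : (\int[P]_w ((EFin \o f0)^\- w) < +oo)%E.
  rewrite ltey; apply/eqP => n0; move: lt.
  suff n1 : (\int[P]_w ((EFin \o f1)^\- w) = +oo)%E.
    by rewrite [X in (_ < X)%E]integralE n1 /= addeNy ltNge leNye.
  apply/eqP; rewrite -leye_eq -n0.
  have h : (\int[P]_w ((EFin \o f0)^\- w) <=
            \int[P]_w ((EFin \o f1)^\- w) + \int[P]_w (g w)%:E)%E.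
    rewrite -ge0_integralD//; [|exact: measurable_funeneg..|by move=> w _; rewrite lee_fin].
    apply: ge0_le_integral => //; [exact: measurable_funeneg| |].
      by apply: emeasurable_funD => //; exact: measurable_funeneg.
    move=> w _; rewrite funeneg.unlock/= -?EFinN -?EFin_max -EFinD lee_fin.
    have := fg w; rewrite ler_norml => /andP[h1 h2].
    rewrite ge_max; apply/andP; split; last by rewrite addr_ge0// le_max lexx orbT.
    apply: (@le_trans _ _ (- f1 w + g w)); first lra.
    by rewrite lerD2r le_max lexx.
  move: h; rewrite n0 (integral_expect Ig).
  by case: (\int[P]_w _)%E.
have lt0 : (\int[P]_w (f0 w)%:E < +oo)%E by exact: (lt_le_trans lt (leey _)).
have pos0 : (\int[P]_w ((EFin \o f0)^\+ w) < +oo)%E.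
  have n0 : (0 <= \int[P]_w ((EFin \o f0)^\- w))%E by apply: integral_ge0.
  rewrite ltey; apply/eqP => p0; move: lt0; rewrite integralE p0.
  by move: neg0 n0; case: (\int[P]_w (_^\- w))%E.
apply/integrableP; split => //.
rewrite (_ : (\int[P]_w _)%E = \int[P]_w ((EFin \o f0)^\+ w + (EFin \o f0)^\- w))%E; last first.
  by apply: eq_integral => w _; rewrite -[RHS]/(((EFin \o f0)^\+ \+ (EFin \o f0)^\-)%E w) -fune_abse.
rewrite ge0_integralD//; first exact: lte_add_pinfty.
- exact: measurable_funepos.
- exact: measurable_funeneg.
Qed.

Lemma zero_of_quadratic_ge0 (g c : R) :
  0 <= c -> (forall t, 0 <= t * g + t ^+ 2 * c) -> g = 0.
Proof.
move=> c0 H; apply/eqP/negPn/negP => gn0.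
have c1 : 0 < c + 1 by rewrite ltr_wpDl.
have := H (- g / (c + 1)).
have -> : - g / (c + 1) * g + (- g / (c + 1)) ^+ 2 * c = - (g ^+ 2 / (c + 1) ^+ 2).
  by field; rewrite gt_eqF.
apply/negP; rewrite -ltNge oppr_lt0 divr_gt0//; first by rewrite exprn_even_gt0.
by rewrite exprn_gt0.
Qed.

(** The Lipschitz derivative gives a second-order expansion with integrable remainder, so the risk
    along the line is bounded by a quadratic in [t], without differentiation under the integral. *)
Lemma risk_gradient_eq0 {Y : Type} (L : Y -> R -> R) (Lu : R) (V : T -> Y) (u x : T -> R) :
  0 <= Lu ->
  (forall y mu, derivable (L y : R -> R^o) mu 1) ->
  (forall y mu1 mu2, `|dL L y mu1 - dL L y mu2| <= Lu * `|mu1 - mu2|) ->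
  (forall t, measurable_fun setT (fun w => L (V w) (u w + t * x w))) ->
  intg P (fun w => L (V w) (u w)) -> intg P (fun w => dL L (V w) (u w) * x w) ->
  intg P (fun w => x w ^+ 2) ->
  (forall t, (\int[P]_w (L (V w) (u w))%:E <= \int[P]_w (L (V w) (u w + t * x w))%:E)%E) ->
  expect P (fun w => dL L (V w) (u w) * x w) = 0.
Proof.
move=> Lu0 dL1 lip mL IL IdL Ix2 opt.
apply: (@zero_of_quadratic_ge0 _ (Lu * expect P (fun w => x w ^+ 2))).
  by rewrite mulr_ge0// fine_ge0// integral_ge0// => w _; rewrite lee_fin sqr_ge0.
move=> t.
have bd w : `|L (V w) (u w + t * x w) - L (V w) (u w) - t * (dL L (V w) (u w) * x w)|
     <= t ^+ 2 * (Lu * x w ^+ 2).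
  have := loss_quadratic_bound dL1 lip (V w) (u w) (u w + t * x w) Lu0.
  rewrite (_ : u w + t * x w - u w = t * x w); last by ring.
  by rewrite exprMn => h; rewrite [t * (_ * _)]mulrCA (mulrCA (t ^+ 2)).
pose h w := L (V w) (u w) + t * (dL L (V w) (u w) * x w) + t ^+ 2 * (Lu * x w ^+ 2).
have Ih : intg P h by apply: intgD; [apply: intgD => //; exact: intgZ|do 2 apply: intgZ].
have IL' : intg P (fun w => L (V w) (u w + t * x w)).
  apply: (@intg_dominated _ _ _ _ _ (fun w => `|L (V w) (u w)|
     + `|t * (dL L (V w) (u w) * x w)| + t ^+ 2 * (Lu * x w ^+ 2))) => //.
    move=> w; have := bd w; set A := L _ (_ + _); set B := L _ _; set C := t * (_ * _) => k.
    rewrite [X in `|X|](_ : A = B + C + (A - B - C)); last by ring.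
    apply: le_trans (ler_normD _ _) _; apply: lerD => //; exact: ler_normD.
  apply: intgD; last by do 2 apply: intgZ.
  apply: intgD; apply: integrable_norm => //; exact: intgZ.
have := opt t; rewrite !integral_expect// lee_fin => le1.
have le2 : expect P (fun w => L (V w) (u w + t * x w)) <= expect P h.
  apply: expect_le => // w; have := bd w; rewrite ler_norml /h => /andP[_]; lra.
have := le_trans le1 le2; rewrite /h expectD ?expectD ?expectZ//; try exact: intgZ.
- by rewrite -addrA lerDl.
- by apply: intgD => //; exact: intgZ.
- by do 2 apply: intgZ.
Qed.

End risk_minimizer.

Section covariance_bound.
Context {R : realType} {d : measure_display} {T : measurableType d}
  (P : probability T R) {p : nat} (X : T -> 'cV[R]_p).
Hypothesis mX : forall j, measurable_fun setT (fun w => X w j 0).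
Hypothesis IX2 : forall j, intg P (fun w => X w j 0 ^+ 2).

(** The second moment exceeds the variance by the square of the mean, and the variance is the
    quadratic form of the covariance matrix. *)
Lemma second_moment_ge (kap : R) (b : 'cV[R]_p) : 0 <= kap -> kap <= lambda_min (covmx P X) ->
  kap * dotp b b <= expect P (fun w => dotp b (X w) ^+ 2).
Proof.
have IX j : intg P (fun w => X w j 0).
  apply: (@intg_dominated _ _ _ _ _ (fun w => 1 + X w j 0 ^+ 2)) => //.
    move=> w; rewrite -[X in 1 + X](real_normK (num_real _)).
    by have := sqr_ge0 (`|X w j 0| - 1 / 2); lra.
  by apply: intgD => //; exact: intg_cst.
have IXX i j : intg P (fun w => X w i 0 * X w j 0).
  apply: (@intg_dominated _ _ _ _ _ (fun w => X w i 0 ^+ 2 + X w j 0 ^+ 2)) => //.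
    exact: measurable_funM.
    move=> w; rewrite normrM -(real_normK (num_real (X w i 0))) -(real_normK (num_real (X w j 0))).
    have := sqr_ge0 (`|X w i 0| - `|X w j 0|); have := normr_ge0 (X w i 0).
    by have := normr_ge0 (X w j 0); nra.
  exact: intgD.
pose e j := expect P (fun w => X w j 0).
pose xc j w := X w j 0 - e j.
have Ixc i j : intg P (fun w => xc i w * xc j w).
  rewrite (_ : (fun w => _) = (fun w => X w i 0 * X w j 0 - e j * X w i 0
      - (e i * X w j 0 - e i * e j))); last by apply/funext => w; rewrite /xc; ring.
  apply: intgB; [apply: intgB => //; exact: intgZ|apply: intgB; [exact: intgZ|exact: intg_cst]].
have covE i j : covmx P X i j = expect P (fun w => xc i w * xc j w).
  rewrite mxE unlock /expect; congr fine; rewrite unlock.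
  by apply: eq_integral => w _.
move=> kap0 hkap; have symC : (covmx P X)^T = covmx P X.
  apply/matrixP => i j; rewrite mxE !covE; congr expect.
  by apply/funext => w; rewrite mulrC.
apply: (@le_trans _ _ (lambda_min (covmx P X) * dotp b b)).
  by rewrite ler_wpM2r// dotp_ge0.
apply: le_trans (lambda_min_sum_le b symC) _.
pose eb := \sum_j b j 0 * e j.
have bX w : dotp b (X w) - eb = \sum_j b j 0 * xc j w.
  by rewrite /dotp /eb -sumrB; apply: eq_bigr => j _; rewrite /xc; ring.
have IbX : intg P (fun w => dotp b (X w)) by apply: intg_sum => j; exact: intgZ.
have EbX : expect P (fun w => dotp b (X w)) = eb.
  by rewrite expect_sum => [|j]; [apply: eq_bigr => j _; rewrite expectZ|exact: intgZ].
have IbX2 : intg P (fun w => dotp b (X w) ^+ 2).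
  rewrite (_ : (fun w => _) = (fun w => \sum_i \sum_j b i 0 * b j 0 * (X w i 0 * X w j 0))).
    by apply: intg_sum => i; apply: intg_sum => j; exact: intgZ.
  apply/funext => w; rewrite expr2 mulr_suml; apply: eq_bigr => i _.
  by rewrite mulr_sumr; apply: eq_bigr => j _; ring.
have -> : \sum_i \sum_j b i 0 * b j 0 * covmx P X i j =
    expect P (fun w => (dotp b (X w) - eb) ^+ 2).
  rewrite (_ : (fun w => _) = (fun w => \sum_i \sum_j b i 0 * b j 0 * (xc i w * xc j w))).
    rewrite expect_sum; last by move=> i; apply: intg_sum => j; exact: intgZ.
    apply: eq_bigr => i _; rewrite expect_sum; last by move=> j; exact: intgZ.
    by apply: eq_bigr => j _; rewrite expectZ// covE.
  apply/funext => w; rewrite bX expr2 mulr_suml; apply: eq_bigr => i _.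
  by rewrite mulr_sumr; apply: eq_bigr => j _; ring.
rewrite (_ : (fun w => (_ - _) ^+ 2) =
  (fun w => dotp b (X w) ^+ 2 - (2 * eb * dotp b (X w) - eb ^+ 2))); last first.
  by apply/funext => w; ring.
rewrite expectB ?expectB ?expectZ ?expect_cst//; try exact: intgZ; try exact: intg_cst.
  by rewrite EbX; have := sqr_ge0 eb; lra.
by apply: intgB; [exact: intgZ|exact: intg_cst].
Qed.

End covariance_bound.

(** * Tail bounds for the sample *)

Section sample_tails.
Context {R : realType} {dY : measure_display} {Ycal : measurableType dY}.
Context {J : nat} (L : Ycal -> R -> R) (S : experiment R Ycal J).
Variables (Lu Kx Ky kappal Kbeta : R).
Hypotheses (Lu0 : 0 < Lu) (Kx0 : 0 < Kx) (Ky0 : 0 < Ky) (kap0 : 0 < kappal) (Kb0 : 0 < Kbeta).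
Hypothesis mL : forall mu, measurable_fun setT (L^~ mu).
Hypothesis dL1 : forall y mu, derivable (L y : R -> R^o) mu 1.
Hypothesis dL2 : forall y mu, derivable (dL L y : R -> R^o) mu 1.
Hypothesis lip : forall y mu1 mu2, `|dL L y mu1 - dL L y mu2| <= Lu * `|mu1 - mu2|.
Hypothesis data : data_model L S.
Hypothesis sub : subgaussian_design L S Kx Ky kappal.

Notation P := (Prob S).
Notation i0 := (first_obs S).
Notation n := (nobs S).
Notation p := (pdim S).

Lemma Yobs_measurable (i : 'I_n) : measurable_fun setT (@Yobs _ _ _ _ S i).
Proof. by case: data => -[]. Qed.

Lemma xcov_measurable (i : 'I_n) (j : nat) : measurable_fun setT (fun w : Omega S => xcov i w j).
Proof.
apply: (measurableT_comp (seqspace_coord_measurable j)).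
by case: data => -[_ []].
Qed.

Lemma Xobs_measurable (i : 'I_n) j : measurable_fun setT (fun w : Omega S => Xobs i w j 0).
Proof. by under eq_fun do rewrite mxE; exact: xcov_measurable. Qed.

Definition obs (i : 'I_n) (w : Omega S) : Ycal * seqspace R := (Yobs i w, xcov i w).

Lemma obs_measurable i : measurable_fun setT (obs i).
Proof.
apply: measurable_fun_pair; first exact: Yobs_measurable.
by case: data => -[_ []].
Qed.

Lemma obs_independent : mutually_independent P obs.
Proof. by case: data => _ []. Qed.

Lemma obs_identical : identically_distributed P obs.
Proof. by case: data => _ []. Qed.

(** The prediction as a function of the observed pair, on which independence and identical
    distribution are stated. *)
Definition lin (b : 'cV[R]_p) (z : Ycal * seqspace R) : R := \sum_j b j 0 * z.2 j.

Lemma lin_obs b i w : lin b (obs i w) = dotp b (Xobs i w).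
Proof. by apply: eq_bigr => j _; rewrite mxE. Qed.

Lemma lin_measurable b : measurable_fun setT (lin b).
Proof.
apply: measurable_sum => j; apply: measurable_funM => //.
by apply: (measurableT_comp (seqspace_coord_measurable j)).
Qed.

Lemma dotp_Xobs_measurable b i : measurable_fun setT (fun w : Omega S => dotp b (Xobs i w)).
Proof. by apply: dotp_measurable => j; exact: Xobs_measurable. Qed.

Lemma dotp_Xobs_expR b sg : 0 < sg -> dotp b b <= sg ->
  (\int[P]_w (expR (dotp b (Xobs i0 w) ^+ 2 / ((2 * Kx) ^+ 2 * sg)))%:E <= 2%:E)%E.
Proof.
case: sub => psiX _ _; apply: dotp_expR => //.
by move=> j; exact: Xobs_measurable.
Qed.

Lemma dotp_Xobs_sqr_intg b : intg P (fun w => dotp b (Xobs i0 w) ^+ 2).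
Proof.
have sg0 : 0 < dotp b b + 1 by rewrite ltr_wpDl// dotp_ge0.
have k0 : 0 < (2 * Kx) ^+ 2 * (dotp b b + 1) by rewrite mulr_gt0// exprn_gt0// mulr_gt0.
have bsg : dotp b b <= dotp b b + 1 by rewrite lerDl.
have [I4 _] := fourth_moment k0 (dotp_Xobs_measurable b i0) (dotp_Xobs_expR sg0 bsg).
apply: (@intg_dominated _ _ _ _ _ (fun w => 1 + dotp b (Xobs i0 w) ^+ 4)).
- by apply: measurable_funX; exact: dotp_Xobs_measurable.
- move=> w; rewrite ger0_norm ?sqr_ge0//; set x := dotp b _.
  have := sqr_ge0 (x ^+ 2 - 1).
  rewrite (_ : (x ^+ 2 - 1) ^+ 2 = x ^+ 4 - 2 * x ^+ 2 + 1); last by ring.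
  by have := sqr_ge0 x; lra.
- by apply: intgD => //; exact: intg_cst.
Qed.

Lemma second_moment_Xobs b : kappal * dotp b b <= expect P (fun w => dotp b (Xobs i0 w) ^+ 2).
Proof.
case: sub => _ _ hk; apply: second_moment_ge (ltW kap0) hk.
- by move=> j; exact: Xobs_measurable.
- move=> j; rewrite (_ : (fun w => _) = (fun w => dotp (delta_mx j 0) (Xobs i0 w) ^+ 2)).
    exact: dotp_Xobs_sqr_intg.
  by apply/funext => w; rewrite dotp_delta.
Qed.

Lemma empirical_norm_tail b (sg : R) : 0 < sg -> dotp b b <= sg ->
  (P [set w | (3 * (2 * Kx) ^+ 2 * sg * n%:R <= \sum_i dotp b (Xobs i w) ^+ 2)%R]
     <= (expR (- (2 * n%:R)))%:E)%E.
Proof.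
move=> sg0 bsg; have k0 : 0 < (2 * Kx) ^+ 2 * sg by rewrite !mulr_gt0// exprn_gt0// mulr_gt0.
pose h z := lin b z ^+ 2 / ((2 * Kx) ^+ 2 * sg).
have mh : measurable_fun setT h.
  by apply: measurable_funM => //; apply: measurable_funX; exact: lin_measurable.
have hB : (\int[P]_w (expR (h (obs i0 w)))%:E <= 2%:E)%E.
  by rewrite /h; under eq_integral do rewrite lin_obs; exact: dotp_Xobs_expR.
have sumE w : \sum_(i | predT i) h (obs i w) =
    (\sum_i dotp b (Xobs i w) ^+ 2) / ((2 * Kx) ^+ 2 * sg).
  by rewrite mulr_suml; apply: eq_bigr => i _; rewrite /h lin_obs.
have := @iid_chernoff _ _ _ _ _ P _ obs obs_measurable obs_independent obs_identical
  predT h i0 (3 * n%:R) 2 mh hB.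
rewrite (_ : [set w | _ <= \sum_(i | predT i) _] =
  [set w | 3 * (2 * Kx) ^+ 2 * sg * n%:R <= \sum_i dotp b (Xobs i w) ^+ 2]); last first.
  apply/funext => w /=; rewrite sumE ler_pdivlMr//.
  by congr (is_true (_ <= _)); ring.
move=> /le_trans; apply; rewrite lee_fin cardE size_enum_ord.
(* Threshold 3 against a moment of at most [expR 1] per observation leaves the exponent [-2 * n],
   twice what the union over tuples will spend. *)
have e2 : (2 : R) <= expR 1 by have := expR_ge1Dx (1 : R); lra.
apply: (@le_trans _ _ (expR (- (3 * n%:R)) * expR 1 ^+ n)).
  by rewrite ler_wpM2l ?expR_ge0// lerXn2r// ?nnegrE ?expR_ge0.
by rewrite -expRM_natl -expRD ler_expR; lra.
Qed.

(** Extension by zero, so that the optimality of [beta S] among square-summable sequences can be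
    tested at finite vectors. *)
Definition finite_theta (b : 'cV[R]_p) (j : nat) : R :=
  if insub j is Some k then b k 0 else 0.

Lemma finite_theta_ge b j : (p <= j)%N -> finite_theta b j = 0.
Proof. by move=> pj; rewrite /finite_theta insubF// ltnNge pj. Qed.

Lemma finite_theta_series b (f : R -> nat -> R) (N : nat) : (forall j, f 0 j = 0) -> (p <= N)%N ->
  series (fun j => f (finite_theta b j) j) N = \sum_(j < p) f (b j 0) j.
Proof.
move=> f0 pN; rewrite /series/= (big_cat_nat _ pN)//= [X in _ + X]big_nat_cond.
rewrite [X in _ + X]big1 ?addr0; last first.
  by move=> j /andP[/andP[pj _] _]; rewrite finite_theta_ge.
rewrite big_mkord; apply: eq_bigr => j _; rewrite /finite_theta.
by rewrite (insubT (fun k => (k < p)%N) (ltn_ord j))/= (_ : Sub _ _ = j)//; exact: val_inj.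
Qed.

Lemma finite_theta_linpred b i w :
  linpred (finite_theta b) i w @ \oo --> dotp b (Xobs i w).
Proof.
apply: cvg_near_cst; exists p => // N /= pN.
rewrite /linpred (finite_theta_series b (f := fun t j => t * xcov i w j))// => [|j].
  by apply: eq_bigr => j _; rewrite mxE.
by rewrite mul0r.
Qed.

Lemma finite_theta_risk b : seq_risk L S (finite_theta b) = risk L b.
Proof.
rewrite /seq_risk /risk; congr expectation; apply/funext => w.
congr (L _ _); apply/cvg_lim => //; exact: finite_theta_linpred.
Qed.

Definition beta_star : 'cV[R]_p := \col_j beta S j.

Hypothesis beta_tail : forall j, (p <= j)%N -> beta S j = 0.
Hypothesis beta_star_le : dotp beta_star beta_star <= Kbeta ^+ 2.

Lemma beta_finite_theta : beta S = finite_theta beta_star.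
Proof.
apply/funext => j; have [pj|jp] := leqP p j.
  by rewrite finite_theta_ge// beta_tail.
by rewrite /finite_theta insubT/= mxE.
Qed.

Lemma risk_beta_star_le (b : 'cV[R]_p) : (risk L (S := S) beta_star <= risk L (S := S) b)%E.
Proof.
case: data => _ _ _ _ [_ opt]; rewrite -!finite_theta_risk -beta_finite_theta.
apply: opt; split.
  apply/cvg_ex; exists (\sum_(j < p) b j 0 ^+ 2).
  apply: cvg_near_cst; exists p => // N /= pN.
  by rewrite (finite_theta_series b (f := fun t _ => t ^+ 2))// => _; rewrite expr0n.
apply: aeW => w; apply/cvg_ex; exists (dotp b (Xobs i0 w)); exact: finite_theta_linpred.
Qed.

Lemma loss_lin_measurable b i :
  measurable_fun setT (fun w : Omega S => L (Yobs i w) (dotp b (Xobs i w))).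
Proof.
apply: caratheodory_measurable => //.
- by move=> y; exact: loss_continuous.
- exact: Yobs_measurable.
- exact: dotp_Xobs_measurable.
Qed.

(** The derivative of the loss at [beta_star] in direction [b]. *)
Definition grad (b : 'cV[R]_p) (z : Ycal * seqspace R) : R :=
  dL L z.1 (lin beta_star z) * lin b z.

Lemma grad_obs b i w :
  grad b (obs i w) = dL L (Yobs i w) (dotp beta_star (Xobs i w)) * dotp b (Xobs i w).
Proof. by rewrite /grad !lin_obs. Qed.

Lemma grad_measurable b : measurable_fun setT (grad b).
Proof.
apply: measurable_funM; last exact: lin_measurable.
apply: (caratheodory_measurable (F := dL L) (V := fst) (U := lin beta_star)) => //.
- by move=> mu; exact: dL_measurable.
- by move=> y; exact: dL_continuous.
- exact: lin_measurable.
Qed.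

(* The exponential moment of [grad_scale * `|grad b|] is at most [6] for [b] in the unit ball,
   so with the parameter [l = grad_scale * a / 2] a centred sum of [n] terms has exponential moment
   at most [expR (48 * n * (l / grad_scale) ^+ 2) = expR (12 * n * a ^+ 2)]. At the threshold
   [28 / grad_scale * n * a], this leaves [12 - 28 / 2 = -2] in the exponent of the tail. *)
Definition grad_scale : R := (12 * (Ky ^+ 2 + Lu ^+ 2 * Kx ^+ 2 * Kbeta ^+ 2 + Kx ^+ 2))^-1.

Lemma grad_scale_gt0 : 0 < grad_scale.
Proof.
have Kx2 : 0 < Kx ^+ 2 by rewrite exprn_gt0.
have LK : 0 <= Lu ^+ 2 * Kx ^+ 2 * Kbeta ^+ 2.
  by apply: mulr_ge0; [apply: mulr_ge0|]; exact: sqr_ge0.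
by rewrite invr_gt0 mulr_gt0//; have := sqr_ge0 Ky; lra.
Qed.

(** Linear growth of the derivative bounds the product by three squares, each sub-exponential. The
    12 in [grad_scale] is 3 from [expRD3_le] times 4 from the doubled norms, and [6 = 2 + 2 + 2]. *)
Lemma grad_abs_expR b : dotp b b <= 1 ->
  (\int[P]_w (expR (grad_scale * `|grad b (obs i0 w)|))%:E <= 6%:E)%E.
Proof.
move=> b1.
pose d0 w := dL L (Yobs i0 w) 0 ^+ 2 / (2 * Ky) ^+ 2.
pose m w := dotp beta_star (Xobs i0 w) ^+ 2 / ((2 * Kx) ^+ 2 * Kbeta ^+ 2).
pose x w := dotp b (Xobs i0 w) ^+ 2 / ((2 * Kx) ^+ 2 * 1).
have md0 : measurable_fun setT d0.
  apply: measurable_funM => //; apply: measurable_funX.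
  by apply: (measurableT_comp (dL_measurable 0 mL dL1)); exact: Yobs_measurable.
have mm : measurable_fun setT m.
  by apply: measurable_funM => //; apply: measurable_funX; exact: dotp_Xobs_measurable.
have mx : measurable_fun setT x.
  by apply: measurable_funM => //; apply: measurable_funX; exact: dotp_Xobs_measurable.
have Bd0 : (\int[P]_w (expR (d0 w))%:E <= 2%:E)%E.
  apply: psi2norm_expR => //; last by case: sub => _ ->.
  by apply: (measurableT_comp (dL_measurable 0 mL dL1)); exact: Yobs_measurable.
have Bm : (\int[P]_w (expR (m w))%:E <= 2%:E)%E.
  by apply: dotp_Xobs_expR => //; rewrite exprn_gt0.
have Bx : (\int[P]_w (expR (x w))%:E <= 2%:E)%E by exact: dotp_Xobs_expR.
have I f : measurable_fun setT f -> (\int[P]_w (expR (f w))%:E <= 2%:E)%E ->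
    intg P (fun w => expR (f w)).
  move=> mf fB; apply: (ge0_integral_le_intg _ _ fB); first by apply: measurableT_comp.
  by move=> w; exact: expR_ge0.
apply: (expect_expR_bound (g := fun w => expR (d0 w) + expR (m w) + expR (x w))).
- apply: measurable_funM => //; apply: measurableT_comp => //.
  by apply: measurableT_comp; [exact: grad_measurable|exact: obs_measurable].
- by apply: intgD; [apply: intgD|]; exact: I.
- move=> w; rewrite grad_obs normrM.
  set s := Ky ^+ 2 + Lu ^+ 2 * Kx ^+ 2 * Kbeta ^+ 2 + Kx ^+ 2.
  have Ky2 : 0 < Ky ^+ 2 by rewrite exprn_gt0.
  have Kx2 : 0 < Kx ^+ 2 by rewrite exprn_gt0.
  have Kb2 : 0 < Kbeta ^+ 2 by rewrite exprn_gt0.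
  have LK : 0 <= Lu ^+ 2 * Kx ^+ 2 * Kbeta ^+ 2.
  by apply: mulr_ge0; [apply: mulr_ge0|]; exact: sqr_ge0.
  have s0 : 0 < s by rewrite /s; lra.
  apply: (@le_trans _ _ (expR (1 / 3 * (d0 w + m w + x w)))); last first.
    apply: expRD3_le; rewrite ?divr_ge0//; first lra.
    - by rewrite !sqr_ge0.
    - by rewrite sqr_ge0.
    - by rewrite sqr_ge0.
    - by rewrite mulr_ge0 ?sqr_ge0.
    - by rewrite sqr_ge0.
    - by rewrite mulr_ge0 ?sqr_ge0.
  rewrite ler_expR /grad_scale -/s.
  set u := dotp beta_star _; set v := dotp b _.
  pose d := dL L (Yobs i0 w) 0.
  have g := dL_growth lip (Yobs i0 w) u.
  have h1 : `|dL L (Yobs i0 w) u| * `|v| <= d ^+ 2 + Lu ^+ 2 * u ^+ 2 + v ^+ 2.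
    apply: (@le_trans _ _ ((`|d| + Lu * `|u|) * `|v|)); first by rewrite ler_wpM2r.
    rewrite -(real_normK (num_real d)) -(real_normK (num_real u)) -(real_normK (num_real v)).
    have := sqr_ge0 (`|d| - Lu * `|u|); have := sqr_ge0 (`|d| + Lu * `|u| - `|v|).
    have := sqr_ge0 `|v|; nra.
  rewrite ler_pdivrMl ?mulr_gt0//; apply: le_trans h1 _.
  have -> : 12 * s * (1 / 3 * (d0 w + m w + x w)) =
    4 * s * d0 w + 4 * s * m w + 4 * s * x w by field.
  apply: lerD; first apply: lerD.
  - rewrite /d0 -/d mulrA ler_pdivlMr ?exprn_gt0 ?mulr_gt0// exprMn.
    have := ler_wpM2r (sqr_ge0 d) (_ : Ky ^+ 2 <= s); rewrite /s => /(_ _); lra.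
  - rewrite /m -/u mulrA ler_pdivlMr ?mulr_gt0 ?exprn_gt0 ?mulr_gt0// exprMn.
    have := ler_wpM2r (sqr_ge0 u) (_ : Lu ^+ 2 * Kx ^+ 2 * Kbeta ^+ 2 <= s); rewrite /s => /(_ _); lra.
  - rewrite /x -/v mulrA ler_pdivlMr ?mulr_gt0 ?exprn_gt0 ?mulr_gt0// exprMn.
    have := ler_wpM2r (sqr_ge0 v) (_ : Kx ^+ 2 <= s); rewrite /s => /(_ _); lra.
- rewrite !expectD; [|exact: I..|by apply: intgD; exact: I|exact: I].
  have := expect_le_integral Bd0 (I _ md0 Bd0); have := expect_le_integral Bm (I _ mm Bm).
  by have := expect_le_integral Bx (I _ mx Bx); lra.
Qed.

Lemma grad_intg b : intg P (fun w => grad b (obs i0 w)).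
Proof.
pose t := dotp b b + 1; have t1 : 1 <= t by rewrite lerDr dotp_ge0.
have t0 : 0 < t by exact: lt_le_trans t1.
pose b' := t^-1 *: b.
have b'1 : dotp b' b' <= 1.
  rewrite /b' dotpZl dotpC dotpZl mulrA -expr2 exprVn ler_pdivrMl ?exprn_gt0// mulr1.
  apply: (@le_trans _ _ t); first by rewrite lerDl.
  by rewrite expr2 ler_peMl// ltW.
have gE z : grad b z = t * grad b' z.
  rewrite /grad mulrCA; congr (_ * _).
  by rewrite /lin mulr_sumr; apply: eq_bigr => j _; rewrite mxE !mulrA mulfV ?mul1r ?gt_eqF.
have mg := measurableT_comp (grad_measurable b') (obs_measurable i0).
under eq_fun do rewrite gE; apply: intgZ.
have IE : intg P (fun w => expR (grad_scale * `|grad b' (obs i0 w)|)).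
  apply: (ge0_integral_le_intg _ _ (grad_abs_expR b'1)) => [|w]; last exact: expR_ge0.
  by apply: measurableT_comp => //; apply: measurable_funM => //; apply: measurableT_comp.
apply: (intg_dominated _ _ (intgZ grad_scale^-1 IE)) => //.
move=> w; rewrite ler_pdivlMl ?grad_scale_gt0//.
by apply: le_trans (expR_ge1Dx _); rewrite lerDr.
Qed.

Lemma beta_star_loss_intg b : (risk L (S := S) beta_star < risk L (S := S) b)%E ->
  intg P (fun w => L (Yobs i0 w) (dotp beta_star (Xobs i0 w))).
Proof.
rewrite /risk unlock => lt.
pose v := b - beta_star.
apply: (integrable_of_lt_expectation
  (g := fun w => `|grad v (obs i0 w)| + Lu * dotp v (Xobs i0 w) ^+ 2) _ _ _ _ lt).
- exact: loss_lin_measurable.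
- exact: loss_lin_measurable.
- apply: intgD; last by apply: intgZ; exact: dotp_Xobs_sqr_intg.
  by apply: integrable_norm => //; exact: grad_intg.
- move=> w; rewrite grad_obs dotpBl.
  set c := dotp b _; set a := dotp beta_star _.
  have := loss_quadratic_bound dL1 lip (Yobs i0 w) a c (ltW Lu0).
  set D := dL L _ _ * _; set E := L _ _ - _ => h.
  by rewrite -[E](subrK D) addrC; apply: le_trans (ler_normD _ _) _; rewrite lerD2l.
Qed.

(** [b0] serves to make the loss at [beta_star] integrable and is unrelated to the direction [b]. *)
Lemma grad_expect0 b0 b : (risk L (S := S) beta_star < risk L (S := S) b0)%E ->
  expect P (fun w => grad b (obs i0 w)) = 0.
Proof.
move=> /beta_star_loss_intg IL; under eq_fun do rewrite grad_obs.
apply: (risk_gradient_eq0 (ltW Lu0) dL1 lip) => //.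
- move=> t; apply: caratheodory_measurable => //.
  + by move=> y; exact: loss_continuous.
  + exact: Yobs_measurable.
  + apply: measurable_funD; first exact: dotp_Xobs_measurable.
    by apply: measurable_funM => //; exact: dotp_Xobs_measurable.
- by under eq_fun do rewrite -grad_obs; exact: grad_intg.
- exact: dotp_Xobs_sqr_intg.
- move=> t; have := risk_beta_star_le (beta_star + t *: b); rewrite /risk unlock.
  by under [X in (_ <= X)%E -> _]eq_integral do rewrite dotpDl dotpZl.
Qed.

Hypothesis nondegenerate : exists b, (risk L (S := S) beta_star < risk L (S := S) b)%E.

Lemma grad_tail_one (Q : pred 'I_n) b (a eps : R) : dotp b b <= 1 -> 0 < a <= 1 -> `|eps| = 1 ->
  (P [set w | (28 / grad_scale * n%:R * a <= eps * \sum_(i | Q i) grad b (obs i w))%R]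
     <= (expR (- (2 * n%:R * a ^+ 2)))%:E)%E.
Proof.
move=> b1 /andP[a0 a1] eps1; have s0 := grad_scale_gt0.
pose l := eps * (grad_scale * a / 2).
pose h z := l * grad b z.
have mh : measurable_fun setT h by apply: measurable_funM => //; exact: grad_measurable.
have mgz : measurable_fun setT (fun w => grad b (obs i0 w)).
  by apply: measurableT_comp; [exact: grad_measurable|exact: obs_measurable].
have [b0 lt0] := nondegenerate.
have ls : `|l| <= grad_scale / 2.
  rewrite /l normrM eps1 mul1r ger0_norm; last by rewrite divr_ge0// mulr_ge0// ltW.
  by rewrite ler_pM2r// ler_piMr// ltW.
have hB := mgf_centered s0 mgz (grad_abs_expR b1) (grad_expect0 b lt0) ls.
have := @iid_chernoff _ _ _ _ _ P _ obs obs_measurable obs_independent obs_identical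
  Q h i0 (14 * n%:R * a ^+ 2) _ mh hB.
rewrite (_ : [set w | _ <= \sum_(i | Q i) h _] =
  [set w | 28 / grad_scale * n%:R * a <= eps * \sum_(i | Q i) grad b (obs i w)]); last first.
  apply/funext => w /=; rewrite -mulr_sumr /l.
  have c0 : 0 < grad_scale * a / 2 by rewrite divr_gt0// mulr_gt0.
  rewrite -[in RHS](ler_pM2l c0); congr (is_true (_ <= _)); last by ring.
  by field; rewrite gt_eqF.
move=> /le_trans; apply; rewrite lee_fin.
have -> : 8 * 6 / grad_scale ^+ 2 * l ^+ 2 = 12 * a ^+ 2.
  have e2 : eps ^+ 2 = 1 by rewrite -(real_normK (num_real eps)) eps1 expr1n.
  rewrite /l exprMn e2; field; rewrite gt_eqF//.
rewrite -expRM_natl -expRD ler_expR.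
have : #|Q|%:R <= n%:R :> R by rewrite ler_nat -[X in (_ <= X)%N]card_ord max_card.
have : 0 <= a ^+ 2 by exact: sqr_ge0.
nra.
Qed.

Lemma grad_tail (Q : pred 'I_n) b (a : R) : dotp b b <= 1 -> 0 < a <= 1 ->
  (P [set w | (28 / grad_scale * n%:R * a <= `|\sum_(i | Q i) grad b (obs i w)|)%R]
     <= (2 * expR (- (2 * n%:R * a ^+ 2)))%:E)%E.
Proof.
move=> b1 a1; set c := 28 / _ * _ * _.
have mg : measurable_fun setT (fun w => \sum_(i | Q i) grad b (obs i w)).
  apply: measurable_sum_cond => i.
  by apply: measurableT_comp; [exact: grad_measurable|exact: obs_measurable].
have mset (eps : R) : measurable [set w | c <= eps * \sum_(i | Q i) grad b (obs i w)].
  by apply: measurable_ler_set => //; exact: measurable_funM.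
rewrite (_ : [set w | _] = [set w | c <= 1 * \sum_(i | Q i) grad b (obs i w)] `|`
   [set w | c <= -1 * \sum_(i | Q i) grad b (obs i w)]); last first.
  apply/seteqP; split => w /=; rewrite mul1r mulN1r ler_normr.
    by move=> /orP[]; [left|right].
  by move=> [] ->; rewrite ?orbT.
have -> : 2 * expR (- (2 * n%:R * a ^+ 2)) =
  expR (- (2 * n%:R * a ^+ 2)) + expR (- (2 * n%:R * a ^+ 2)) by rewrite mulr_natl.
by apply: prob_setU_le; rewrite ?mset//; apply: grad_tail_one => //; rewrite ?normrN normr1.
Qed.

(* By [ball_weight_lower], passing from [x ^+ 2] to the capped and truncated [ball_weight] costs
   fourth moments divided by [cap_scale] and by [trunc_level ^+ 2]; both are chosen so large
   that these corrections stay below a fixed fraction of [kappal * dotp b b]. *)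
Definition cap_scale : R := 1 + 64 * (2 * Kx) ^+ 4 * Kbeta ^+ 2 / kappal.

Definition trunc_level : R := 1 + 8 * (2 * Kx) ^+ 4 * (1 + Kbeta ^+ 4) / kappal.

(** The exponent [th * kap / (4 * H)] of [small_ball_mgf] at [k = (2 * Kx) ^+ 2] and
    [H = cap_scale]. *)
Definition small_ball_rate : R := kappal ^+ 2 / (64 * cap_scale ^+ 2 * (2 * Kx) ^+ 4).

Lemma cap_scale_ge1 : 1 <= cap_scale.
Proof.
by rewrite lerDl divr_ge0 ?(ltW kap0)// mulr_ge0 ?sqr_ge0// mulr_ge0// exprn_even_ge0.
Qed.

Lemma trunc_level_ge1 : 1 <= trunc_level.
Proof.
rewrite lerDl divr_ge0 ?(ltW kap0)// mulr_ge0//; first by rewrite mulr_ge0// exprn_even_ge0.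
by rewrite addr_ge0// exprn_even_ge0.
Qed.

Lemma small_ball_rate_gt0 : 0 < small_ball_rate.
Proof.
have H0 := lt_le_trans ltr01 cap_scale_ge1.
by rewrite divr_gt0 ?exprn_gt0// !mulr_gt0 ?exprn_gt0// mulr_gt0.
Qed.

(** The threshold is set to spend half of [small_ball_rate] in Chernoff's bound, the other half
    remaining as the tail. The size [4 * Kbeta ^+ 2] is that of a difference of two pseudo-true
    vectors. *)
Lemma small_ball_tail b : 0 < dotp b b -> dotp b b <= 4 * Kbeta ^+ 2 ->
  (P [set w | (\sum_(i | `|dotp beta_star (Xobs i w)| <= trunc_level)
                 Num.min `|dotp b (Xobs i w)| 1 ^+ 2
               <= kappal / (8 * cap_scale) * dotp b b * n%:R)%R]
     <= (expR (- (small_ball_rate / 2 * n%:R)))%:E)%E.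
Proof.
move=> b0 b4; set k := (2 * Kx) ^+ 2.
have k4 : (2 * Kx) ^+ 4 = k ^+ 2 by rewrite -exprM.
have k0 : 0 < k by rewrite exprn_gt0// mulr_gt0.
have H1 := cap_scale_ge1; have H0 := lt_le_trans ltr01 H1.
have M1 := trunc_level_ge1; have M0 := lt_le_trans ltr01 M1.
have Kb2 : 0 < Kbeta ^+ 2 by rewrite exprn_gt0.
pose th := kappal / (16 * cap_scale * k ^+ 2).
have th0 : 0 < th by rewrite divr_gt0// !mulr_gt0// exprn_gt0.
pose h z := - (th / dotp b b * ball_weight trunc_level (lin b z) (lin beta_star z)).
have mh : measurable_fun setT h.
  apply: measurable_funN; apply: measurable_funM => //.
  by apply: ball_weight_measurable; exact: lin_measurable.
have hB : (\int[P]_w (expR (h (obs i0 w)))%:E <= (expR (- small_ball_rate))%:E)%E.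
  rewrite /h; under eq_integral do rewrite !lin_obs.
  have -> : small_ball_rate = th * kappal / (4 * cap_scale).
    by rewrite /small_ball_rate /th k4; field; rewrite !gt_eqF// exprn_gt0.
  apply: (@small_ball_mgf _ _ _ _ _ _ k kappal (dotp b b) (Kbeta ^+ 2)) => //.
  - exact: dotp_Xobs_measurable.
  - exact: dotp_Xobs_measurable.
  - exact: dotp_Xobs_expR.
  - exact: dotp_Xobs_expR.
  - exact: second_moment_Xobs.
  - rewrite /cap_scale k4 mulrDr mulr1.
    have -> : kappal * (64 * k ^+ 2 * Kbeta ^+ 2 / kappal) = 16 * k ^+ 2 * (4 * Kbeta ^+ 2).
      by field; rewrite gt_eqF.
    apply: (@le_trans _ _ (16 * k ^+ 2 * (4 * Kbeta ^+ 2))); last by rewrite lerDr ltW.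
    by rewrite ler_wpM2l// mulr_ge0 ?sqr_ge0.
  - apply: (@le_trans _ _ (kappal * trunc_level)).
      rewrite (_ : (Kbeta ^+ 2) ^+ 2 = Kbeta ^+ 4); last by rewrite -exprM.
      rewrite /trunc_level k4 [leRHS]mulrDr mulr1.
      have -> : kappal * (8 * k ^+ 2 * (1 + Kbeta ^+ 4) / kappal) = 8 * k ^+ 2 * (1 + Kbeta ^+ 4).
        by field; rewrite gt_eqF.
      by rewrite lerDr ltW.
    by rewrite ler_pM2l// expr2 ler_peMl// ltW.
have := @iid_chernoff _ _ _ _ _ P _ obs obs_measurable obs_independent obs_identical
  predT h i0 (- (small_ball_rate / 2 * n%:R)) _ mh hB.
rewrite (_ : [set w | _ <= \sum_(i | predT i) h _] = [set w |
   (\sum_(i | `|dotp beta_star (Xobs i w)| <= trunc_level) Num.min `|dotp b (Xobs i w)| 1 ^+ 2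
               <= kappal / (8 * cap_scale) * dotp b b * n%:R)%R]); last first.
  apply/funext => w /=; rewrite sumrN -mulr_sumr lerN2.
  have -> : \sum_i ball_weight trunc_level (lin b (obs i w)) (lin beta_star (obs i w)) =
      \sum_(i | `|dotp beta_star (Xobs i w)| <= trunc_level) Num.min `|dotp b (Xobs i w)| 1 ^+ 2.
    by rewrite [RHS]big_mkcond; apply: eq_bigr => i _; rewrite !lin_obs.
  have thb : 0 < th / dotp b b by rewrite divr_gt0.
  rewrite -[in RHS](ler_pM2l thb); congr (is_true (_ <= _)).
  by rewrite /small_ball_rate /th k4; field; rewrite !gt_eqF.
move=> /le_trans; apply; rewrite lee_fin cardE size_enum_ord -expRM_natl -expRD ler_expR.
lra.
Qed.

Lemma sum_sqr_measurable b : measurable_fun setT (fun w : Omega S => \sum_i dotp b (Xobs i w) ^+ 2).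
Proof.
by apply: measurable_sum => i; apply: measurable_funX; exact: dotp_Xobs_measurable.
Qed.

(** The strict inequality makes the event empty at [b = 0], so that the union may range over all
    tuples, including those whose sum cancels. *)
Definition norm_event b : set (Omega S) :=
  [set w | 3 * (2 * Kx) ^+ 2 * dotp b b * n%:R < \sum_i dotp b (Xobs i w) ^+ 2].

Lemma norm_event_measurable b : measurable (norm_event b).
Proof.
apply: measurable_ltr_set => //.
exact: sum_sqr_measurable.
Qed.

Lemma norm_event_prob b : (P (norm_event b) <= (expR (- (2 * n%:R)))%:E)%E.
Proof.
have [/eqP b0|bn0] := eqVneq (dotp b b) 0.
  rewrite (_ : norm_event b = set0) ?measure0 ?lee_fin ?expR_ge0//.
  apply/seteqP; split => w //=; rewrite /norm_event/= (eqP b0) mulr0 mul0r.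
  have -> : b = 0.
    apply/matrixP => j k; rewrite (ord1 k) mxE; apply/eqP; rewrite -sqrf_eq0 expr2; apply/eqP.
    by move/eqP: b0 => /psumr_eq0P -> // i _; rewrite -expr2 sqr_ge0.
  by rewrite big1 ?ltxx// => i _; rewrite dotp0l expr0n.
have bp : 0 < dotp b b by rewrite lt_neqAle eq_sym bn0 dotp_ge0.
apply: le_trans (empirical_norm_tail bp (lexx _)); apply: le_measure; rewrite ?inE//.
- exact: norm_event_measurable.
- by apply: measurable_ler_set => //; exact: sum_sqr_measurable.
- by move=> w /ltW.
Qed.

Definition ball_event b : set (Omega S) :=
  [set w | \sum_(i | `|dotp beta_star (Xobs i w)| <= trunc_level)
             Num.min `|dotp b (Xobs i w)| 1 ^+ 2
           < kappal / (8 * cap_scale) * dotp b b * n%:R].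

Lemma ball_sum_measurable b : measurable_fun setT (fun w : Omega S =>
  \sum_(i | `|dotp beta_star (Xobs i w)| <= trunc_level) Num.min `|dotp b (Xobs i w)| 1 ^+ 2).
Proof.
under eq_fun do rewrite big_mkcond/=.
apply: measurable_sum => i; apply: ball_weight_measurable; exact: dotp_Xobs_measurable.
Qed.

Lemma ball_event_measurable b : measurable (ball_event b).
Proof.
apply: measurable_ltr_set => //.
exact: ball_sum_measurable.
Qed.

Lemma ball_event_prob b : dotp b b <= 4 * Kbeta ^+ 2 ->
  (P (ball_event b) <= (expR (- (small_ball_rate / 2 * n%:R)))%:E)%E.
Proof.
move=> b4; have [b0|bn0] := eqVneq (dotp b b) 0.
  rewrite (_ : ball_event b = set0) ?measure0 ?lee_fin ?expR_ge0//.
  apply/seteqP; split => w //=; rewrite /ball_event/= b0 mulr0 mul0r => /lt_geF.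
  by rewrite sumr_ge0// => i _; exact: sqr_ge0.
have bp : 0 < dotp b b by rewrite lt_neqAle eq_sym bn0 dotp_ge0.
apply: le_trans (small_ball_tail bp b4); apply: le_measure; rewrite ?inE//.
- exact: ball_event_measurable.
- by apply: measurable_ler_set => //; exact: ball_sum_measurable.
- by move=> w /ltW.
Qed.

Definition grad_event (Q : pred 'I_n) b (sg a : R) : set (Omega S) :=
  [set w | sg * (28 / grad_scale * n%:R * a) < `|\sum_(i | Q i) grad b (obs i w)|].

Lemma grad_sum_measurable (Q : pred 'I_n) b :
  measurable_fun setT (fun w => \sum_(i | Q i) grad b (obs i w)).
Proof.
apply: measurable_sum_cond => i.
by apply: measurableT_comp; [exact: grad_measurable|exact: obs_measurable].
Qed.

Lemma grad_event_measurable Q b sg a : measurable (grad_event Q b sg a).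
Proof.
apply: measurable_ltr_set => //.
by apply: measurableT_comp => //; exact: grad_sum_measurable.
Qed.

Lemma grad_event_prob Q b (sg a : R) : 0 < sg -> dotp b b <= sg ^+ 2 -> 0 < a <= 1 ->
  (P (grad_event Q b sg a) <= (2 * expR (- (2 * n%:R * a ^+ 2)))%:E)%E.
Proof.
move=> sg0 bsg a1; pose v := sg^-1 *: b.
have v1 : dotp v v <= 1.
  by rewrite /v dotpZl dotpC dotpZl mulrA -expr2 exprVn ler_pdivrMl ?exprn_gt0// mulr1.
apply: le_trans (grad_tail Q v1 a1); apply: le_measure; rewrite ?inE.
- exact: grad_event_measurable.
- apply: measurable_ler_set => //.
  by apply: measurableT_comp => //; exact: grad_sum_measurable.
move=> w /ltW /=; rewrite -ler_pdivlMl// => /le_trans; apply.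
rewrite -[sg^-1](gtr0_norm (_ : 0 < sg^-1)) ?invr_gt0// -normrM mulr_sumr.
rewrite le_eqVlt; apply/orP; left; apply/eqP; congr `|_|; apply: eq_bigr => i _.
rewrite /grad mulrCA; congr (_ * _); rewrite /lin mulr_sumr; apply: eq_bigr => j _.
by rewrite mxE mulrA.
Qed.

End sample_tails.

(** * The cross-validation inequality *)

Section jensen.
Context {R : realType} {p : nat}.

(** Jensen's inequality, by averaging [0 <= bil (mu - x k) (mu - x k)] over [om]. *)
Lemma convex_form_le (bil : 'cV[R]_p -> 'cV[R]_p -> R) {I : finType} (om : I -> R)
    (x : I -> 'cV[R]_p) (B : R) :
  (forall u u' v, bil (u + u') v = bil u v + bil u' v) ->
  (forall t u v, bil (t *: u) v = t * bil u v) ->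
  (forall u v, bil u v = bil v u) -> (forall u, 0 <= bil u u) ->
  (forall k, 0 <= om k) -> \sum_k om k = 1 ->
  (forall k, om k != 0 -> bil (x k) (x k) <= B) ->
  let mu := \sum_k om k *: x k in bil mu mu <= B.
Proof.
move=> bD bZ bC b0 om0 om1 xB /=; set mu := \sum_k _.
have bDr u v v' : bil u (v + v') = bil u v + bil u v' by rewrite bC bD !(bC _ u).
have bZr t u v : bil u (t *: v) = t * bil u v by rewrite bC bZ bC.
have mumu : bil mu mu = \sum_k om k * bil mu (x k) by rewrite {2}/mu (bil_sumr bD bZ bC).
have avg : \sum_k om k * (2 * bil mu (x k) - bil mu mu) <= \sum_k om k * B.
  apply: ler_sum => k _; have [->|ok] := eqVneq (om k) 0; first by rewrite !mul0r.
  rewrite ler_wpM2l//; apply: le_trans (xB k ok).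
  have := b0 (mu + (-1) *: x k); rewrite !(bD, bDr, bZ, bZr) (bC (x k) mu); lra.
move: avg; rewrite -[X in _ <= X]mulr_suml om1 mul1r.
under eq_bigr do rewrite mulrBr mulrCA.
by rewrite big_split/= sumrN -mulr_sumr -mumu -mulr_suml om1; lra.
Qed.

Lemma dotp_convex_le {I : finType} (om : I -> R) (x : I -> 'cV[R]_p) (B : R) :
  (forall k, 0 <= om k) -> \sum_k om k = 1 ->
  (forall k, om k != 0 -> dotp (x k) (x k) <= B) ->
  let mu := \sum_k om k *: x k in dotp mu mu <= B.
Proof. exact: (convex_form_le dotpDl dotpZl dotpC dotp_ge0). Qed.

Lemma dotpB_le (u v : 'cV[R]_p) (B : R) : dotp u u <= B -> dotp v v <= B ->
  dotp (u - v) (u - v) <= 4 * B.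
Proof.
move=> uB vB.
have h : 0 <= dotp u u + 2 * dotp u v + dotp v v.
  rewrite (_ : _ + _ = dotp (u + v) (u + v)) ?dotp_ge0//.
  by rewrite dotpDl (dotpC u (u + v)) (dotpC v (u + v)) !dotpDl (dotpC v u); ring.
have -> : dotp (u - v) (u - v) = dotp u u - 2 * dotp u v + dotp v v.
  by rewrite dotpBl (dotpC u (u - v)) (dotpC v (u - v)) !dotpBl (dotpC v u); ring.
lra.
Qed.

Lemma norm1D (u v : 'cV[R]_p) : norm1 (u + v) <= norm1 u + norm1 v.
Proof. by rewrite /norm1 -big_split/=; apply: ler_sum => j _; rewrite mxE ler_normD. Qed.

Lemma norm1_convex_le {I : finType} (om : I -> R) (x : I -> 'cV[R]_p) (B : R) :
  (forall k, 0 <= om k) -> \sum_k om k = 1 -> (forall k, norm1 (x k) <= B) ->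
  norm1 (\sum_k om k *: x k) <= B.
Proof.
move=> om0 om1 xB.
apply: (@le_trans _ _ (\sum_k om k * norm1 (x k))); last first.
  by rewrite -[leRHS]mul1r -om1 mulr_suml; apply: ler_sum => k _; rewrite ler_wpM2l.
rewrite /norm1; under [leRHS]eq_bigr do rewrite mulr_sumr.
rewrite exchange_big/=; apply: ler_sum => j _; rewrite summxE.
apply: le_trans (ler_norm_sum _ _ _) _; apply: ler_sum => k _.
by rewrite mxE normrM ger0_norm.
Qed.

Lemma norm1N (u : 'cV[R]_p) : norm1 (- u) = norm1 u.
Proof. by apply: eq_bigr => j _; rewrite mxE normrN. Qed.

End jensen.

Lemma emp_convex_le {R : realType} {p n : nat} (X : 'I_n -> 'cV[R]_p) {I : finType}
    (om : I -> R) (x : I -> 'cV[R]_p) (B : R) :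
  (forall k, 0 <= om k) -> \sum_k om k = 1 ->
  (forall k, emp_form X (x k) (x k) <= B) ->
  let mu := \sum_k om k *: x k in emp_form X mu mu <= B.
Proof.
move=> om0 om1 xB; apply: (convex_form_le (emp_formDl X) (emp_formZl X) (emp_formC X)) => //.
exact: emp_form_ge0.
Qed.

Section deterministic.
Context {R : realType} {n p K J : nat}.
Variables (X : 'I_n -> 'cV[R]_p) (fold : 'I_n -> 'I_J) (bet : 'I_K -> 'cV[R]_p)
  (bs : 'cV[R]_p) (del : 'I_J -> 'I_K -> 'cV[R]_p) (cr : pred 'I_K) (ks : 'I_K)
  (wh : 'I_K -> R) (Lf dLf : 'I_n -> R -> R).
Variables (eta Lu M T phi c eps D0 D1 G C : R) (m2 : nat).
Let mu i := dotp bs (X i).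
Let x k := bet k - bs.
Let pred_pt m (w : 'I_K -> R) := \sum_k w k *: (bet k + del m k).
Hypotheses (crks : cr ks) (crE : forall k, cr k -> bet k = bs).
Hypotheses (wh0 : forall k, 0 <= wh k) (wh1 : \sum_k wh k = 1).
Hypothesis opt : forall w : 'I_K -> R, (forall k, 0 <= w k) -> \sum_k w k = 1 ->
  \sum_i Lf i (dotp (pred_pt (fold i) wh) (X i)) <=
  \sum_i Lf i (dotp (pred_pt (fold i) w) (X i)).
Hypotheses (eta0 : 0 < eta) (T0 : 0 < T) (T1 : T <= 1) (n0 : (0 < n)%N) (m20 : (0 < m2)%N)
  (Lu0 : 0 <= Lu) (C0 : 0 <= C).
Hypothesis curv : forall i a b, `|a| <= M + 1 ->
  eta * Num.min `|b - a| 1 ^+ 2 <= Lf i b - Lf i a - dLf i a * (b - a).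
Hypothesis convx : forall i a b, 0 <= Lf i b - Lf i a - dLf i a * (b - a).
Hypothesis lip : forall i a b, `|dLf i a - dLf i b| <= Lu * `|a - b|.
Hypothesis Hdel : forall m k, emp_form X (del m k) (del m k) <= D0 * n%:R * T ^+ 2.
Hypothesis Hx : forall k, emp_form X (x k) (x k) <= D1 * n%:R.
Hypothesis Hlow : forall t : m2.-tuple 'I_K, {in t, forall k, ~~ cr k} ->
  c * n%:R * phi <= \sum_(i | `|mu i| <= M)
    Num.min `|dotp (m2%:R^-1 *: \sum_(k <- t) x k) (X i)| 1 ^+ 2.
Hypothesis Hg1 : forall k, `|\sum_i dLf i (mu i) * dotp (x k) (X i)| <= C * n%:R * T.
Hypothesis Hg2 : forall m j, `|\sum_(i | fold i == m) dLf i (mu i) * X i j 0| <= G.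
Hypothesis Hdel1 : forall m k, 2 * J%:R * norm1 (del m k) * G <= C * n%:R * T.
Hypotheses (HC1 : 4 * J%:R * D0 <= C) (HC2 : D1 <= C) (J0 : (0 < J)%N) (D00 : 0 <= D0).
Hypothesis Hm2 : D1 / m2%:R <= eps * phi.
Hypothesis small : eps * phi + 2 * C * T ^+ 2 <= c * phi / 6.

Let tau := 1 - \sum_(k | cr k) wh k.

Lemma deterministic_bound : eta * (c * phi / 6) * tau <= (2 + 3 * Lu) * C * T.
Proof.
have nR : (0 : R) < n%:R by rewrite ltr0n.
have tauE : tau = \sum_(k | ~~ cr k) wh k.
  by rewrite /tau -wh1 (bigID cr)/= addrAC subrr add0r.
have tau0 : 0 <= tau by rewrite tauE sumr_ge0.
have tau1 : tau <= 1 by rewrite /tau gerBl sumr_ge0.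
have rhs0 : 0 <= (2 + 3 * Lu) * C * T.
  by rewrite !mulr_ge0// ?addr_ge0// ?mulr_ge0// ltW.
have [tz|taun0] := eqVneq tau 0; first by rewrite tz mulr0.
have taup : 0 < tau by rewrite lt_neqAle eq_sym taun0.
(* The wrong weights normalised to a probability vector; with [w'], the weight after moving the mass
   to [ks], [wh] is [w'] plus [tau] times [om] minus the vertex at [ks]. *)
pose om k := if cr k then 0 else wh k / tau.
have om0 k : 0 <= om k by rewrite /om; case: ifP => // _; rewrite divr_ge0.
have om1 : \sum_k om k = 1.
  rewrite (bigID cr)/= big1 => [|k ck]; last by rewrite /om ck.
  under eq_bigr => k ck do rewrite /om (negbTE ck).
  by rewrite add0r -mulr_suml -tauE mulfV.
pose w' k := (if cr k then wh k else 0) + (if k == ks then tau else 0).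
have w'0 k : 0 <= w' k by rewrite addr_ge0//; case: ifP.
have w'1 : \sum_k w' k = 1.
  by rewrite big_split/= -!big_mkcond/= big_pred1_eq /tau addrC subrK.
have whE k : wh k = w' k + tau * (om k - (k == ks)%:R).
  rewrite /w' /om; have [->|kks] := eqVneq k ks.
    by rewrite crks sub0r mulrN mulr1 addrK.
  rewrite addr0 subr0; case: ifP => _; first by rewrite mulr0 addr0.
  by rewrite add0r mulrCA mulfV ?mulr1.
pose b := \sum_k om k *: x k.
pose rho m := \sum_k om k *: del m k - del m ks.
pose sig m := \sum_k w' k *: del m k.
have sum_del (V : 'I_K -> 'cV[R]_p) :
    \sum_k (k == ks)%:R *: V k = V ks.
  by rewrite (bigD1 ks)//= eqxx scale1r big1 ?addr0// => k /negbTE ->; rewrite scale0r.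
have predw' m : pred_pt m w' = bs + sig m.
  rewrite /pred_pt; under eq_bigr do rewrite scalerDr.
  rewrite big_split/=; congr (_ + _).
  transitivity (\sum_k w' k *: bs); last by rewrite -scaler_suml w'1 scale1r.
  apply: eq_bigr => k _; have [ck|nck] := boolP (cr k); first by rewrite crE.
  rewrite /w' (negbTE nck) (_ : (k == ks) = false) ?addr0 ?scale0r//.
  by apply/negbTE; apply: contra nck => /eqP ->.
have predwh m : pred_pt m wh = bs + sig m + tau *: (b + rho m).
  rewrite -predw' /pred_pt.
  rewrite (eq_bigr (fun k => w' k *: (bet k + del m k) +
     tau *: (om k *: (bet k + del m k) - (k == ks)%:R *: (bet k + del m k)))); last first.
    by move=> k _; rewrite {1}whE scalerDl -scalerA (scalerBl (om k)).
  rewrite big_split/= -scaler_sumr; congr (_ + _ *: _).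
  rewrite big_split/= sumrN (sum_del (fun k => bet k + del m k)%R) (crE crks).
  rewrite /b /rho; under [X in _ = X + _]eq_bigr do rewrite /x scalerBr.
  rewrite big_split/= sumrN -scaler_suml om1 scale1r.
  under eq_bigr do rewrite scalerDr; rewrite big_split/=.
  by rewrite opprD addrACA.
(* Each observation sees the error of its own fold; summing over all folds and all observations
   instead reduces to full empirical norms, at the cost of a factor [J]. *)
have foldsum (F : 'I_J -> 'I_n -> R) : (forall m i, 0 <= F m i) ->
    \sum_i F (fold i) i <= \sum_m \sum_i F m i.
  move=> F0; rewrite exchange_big/=; apply: ler_sum => i _.
  by rewrite (bigD1 (fold i))//= lerDl sumr_ge0.
have sumJ (f : 'I_J -> R) (B : R) : (forall m, f m <= B) -> \sum_m f m <= J%:R * B.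
  move=> fB; apply: le_trans (ler_sum _ (fun m _ => fB m)) _.
  by rewrite sumr_const card_ord mulr_natl.
have JR : (1 : R) <= J%:R by rewrite ler1n.
have sqE u i : dotp u (X i) ^+ 2 = dotp u (X i) * dotp u (X i) by rewrite expr2.
have emp_sum u : \sum_i dotp u (X i) ^+ 2 = emp_form X u u.
  by apply: eq_bigr => i _; rewrite expr2.
have Bn : 0 <= D0 * n%:R * T ^+ 2 by rewrite mulr_ge0 ?sqr_ge0 ?mulr_ge0.
have [t tpos tapp] := emp_form_approx (X := X) m20 om0 om1 Hx.
apply: (@core_inequality R n Lf dLf mu (fun i => dotp (sig (fold i)) (X i))
  (fun i => dotp b (X i)) (fun i => dotp (rho (fold i)) (X i))
  (fun i => dotp (m2%:R^-1 *: \sum_(k <- t) x k) (X i))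
  tau eta Lu M n%:R T phi c C eps) => //.
- by rewrite tau0.
- have := opt w'0 w'1.
  under eq_bigr do rewrite predwh dotpDl dotpZl (dotpDl bs) (dotpDl b).
  by under [X in _ <= X -> _]eq_bigr do rewrite predw' dotpDl.
- apply: le_trans (foldsum (fun m i => dotp (sig m) (X i) ^+ 2) (fun m i => sqr_ge0 _)) _.
  apply: (@le_trans _ _ (J%:R * (D0 * n%:R * T ^+ 2))).
    by apply: sumJ => m; rewrite emp_sum; exact: (emp_convex_le w'0 w'1 (Hdel m)).
  rewrite (_ : J%:R * _ = J%:R * D0 * n%:R * T ^+ 2); last by ring.
  apply: ler_wpM2r; first exact: sqr_ge0.
  apply: ler_wpM2r => //; apply: le_trans HC1.
  by apply: ler_wpM2r => //; rewrite ler_peMl// ler1n.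
- apply: le_trans (foldsum (fun m i => dotp (rho m) (X i) ^+ 2) (fun m i => sqr_ge0 _)) _.
  apply: (@le_trans _ _ (J%:R * (4 * (D0 * n%:R * T ^+ 2)))).
    apply: sumJ => m; rewrite emp_sum /rho; set u := \sum_k _; set v := del m ks.
    have hu : emp_form X u u <= D0 * n%:R * T ^+ 2 by exact: (emp_convex_le om0 om1 (Hdel m)).
    have hv : emp_form X v v <= D0 * n%:R * T ^+ 2 by exact: Hdel.
    have := emp_form_ge0 X (u + v).
    rewrite -!(scaleN1r v) !(emp_formDl, emp_formZl) !(emp_formC X _ (_ + _)).
    by rewrite !(emp_formDl, emp_formZl) (emp_formC X v u); lra.
  rewrite (_ : _ * (4 * _) = 4 * J%:R * D0 * n%:R * T ^+ 2); last by ring.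
  apply: ler_wpM2r; first exact: sqr_ge0.
  exact: ler_wpM2r.
- rewrite emp_sum; apply: (@le_trans _ _ (D1 * n%:R)); first exact: (emp_convex_le om0 om1 Hx).
  by rewrite ler_wpM2r.
- under eq_bigr do rewrite -dotpBl; rewrite emp_sum.
  apply: le_trans tapp _; rewrite mulrAC [leRHS]mulrAC ler_wpM2r// ltW//.
- by apply: Hlow => k kt; apply/negP => ck; have := tpos k kt; rewrite /om ck ltxx.
- rewrite (_ : \sum_i _ = \sum_k om k * \sum_i dLf i (mu i) * dotp (x k) (X i)); last first.
    under eq_bigr do rewrite /b dotp_suml mulr_sumr.
    rewrite exchange_big/=; apply: eq_bigr => k _; rewrite mulr_sumr.
    by apply: eq_bigr => i _; rewrite dotpZl; ring.
  apply: le_trans (ler_norm_sum _ _ _) _.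
  rewrite (_ : C * n%:R * T = \sum_k om k * (C * n%:R * T)); last by rewrite -mulr_suml om1 mul1r.
  apply: ler_sum => k _.
  by rewrite normrM (ger0_norm (om0 k)); apply: ler_wpM2l; [exact: om0|exact: Hg1].
(* The training error changes with the fold, so the gradient is paired with it fold by fold: l1-norm
   of [rho m] times the largest coordinate of the gradient on that fold. *)
- rewrite (_ : \sum_i _ =
    \sum_m \sum_j rho m j 0 * \sum_(i | fold i == m) dLf i (mu i) * X i j 0); last first.
    rewrite (partition_big fold predT)//=; apply: eq_bigr => m _.
    under [RHS]eq_bigr do rewrite mulr_sumr.
    rewrite exchange_big/=; apply: eq_bigr => i /eqP <-.
    by rewrite /dotp mulr_sumr; apply: eq_bigr => j _; ring.
  apply: le_trans (ler_norm_sum _ _ _) _.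
  pose B := C * n%:R * T / J%:R.
  have JR0 : (0 : R) < J%:R by rewrite ltr0n.
  have -> : C * n%:R * T = J%:R * B by rewrite /B mulrCA mulfV ?mulr1// gt_eqF.
  apply: sumJ => m.
  (* The sign of [G] is known only through a coordinate, whence the separate case [p = 0]. *)
  have G0 (j : 'I_p) : 0 <= G by apply: le_trans (Hg2 m j).
  apply: (@le_trans _ _ (norm1 (rho m) * G)).
    apply: le_trans (ler_norm_sum _ _ _) _; rewrite mulr_suml; apply: ler_sum => j _.
    by rewrite normrM ler_wpM2l.
  have [p0|pn0] := posnP p.
    have -> : norm1 (rho m) = 0.
      by rewrite /norm1 big1// => j _; exfalso; have := ltn_ord j; rewrite [X in (_ < X)%N]p0.
    by rewrite mul0r /B divr_ge0// !mulr_ge0// ltW.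
  have {}G0 := G0 (Ordinal pn0).
  rewrite /B ler_pdivlMr//.
  have [Gz|Gn0] := eqVneq G 0; first by rewrite Gz mulr0 mul0r !mulr_ge0// ltW.
  have Gp : 0 < G by rewrite lt_neqAle eq_sym Gn0.
  have JG : 0 < 2 * J%:R * G by rewrite !mulr_gt0.
  pose B' := C * n%:R * T / (2 * J%:R * G).
  have dB k : norm1 (del m k) <= B'.
    rewrite /B' ler_pdivlMr//; apply: le_trans (Hdel1 m k).
    by rewrite le_eqVlt; apply/orP; left; apply/eqP; ring.
  have rB : norm1 (rho m) <= B' + B'.
    apply: le_trans (norm1D _ _) _; rewrite norm1N; apply: lerD; last exact: dB.
    exact: norm1_convex_le.
  apply: (@le_trans _ _ ((B' + B') * G * J%:R)).
    by rewrite ler_wpM2r// ler_wpM2r.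
  by rewrite /B' le_eqVlt; apply/orP; left; apply/eqP; field; rewrite !gt_eqF.
Qed.

End deterministic.

(** * The merged models *)

Section merged.
Context {R : realType} {dY : measure_display} {Ycal : measurableType dY}.
Context {J : nat} (L : Ycal -> R -> R) (S : experiment R Ycal J).
Hypothesis data : data_model L S.
Hypothesis corr : forall k, correct k <-> in_correct_range (S := S) k.
Hypothesis uniq_min : wtilde_unique_min L S.

Notation p := (pdim S).
Notation K := (nmod S).

Definition kstar : 'I_K := unmerge (merged_star S).

Lemma kstar_val : (kstar : nat) = (Kstar S).-1.
Proof. by rewrite /= prednK ?Kstar_gt0// leqnn. Qed.

Lemma kstar_correct : in_correct_range kstar.
Proof. by rewrite /in_correct_range kstar_val prednK ?Kstar_gt0// leqnn Kstar_le. Qed.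

Lemma col_correct k : in_correct_range k -> col k (Bstar S) = beta_star S.
Proof. by move=> /corr[]. Qed.

Lemma beta_tail_eq0 j : (p <= j)%N -> beta S j = 0.
Proof. by have [h _] := (corr kstar).2 kstar_correct; exact: h. Qed.

(** Models before the correct range keep their index, those after it are shifted by
    [Kne S - Kstar S]; only correct models are dropped. *)
Lemma merged_wrongP k : ~~ in_correct_range (S := S) k ->
  exists2 a : 'I_(nmerged S), a != merged_star S & unmerge a = k.
Proof.
move=> nk; suff [a ak] : exists a : 'I_(nmerged S), unmerge a = k.
  by exists a => //; apply: contra nk => /eqP e; rewrite -ak e; exact: kstar_correct.
have := Kstar_le S; have := Kne_le S; have := Kstar_gt0 S => s0 hK hs.
move: nk; rewrite /in_correct_range negb_and -!ltnNge ltnS => /orP[kl|kg].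
  have kn : (k < nmerged S)%N.
    by rewrite /nmerged ltn_subRL; have := ltn_ord k; lia.
  exists (Ordinal kn); apply: val_inj; rewrite /=.
  by rewrite ltnW.
have kn : (k - (Kne S - Kstar S) < nmerged S)%N.
  by rewrite /nmerged; have := ltn_ord k; lia.
exists (Ordinal kn); apply: val_inj; rewrite /= ifF; lia.
Qed.

Lemma Btilde_col a : col a (Btilde S) = col (unmerge a) (Bstar S).
Proof. by apply/matrixP => j b; rewrite !mxE. Qed.

Lemma simplex_delta (a : 'I_(nmerged S)) : simplex (R := R) (nmerged S) (delta_mx a 0).
Proof.
split=> [k|]; first by rewrite mxE eqxx andbT; case: eqP; rewrite ?lexx ?ler01.
rewrite (bigD1 a)//= mxE !eqxx big1 ?addr0// => k /negbTE ka.
by rewrite mxE ka.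
Qed.

Lemma Btilde_star : Btilde S *m delta_mx (merged_star S) 0 = beta_star S.
Proof. by rewrite -colE Btilde_col (col_correct kstar_correct). Qed.

(** The vertex at [merged_star] yields [beta_star], which minimizes the risk over all vectors;
    uniqueness identifies it with [wtilde S]. *)
Lemma wtilde_star : wtilde S = delta_mx (merged_star S) 0.
Proof.
apply/esym; have : argmin (simplex (nmerged S)) (fun w => risk L (Btilde S *m w))
    (delta_mx (merged_star S) 0).
  split; first exact: simplex_delta.
  by move=> b _; rewrite Btilde_star; exact: (risk_beta_star_le data beta_tail_eq0).
by rewrite uniq_min.
Qed.

Lemma nondegenerate_risk k : ~~ in_correct_range (S := S) k ->
  exists b, (risk L (S := S) (beta_star S) < risk L (S := S) b)%E.
Proof.
move=> /merged_wrongP[a anstar _].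
exists (Btilde S *m delta_mx a 0); rewrite ltNge; apply/negP => le.
have : argmin (simplex (nmerged S)) (fun w => risk L (Btilde S *m w)) (delta_mx a 0).
  split; first exact: simplex_delta.
  move=> b _; apply: le_trans le _; exact: (risk_beta_star_le data beta_tail_eq0).
rewrite uniq_min /= wtilde_star => /matrixP/(_ a 0).
by rewrite !mxE !eqxx/= (negbTE anstar) => /eqP; rewrite oner_eq0.
Qed.

Definition excess k : 'cV[R]_p := col k (Bstar S) - beta_star S.

(** Right inverse of [unmerge] on the wrong models; all correct ones go to [merged_star]. *)
Definition merge (k : 'I_K) : 'I_(nmerged S) :=
  odflt (merged_star S) [pick a | unmerge a == k].

(** A combination of wrong models is a weight [w] vanishing at [merged_star], so [w - wtilde S] has
    entry -1 there: the denominator of the quotient is 1 and its numerator is the squared norm of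
    [b]. *)
Lemma phi2_le (om : 'I_K -> R) : (forall k, 0 <= om k) -> \sum_k om k = 1 ->
  (forall k, in_correct_range k -> om k = 0) ->
  let b := \sum_k om k *: excess k in phi2 S <= dotp b b.
Proof.
move=> om0 om1 omc /=; set b := \sum_k _.
pose w : 'cV[R]_(nmerged S) := \sum_k om k *: delta_mx (merge k) 0.
have mergeK k : om k != 0 -> unmerge (merge k) = k.
  move=> ok; rewrite /merge; case: pickP => [a /eqP//|/= no].
  have nk : ~~ in_correct_range k by apply: contra ok => /omc ->.
  by have [a _ ak] := merged_wrongP nk; have := no a; rewrite ak eqxx.
have wE a : w a 0 = \sum_k om k * (a == merge k)%:R.
  by rewrite /w summxE; apply: eq_bigr => k _; rewrite !mxE eqxx andbT.
have w0 a : 0 <= w a 0 by rewrite wE sumr_ge0// => k _; rewrite mulr_ge0.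
have w1 : \sum_a w a 0 = 1.
  under eq_bigr do rewrite wE.
  rewrite exchange_big/=; transitivity (\sum_k om k) => //; apply: eq_bigr => k _.
  rewrite -mulr_sumr (bigD1 (merge k))//= eqxx big1 ?addr0 ?mulr1//.
  by move=> a /negbTE ->.
have ws : simplex (nmerged S) w.
  split => // a; rewrite w0/= -w1 (bigD1 a)//= lerDl sumr_ge0//.
have wstar0 : w (merged_star S) 0 = 0.
  rewrite wE big1// => k _; have [->|ok] := eqVneq (om k) 0; first by rewrite mul0r.
  case: eqP => [e|]; rewrite ?mulr0//; exfalso; move/eqP: (ok); apply; apply: omc.
  by rewrite -(mergeK k ok) -e; exact: kstar_correct.
have bE : Btilde S *m (w - wtilde S) = b.
  rewrite mulmxBr wtilde_star Btilde_star /w mulmx_sumr /b /excess.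
  under [RHS]eq_bigr do rewrite scalerBr.
  rewrite big_split/= sumrN -scaler_suml om1 scale1r; congr (_ - _).
  apply: eq_bigr => k _; rewrite -scalemxAr -colE Btilde_col.
  by have [->|ok] := eqVneq (om k) 0; rewrite ?scale0r// mergeK.
have Dstar : (w - wtilde S) (merged_star S) 0 = -1.
  by rewrite 2!mxE wstar0 wtilde_star mxE !eqxx sub0r.
apply: ge_inf.
  exists 0 => _ [D _ <-]; rewrite mulr_ge0 ?sqr_ge0// invr_ge0 sqr_ge0//.
exists (w - wtilde S).
  split; last by exists w.
  by apply/eqP => e; move: Dstar; rewrite e mxE => /eqP; rewrite eq_sym oppr_eq0 oner_eq0.
by rewrite Dstar bE normrN1 expr1n invr1 mulr1 lqnorm2E sqr_sqrtr// dotp_ge0.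
Qed.

(** An average over a tuple is the convex combination with the empirical frequencies, so Maurey
    averages are bounded below like the original direction. *)
Lemma phi2_le_average (m : nat) (t : m.-tuple 'I_K) : (0 < m)%N ->
  {in t, forall k, ~~ in_correct_range k} ->
  let b := m%:R^-1 *: \sum_(k <- t) excess k in phi2 S <= dotp b b.
Proof.
move=> m0 tw /=; pose om k : R := m%:R^-1 * \sum_(l <- t) (l == k)%:R.
have -> : m%:R^-1 *: \sum_(k <- t) excess k = \sum_k om k *: excess k.
  under [RHS]eq_bigr do rewrite -scalerA scaler_suml.
  rewrite -scaler_sumr exchange_big/=; congr (_ *: _); apply: eq_bigr => l _.
  rewrite (bigD1 l)//= eqxx scale1r big1 ?addr0// => k kl.
  by rewrite eq_sym (negbTE kl) scale0r.
apply: phi2_le.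
- by move=> k; rewrite mulr_ge0 ?invr_ge0// sumr_ge0.
- rewrite -mulr_sumr exchange_big/= (eq_bigr (fun=> 1)); last first.
    move=> l _; rewrite (bigD1 l)//= eqxx big1 ?addr0// => k kl.
    by rewrite eq_sym (negbTE kl).
  by rewrite big_tuple sumr_const card_ord mulVf// pnatr_eq0 -lt0n.
- move=> k ck; rewrite /om big_seq big1 ?mulr0// => l lt.
  by case: eqP => // e; move: (tw l lt); rewrite e ck.
Qed.

Lemma excess_le (rho : R) : (forall k, dotp (col k (Bstar S)) (col k (Bstar S)) <= rho) ->
  forall k, dotp (excess k) (excess k) <= 4 * rho.
Proof.
move=> h k; apply: dotpB_le; first exact: h.
by rewrite -(col_correct kstar_correct).
Qed.

Lemma phi2_le_excess k : ~~ in_correct_range k -> phi2 S <= dotp (excess k) (excess k).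
Proof.
move=> nk; have := @phi2_le (fun l => (l == k)%:R); rewrite /=.
have -> : \sum_l (l == k)%:R *: excess l = excess k.
  by rewrite (bigD1 k)//= eqxx scale1r big1 ?addr0// => l /negbTE ->; rewrite scale0r.
apply => //.
- by rewrite (bigD1 k)//= eqxx big1 ?addr0// => l /negbTE ->.
- by move=> l cl; case: eqP => // e; move: nk; rewrite -e cl.
Qed.

End merged.

(** * Rates *)

Section norms.
Context {R : realType} {p : nat}.

Lemma lqnorm1E (v : 'cV[R]_p) : lqnorm 1 v = norm1 v.
Proof.
rewrite /lqnorm invr1 powRr1; last by rewrite sumr_ge0// => j _; rewrite powR_ge0.
by apply: eq_bigr => j _; rewrite powRr1.
Qed.

(** No entry exceeds [N], so a square is at most [N] to the power [2 - q] times the [q]-th power. *)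
Lemma lqnorm2_le_lqnorm (q : R) (v : 'cV[R]_p) : 0 < q < 1 -> lqnorm 2 v <= lqnorm q v.
Proof.
move=> /andP[q0 q1]; set N := lqnorm q v.
have S0 : 0 <= \sum_j `|v j 0| `^ q by rewrite sumr_ge0// => j _; rewrite powR_ge0.
have N0 : 0 <= N by exact: powR_ge0.
have Nq : N `^ q = \sum_j `|v j 0| `^ q by rewrite /N /lqnorm -powRrM mulVf ?gt_eqF// powRr1.
have vN j : `|v j 0| <= N.
  have -> : `|v j 0| = (`|v j 0| `^ q) `^ q^-1 by rewrite -powRrM mulfV ?gt_eqF// powRr1.
  apply: ge0_ler_powR; rewrite ?nnegrE ?powR_ge0 ?invr_ge0 ?(ltW q0)//.
  by rewrite (bigD1 j)//= lerDl sumr_ge0// => k _; rewrite powR_ge0.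
rewrite lqnorm2E -(ger0_norm N0) -sqrtr_sqr ler_wsqrtr//.
have sq j : v j 0 * v j 0 <= N `^ (2 - q) * `|v j 0| `^ q.
  have [v0|v0] := eqVneq `|v j 0| 0.
    by move/eqP: v0; rewrite normr_eq0 => /eqP ->; rewrite mul0r mulr_ge0// powR_ge0.
  rewrite -expr2 -(real_normK (num_real _)) -powR_mulrn//.
  rewrite -[in leLHS](subrK q 2%:R) powRD; last by rewrite v0 implybT.
  rewrite ler_wpM2r ?powR_ge0//; apply: ge0_ler_powR; rewrite ?nnegrE//.
  by rewrite subr_ge0 ltW// (lt_trans q1)// ltr1n.
apply: le_trans (ler_sum _ (fun j _ => sq j)) _.
rewrite -mulr_sumr -Nq -powRD; last by rewrite subrK pnatr_eq0.
by rewrite subrK powR_mulrn.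
Qed.

End norms.

Section real_rates.
Context {R : realType}.
Variables (q s h a Kb su c1 phi C0 r : R).
Hypotheses (q01 : 0 <= q < 1) (s0 : 0 < s) (sK : s <= Kb) (sh : 0 < q -> s <= h)
  (a0 : 0 < a) (su1 : 1 <= su) (c10 : 0 < c1) (C00 : 0 < C0).

Definition Trate : R :=
  if q == 0 then Num.sqrt su * a else h `^ (q / 2) * a `^ (1 - q / 2).

Definition Psirate : R :=
  if q == 0 then Trate else Num.max (h `^ (2 / (2 - q)) * a) Trate.

Hypotheses (phi_le : phi <= 4 * s ^+ 2) (Psi_le : Psirate <= c1 * phi)
  (c1_small : 4 * c1 * (1 + Kb) ^+ 2 <= 1).

Let Kb0 : 0 < Kb. Proof. exact: lt_le_trans sK. Qed.

Let Crho := (1 + Kb) ^+ 2.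

Let Crho0 : 0 < Crho.
Proof. by rewrite exprn_gt0// ltr_wpDl// ltW. Qed.

Let q_cases : q = 0 \/ 0 < q.
Proof. by case/andP: q01; rewrite le_eqVlt => /predU1P[<-|]; [left|right]. Qed.

Let hpos : 0 < q -> 0 < h.
Proof. by move=> q0; exact: lt_le_trans (sh q0). Qed.

Lemma Trate0 : q = 0 -> Trate = Num.sqrt su * a.
Proof. by move=> q0; rewrite /Trate q0 eqxx. Qed.

Lemma Trate_gt : 0 < q -> Trate = h `^ (q / 2) * a `^ (1 - q / 2).
Proof. by move=> q0; rewrite /Trate gt_eqF. Qed.

Lemma Trate_le_Psirate : Trate <= Psirate.
Proof. by rewrite /Psirate; case: ifP => // _; rewrite le_max lexx orbT. Qed.

Lemma Trate_gt0 : 0 < Trate.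
Proof.
case: q_cases => q0.
  by rewrite (Trate0 q0) mulr_gt0// sqrtr_gt0 (lt_le_trans ltr01).
rewrite (Trate_gt q0); apply: mulr_gt0; apply: powR_gt0; last exact: a0.
exact: hpos.
Qed.

Let a_le_T0 : q = 0 -> a <= Trate.
Proof.
move=> q0; rewrite (Trate0 q0) -[leLHS]mul1r; apply: ler_wpM2r; first exact: ltW.
by rewrite -[leLHS]sqrtr1 ler_wsqrtr.
Qed.

Let s_powR (e : R) : 0 <= e -> e <= 2 -> s `^ e <= Crho.
Proof.
move=> e0 e2; have K1 : 0 <= 1 + Kb by rewrite addr_ge0// ltW.
apply: (@le_trans _ _ ((1 + Kb) `^ e)).
  apply: ge0_ler_powR => //; rewrite ?nnegrE ?(ltW s0)//.
  by apply: (le_trans sK); rewrite lerDr.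
rewrite /Crho -(powR_mulrn 2 K1).
by apply: ler_powR => //; rewrite lerDl ltW.
Qed.

Let s_split (e u : R) : s `^ u = s `^ e * s `^ (u - e).
Proof.
have := @powRD _ s e (u - e); rewrite (gt_eqF s0) implybT => /(_ isT) <-.
by congr (_ `^ _); rewrite addrC subrK.
Qed.

(** Part of the power of [s] is traded for [h] through [s <= h], the remainder for a constant
    through [s <= Kb]. *)
Let s_powR_h (e u : R) : 0 < q -> 0 <= e -> e <= u -> u <= 2 -> s `^ u <= h `^ e * Crho.
Proof.
move=> q0 e0 eu u2; rewrite (s_split e u); apply: ler_pM; rewrite ?powR_ge0//.
  apply: ge0_ler_powR => //; rewrite ?nnegrE ?(ltW s0) ?(ltW (hpos q0))//.
  exact: sh.
by apply: s_powR; lra.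
Qed.

Let s_sqr : s ^+ 2 = s `^ 2.
Proof. by rewrite (powR_mulrn 2 (ltW s0)). Qed.

Let s_sqr_le : 0 < q -> s ^+ 2 <= h `^ (2 / (2 - q)) * Crho.
Proof.
case/andP: (q01) => _ q1 q0; have q2 : 0 < 2 - q by lra.
rewrite s_sqr; apply: s_powR_h => //; first by rewrite divr_ge0// ltW.
by rewrite ler_pdivrMr//; lra.
Qed.

(** Controls the Maurey approximation error; for [q > 0] it is matched with the first term of
    [Psirate], whose exponent [2 / (2 - q)] is at most 2. *)
Lemma sqr_rate_le : s ^+ 2 * a <= Crho * Psirate.
Proof.
case: q_cases => q0.
  apply: ler_pM; rewrite ?sqr_ge0 ?(ltW a0)//; first by rewrite s_sqr; apply: s_powR.
  exact: le_trans (a_le_T0 q0) Trate_le_Psirate.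
apply: (@le_trans _ _ (h `^ (2 / (2 - q)) * Crho * a)).
  by apply: ler_wpM2r; [exact: ltW|exact: s_sqr_le].
rewrite mulrAC mulrC; apply: ler_wpM2l; first exact: ltW.
by rewrite /Psirate gt_eqF// le_max lexx.
Qed.

Let Psi_le_s : Psirate <= 4 * c1 * s ^+ 2.
Proof. by apply: (le_trans Psi_le); have := ler_wpM2l (ltW c10) phi_le; lra. Qed.

(** For [q > 0] the power of [h] in the first term of [Psirate] also bounds [s ^+ 2] up to a
    constant, and cancelling it in [Psirate <= 4 * c1 * s ^+ 2] leaves a bound on [a]. *)
Lemma rate_le : a <= 4 * c1 * Crho.
Proof.
have c4 : 0 <= 4 * c1 by rewrite mulr_ge0// ltW.
case: q_cases => q0.
  apply: le_trans (a_le_T0 q0) _; apply: le_trans Trate_le_Psirate _.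
  apply: (le_trans Psi_le_s); apply: ler_wpM2l => //.
  by rewrite s_sqr; apply: s_powR.
have h0 : 0 < h `^ (2 / (2 - q)) by apply: powR_gt0; exact: hpos.
rewrite -(ler_pM2l h0); apply: (@le_trans _ _ Psirate).
  by rewrite /Psirate gt_eqF// le_max lexx.
apply: (le_trans Psi_le_s).
by rewrite [leRHS]mulrCA; apply: ler_wpM2l => //; exact: s_sqr_le.
Qed.

Lemma rate_le1 : a <= 1.
Proof. exact: le_trans rate_le c1_small. Qed.

(** For the gradient in the directions of size [s]; [a <= 1] allows lowering its exponent to
    [1 - q / 2]. *)
Lemma norm_rate_le : s * a <= Crho * Trate.
Proof.
have a1 := rate_le1; case/andP: q01 => _ q1; have s1 : s = s `^ 1 by rewrite powRr1// ltW.
case: q_cases => q0.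
  apply: ler_pM; rewrite ?(ltW s0) ?(ltW a0)//; last exact: a_le_T0.
  by rewrite s1; apply: s_powR; rewrite ?ler0n ?ler1n.
rewrite (Trate_gt q0) mulrA; apply: ler_pM; rewrite ?(ltW s0) ?(ltW a0)//.
  by rewrite [leRHS]mulrC s1; apply: s_powR_h => //; lra.
by apply: ger1_powR; [rewrite a0 a1|lra].
Qed.

Hypothesis r3 : 0 <= r <= 3 * a.

Let powR3_le (e : R) : 0 <= e -> e <= 1 -> r `^ e <= 3 * a `^ e.
Proof.
move=> e0 e1; case/andP: r3 => r0 ra; have a0' := ltW a0.
apply: (@le_trans _ _ ((3 * a) `^ e)).
  by apply: ge0_ler_powR => //; rewrite ?nnegrE// mulr_ge0.
rewrite powRM//; apply: ler_wpM2r; first exact: powR_ge0.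
by apply: ler1_powR => //; rewrite ler1n.
Qed.

Lemma l2_rate_le :
  (if q == 0 then C0 * Num.sqrt su * r else C0 * h `^ (q / 2) * r `^ (1 - q / 2))
  <= 3 * C0 * Trate.
Proof.
case/andP: (q01) (r3) => _ q1 /andP[r0 ra]; have C0' := ltW C00; case: q_cases => q0.
  rewrite (Trate0 q0) ifT ?q0//.
  apply: (@le_trans _ _ (C0 * Num.sqrt su * (3 * a))).
    by apply: ler_wpM2l => //; rewrite mulr_ge0 ?sqrtr_ge0.
  by rewrite le_eqVlt; apply/orP; left; apply/eqP; ring.
rewrite (Trate_gt q0) gt_eqF//.
have p3 : r `^ (1 - q / 2) <= 3 * a `^ (1 - q / 2) by apply: powR3_le; lra.
have h0 : 0 <= h `^ (q / 2) by exact: powR_ge0.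
move: p3 h0; set x := r `^ _; set y := a `^ _; set z := h `^ _ => p3 h0.
have := ler_wpM2l (mulr_ge0 C0' h0) p3; lra.
Qed.

(** The l1 rate times [a] is of the order of the squared l2 rate: for [q > 0], both are the [q]-th
    power of [h] times [a] to the power [2 - q]. *)
Lemma l1_rate_le :
  (if q == 0 then C0 * su * r else C0 * h `^ q * r `^ (1 - q)) * a
  <= 3 * C0 * Trate ^+ 2.
Proof.
case/andP: (q01) (r3) => _ q1 /andP[r0 ra]; have C0' := ltW C00; have a0' := ltW a0.
case: q_cases => q0.
  rewrite (Trate0 q0) ifT ?q0// exprMn sqr_sqrtr ?(le_trans _ su1)//.
  have := ler_wpM2l (mulr_ge0 C0' (le_trans ler01 su1)) ra.
  move=> /(ler_wpM2r a0'); lra.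
rewrite (Trate_gt q0) gt_eqF// exprMn.
have h2 : (h `^ (q / 2)) ^+ 2 = h `^ q.
  by rewrite -(powR_mulrn 2 (powR_ge0 _ _)) -powRrM; congr (_ `^ _); field.
have a2 : (a `^ (1 - q / 2)) ^+ 2 = a `^ (1 - q) * a.
  rewrite -(powR_mulrn 2 (powR_ge0 _ _)) -powRrM.
  have := @powRD _ a (1 - q) 1; rewrite (gt_eqF a0) implybT => /(_ isT).
  by rewrite (powRr1 a0') => <-; congr (_ `^ _); field.
rewrite h2 a2.
have p3 : r `^ (1 - q) <= 3 * a `^ (1 - q) by apply: powR3_le; lra.
have h0 : 0 <= h `^ q by exact: powR_ge0.
move: p3 h0; set x := r `^ _; set y := a `^ _; set z := h `^ _ => p3 h0.
have := ler_wpM2r a0' (ler_wpM2l (mulr_ge0 C0' h0) p3); lra.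
Qed.

End real_rates.

Section rates.
Context {R : realType} {dY : measure_display} {Ycal : measurableType dY}.
Context {J : nat} (S : experiment R Ycal J).
Variables (q C0 Kbeta c1 : R).
Hypotheses (q01 : 0 <= q < 1) (C00 : 0 < C0) (c10 : 0 < c1).
Hypothesis Kb : forall k, lqnorm 2 (col k (Bstar S)) <= Kbeta.
Hypothesis K2 : (2 <= nmod S)%N.

Definition smax : R := \big[Num.max/0]_k lqnorm 2 (col k (Bstar S)).
Definition arate : R := Num.sqrt (log_pK S / (nobs S)%:R).

Hypothesis smax0 : 0 < smax.
Hypothesis phi_le : phi2 S <= 4 * smax ^+ 2.
Hypothesis Psi_le : Psin S q <= c1 * phi2 S.
Hypothesis c1_small : 4 * c1 * (1 + Kbeta) ^+ 2 <= 1.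

Lemma lqnorm2_le_smax k : lqnorm 2 (col k (Bstar S)) <= smax.
Proof. exact: le_bigmax. Qed.

Lemma dotp_le_smax k : dotp (col k (Bstar S)) (col k (Bstar S)) <= smax ^+ 2.
Proof.
have := lqnorm2_le_smax k; rewrite lqnorm2E => h.
by rewrite -(sqr_sqrtr (dotp_ge0 _)) ler_pXn2r ?nnegrE ?sqrtr_ge0// bigmax_ge_id.
Qed.

Lemma smax_attained : exists k, smax = lqnorm 2 (col k (Bstar S)).
Proof.
have k0 : 'I_(nmod S) by exists 0%N; exact: ltn_trans K2.
have [k _ e] := @eq_bigmax _ R _ 0 k0 predT (fun k => lqnorm 2 (col k (Bstar S)))
  isT (fun k _ => powR_ge0 _ _).
by exists k.
Qed.

Lemma smax_le : smax <= Kbeta.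
Proof. by have [k ->] := smax_attained. Qed.

Lemma nonzero_entry : exists j k, Bstar S j k != 0.
Proof.
apply: contrapT => no; have [k e] := smax_attained.
move: smax0; rewrite e lqnorm2E /dotp big1 ?sqrtr0 ?ltxx// => j _.
rewrite !mxE; have [->|n0] := eqVneq (Bstar S j k) 0; first by rewrite mul0r.
by case: no; exists j, k.
Qed.

Lemma pdim_gt0 : (0 < pdim S)%N.
Proof. by have [j _] := nonzero_entry; exact: leq_ltn_trans (ltn_ord j). Qed.

Lemma pK_ge2 : (2 <= pdim S * nmod S)%N.
Proof. exact: (@leq_mul 1 2 (pdim S) (nmod S) pdim_gt0 K2). Qed.

Lemma log_pK_gt0 : 0 < log_pK S.
Proof. by rewrite /log_pK ln_gt0// ltr1n pK_ge2. Qed.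

Lemma nobs_pos : (0 : R) < (nobs S)%:R.
Proof. by rewrite ltr0n nobs_gt0. Qed.

Lemma arate_sqr : arate ^+ 2 = log_pK S / (nobs S)%:R.
Proof. by rewrite sqr_sqrtr// divr_ge0 ?ltW ?log_pK_gt0 ?nobs_pos. Qed.

Lemma arate_gt0 : 0 < arate.
Proof. by rewrite sqrtr_gt0 divr_gt0 ?log_pK_gt0 ?nobs_pos. Qed.

Lemma arate_powR (e : R) : (log_pK S / (nobs S)%:R) `^ e = arate `^ (2 * e).
Proof. by rewrite powRrM (powR_mulrn 2 (ltW arate_gt0)) arate_sqr. Qed.

Lemma smax_le_h_u : 0 < q -> smax <= h_u S q.
Proof.
move=> q0; have [k ->] := smax_attained.
apply: le_trans (lqnorm2_le_lqnorm _ (q := q) _) _.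
  by case/andP: q01 => _ ->; rewrite q0.
exact: (le_bigmax 0 (fun k => lqnorm q (col k (Bstar S)))).
Qed.

Lemma s_u_ge1 : (1 : R) <= (s_u S)%:R.
Proof.
rewrite ler1n; have [j [k jk]] := nonzero_entry.
apply: leq_trans (leq_bigmax k); rewrite /l0norm.
by apply/card_gt0P; exists j; rewrite inE mxE.
Qed.

Lemma Tn_Trate : Tn S q = Trate q (h_u S q) arate (s_u S)%:R.
Proof.
rewrite /Tn /Trate; case: ifP => // _; rewrite arate_powR; congr (_ * _ `^ _).
by field.
Qed.

Lemma Psin_Psirate : Psin S q = Psirate q (h_u S q) arate (s_u S)%:R.
Proof. by rewrite /Psin /Psirate Tn_Trate. Qed.

Lemma rate_base_le : 0 <= 2 * arate + Num.sqrt (ln (p_u S)%:R / (nobs S)%:R) <= 3 * arate.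
Proof.
rewrite addr_ge0 ?sqrtr_ge0 ?mulr_ge0 ?(ltW arate_gt0)//=.
suff : Num.sqrt (ln (p_u S)%:R / (nobs S)%:R) <= arate by lra.
apply: ler_wsqrtr; apply: ler_wpM2r; first by rewrite invr_ge0 ltW// nobs_pos.
(* At [p_u S = 0] the logarithm is 0 by convention. *)
have [->|pu] := posnP (p_u S); first by rewrite ln0// ltW// log_pK_gt0.
rewrite /log_pK ler_ln ?posrE ?ltr0n//; last exact: leq_trans pK_ge2.
rewrite ler_nat; apply: (@leq_trans (pdim S)); last by rewrite leq_pmulr// (leq_trans _ K2).
apply/bigmax_leqP => k _; rewrite -[X in (_ <= X)%N]card_ord; exact: max_card.
Qed.

Let Psi_le' : Psirate q (h_u S q) arate (s_u S)%:R <= c1 * phi2 S.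
Proof. by rewrite -Psin_Psirate. Qed.

Lemma Tn_le : Tn S q <= c1 * phi2 S.
Proof. rewrite Tn_Trate; exact: le_trans (Trate_le_Psirate _ _ _ _) Psi_le'. Qed.

Lemma Tn_gt0 : 0 < Tn S q.
Proof.
rewrite Tn_Trate.
exact: (Trate_gt0 q01 smax0 smax_le_h_u arate_gt0 s_u_ge1).
Qed.

Lemma smax_sqr_arate : smax ^+ 2 * arate <= (1 + Kbeta) ^+ 2 * Psin S q.
Proof.
rewrite Psin_Psirate.
exact: (sqr_rate_le q01 smax0 smax_le smax_le_h_u arate_gt0 s_u_ge1).
Qed.

Lemma arate_le : arate <= 4 * c1 * (1 + Kbeta) ^+ 2.
Proof.
exact: (rate_le q01 smax0 smax_le smax_le_h_u arate_gt0 s_u_ge1 c10 phi_le Psi_le').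
Qed.

Lemma smax_arate : smax * arate <= (1 + Kbeta) ^+ 2 * Tn S q.
Proof.
rewrite Tn_Trate.
exact: (norm_rate_le q01 smax0 smax_le smax_le_h_u arate_gt0 s_u_ge1 c10 phi_le Psi_le' c1_small).
Qed.

Lemma rate2_le : rate2 S q C0 (2 * arate) <= 3 * C0 * Tn S q.
Proof. rewrite Tn_Trate; exact: (l2_rate_le _ _ q01 arate_gt0 C00 rate_base_le). Qed.

Lemma rate1_le : rate1 S q C0 (2 * arate) * arate <= 3 * C0 * Tn S q ^+ 2.
Proof. rewrite Tn_Trate; exact: (l1_rate_le _ q01 arate_gt0 s_u_ge1 C00 rate_base_le). Qed.

Lemma expR_arate : expR (- ((nobs S)%:R * arate ^+ 2)) = ((pdim S * nmod S)%:R)^-1.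
Proof.
rewrite arate_sqr mulrCA mulfV ?mulr1 ?gt_eqF ?nobs_pos// expRN lnK// posrE ltr0n.
exact: leq_trans pK_ge2.
Qed.

End rates.

Lemma lqnorm_measurable {R : realType} {d : measure_display} {T : measurableType d}
    {p : nat} (q : R) (V : T -> 'cV[R]_p) : (forall j, measurable_fun setT (fun w => V w j 0)) ->
  measurable_fun setT (fun w => lqnorm q (V w)).
Proof.
move=> mV; apply: (measurableT_comp (measurable_powR _)); apply: measurable_sum => j.
by apply: (measurableT_comp (measurable_powR _)); exact: measurableT_comp.
Qed.

Lemma leq_double_subn_divn (m d : nat) : (2 <= d)%N -> (m <= 2 * (m - m %/ d))%N.
Proof.
move=> d2; have h : (m %/ d * 2 <= m)%N.
  by apply: leq_trans (leq_divM m d); rewrite leq_mul2l d2 orbT.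
lia.
Qed.

Lemma ord_le1_eq (m : nat) (x y : 'I_m) : (m <= 1)%N -> x = y.
Proof. by move=> m1; apply: ord_inj; case: x y => x xm [y ym] /=; lia. Qed.

(** * The good event *)

Section high_probability.
Context {R : realType} {dY : measure_display} {Ycal : measurableType dY}.
Context {J : nat} (L : Ycal -> R -> R) (S : experiment R Ycal J).
Variables (q Lu Kx Ky kappal Kbeta C0 c1 : R).
Hypotheses (J2 : (2 <= J)%N) (q01 : 0 <= q < 1) (Lu0 : 0 < Lu) (Kx0 : 0 < Kx) (Ky0 : 0 < Ky)
  (kap0 : 0 < kappal) (Kb0 : 0 < Kbeta) (C00 : 0 < C0) (c10 : 0 < c1).
Hypothesis mL : forall mu, measurable_fun setT (L^~ mu).
Hypothesis dL1 : forall y mu, derivable (L y : R -> R^o) mu 1.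
Hypothesis dL2 : forall y mu, derivable (dL L y : R -> R^o) mu 1.
Hypothesis lip : forall y mu1 mu2, `|dL L y mu1 - dL L y mu2| <= Lu * `|mu1 - mu2|.
Hypothesis data : data_model L S.
Hypothesis est : estimators L S.
Hypothesis corr : forall k, correct k <-> in_correct_range (S := S) k.
Hypothesis uniq_min : wtilde_unique_min L S.
Hypothesis sub : subgaussian_design L S Kx Ky kappal.
Hypothesis rates : estimation_rates S q C0 Kbeta.
Hypothesis Psi_le : Psin S q <= c1 * phi2 S.
Variable k0 : 'I_(nmod S).
Hypothesis k0_wrong : ~~ in_correct_range k0.

Notation P := (Prob S).
Notation n := (nobs S).
Notation p := (pdim S).
Notation K := (nmod S).
Notation a := (arate S).
Notation sb := (small_ball_rate Kx kappal Kbeta).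
Notation Cg := (28 / grad_scale Lu Kx Ky Kbeta).
Notation Crho := ((1 + Kbeta) ^+ 2).

Hypothesis c1_a : 16 * c1 * Crho <= 1.
Hypothesis c1_sb : 16 * c1 * Crho <= sb.

Lemma nmod_ge2 : (2 <= K)%N.
Proof.
have ks : kstar S != k0 by apply: contraNneq k0_wrong => <-; exact: kstar_correct.
by rewrite ltnNge; apply/negP => K1; case/eqP: ks; exact: ord_le1_eq.
Qed.

Lemma lqnorm2_Bstar k : lqnorm 2 (col k (Bstar S)) <= Kbeta.
Proof. by case: rates. Qed.

Lemma beta_star_sqr_le : dotp (beta_star S) (beta_star S) <= Kbeta ^+ 2.
Proof.
rewrite -(col_correct corr (kstar_correct S)) -(sqr_sqrtr (dotp_ge0 _)) -lqnorm2E.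
by rewrite ler_pXn2r ?nnegrE ?lqnorm2_Bstar ?(ltW Kb0)// powR_ge0.
Qed.

(** If all pseudo-true vectors vanished, they would all equal [beta_star] and [k0] would be
    correct. *)
Lemma smax_gt0 : 0 < smax S.
Proof.
rewrite lt_neqAle bigmax_ge_id andbT; apply/negP => /eqP s0.
have B0 k : col k (Bstar S) = 0.
  apply/matrixP => j l; rewrite (ord1 l) [RHS]mxE; apply/eqP; rewrite -sqrf_eq0 expr2; apply/eqP.
  have := dotp_le_smax k; rewrite -s0 expr0n/= => d0.
  have /eqP : dotp (col k (Bstar S)) (col k (Bstar S)) = 0.
    by apply/le_anti; rewrite d0 dotp_ge0.
  by move=> /eqP/psumr_eq0P -> // i _; rewrite -expr2 sqr_ge0.
move/negP: k0_wrong; apply; apply/corr; split; first exact: beta_tail_eq0.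
by rewrite B0 -(B0 (kstar S)) (col_correct corr (kstar_correct S)).
Qed.

Let K2 := nmod_ge2.
Let s0 := smax_gt0.

Lemma excess_sqr_le (k : 'I_K) : dotp (excess k) (excess k) <= 4 * smax S ^+ 2.
Proof. exact: (excess_le corr (@dotp_le_smax _ _ _ _ S)). Qed.

Lemma phi2_le_smax : phi2 S <= 4 * smax S ^+ 2.
Proof. exact: le_trans (phi2_le_excess data corr uniq_min k0_wrong) (excess_sqr_le k0). Qed.

Lemma smax_sqr_le : smax S ^+ 2 <= Kbeta ^+ 2.
Proof.
rewrite ler_pXn2r ?nnegrE ?(ltW s0) ?(ltW Kb0)//.
exact: (smax_le lqnorm2_Bstar K2).
Qed.

Let a0 : 0 < a := arate_gt0 K2 s0.
Let T0 : 0 < Tn S q := Tn_gt0 q01 K2 s0.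
Let nR : (0 : R) < n%:R := nobs_pos S.

Lemma arate_small : 4 * a <= 1 /\ 4 * a <= sb.
Proof.
have := arate_le q01 c10 lqnorm2_Bstar K2 s0 phi2_le_smax Psi_le.
by move: c1_a c1_sb; split; lra.
Qed.

Let c1_small : 4 * c1 * Crho <= 1.
Proof. by have : 0 <= c1 * Crho by [rewrite mulr_ge0 ?sqr_ge0 ?ltW]; move: c1_a; lra. Qed.

Lemma phi2_gt0 : 0 < phi2 S.
Proof.
rewrite -(pmulr_rgt0 _ c10).
exact: lt_le_trans T0 (Tn_le K2 s0 Psi_le).
Qed.

Lemma Tn_le1 : Tn S q <= 1.
Proof.
apply: le_trans (Tn_le K2 s0 Psi_le) _; apply: le_trans c1_small.
have h : phi2 S <= 4 * Crho.
  apply: le_trans phi2_le_smax _; rewrite ler_pM2l//; apply: le_trans smax_sqr_le _.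
  rewrite ler_pXn2r ?nnegrE ?(ltW Kb0) ?addr_ge0 ?(ltW Kb0)//.
  by rewrite lerDr.
by have := ler_wpM2l (ltW c10) h; lra.
Qed.

(* Sizes of the empirical averages in Maurey's argument: small enough that the union bound over
   the tuples costs [(p * K) ^+ m <= expR (O(1) * n)], as [n * a ^+ 2 = ln (p * K)], and large
   enough for an error of order [a ^+ 2]. *)
Definition m_re : nat := Num.truncn (a ^+ 2)^-1.
Definition m_sb : nat := Num.truncn (sb / (4 * a ^+ 2)).

Lemma truncn_half (x : R) : 1 <= x -> x / 2 <= (Num.truncn x)%:R.
Proof.
move=> x1; have x0 : 0 <= x by exact: le_trans x1.
have /andP[_ h] := truncn_itv x0.
have t1 : (1 : R) <= (Num.truncn x)%:R by rewrite ler1n truncn_gt0.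
by rewrite -natr1 in h; lra.
Qed.

Let a2 : 0 < a ^+ 2. Proof. by rewrite exprn_gt0. Qed.

Let ia1 : 16 <= (a ^+ 2)^-1.
Proof.
have [a4 _] := arate_small; rewrite -(invrK 16) lef_pV2 ?posrE ?invr_gt0//.
have h : a <= 4^-1 by lra.
have -> : 16^-1 = 4^-1 ^+ 2 :> R by rewrite expr2 -invfM -natrM.
by rewrite ler_pXn2r// nnegrE ltW.
Qed.

Lemma m_re_le : (m_re)%:R <= (a ^+ 2)^-1.
Proof. by rewrite truncn_le invr_ge0 ltW. Qed.

Lemma m_re_gt1 : (1 < m_re)%N.
Proof.
by rewrite truncn_gt_nat (le_trans _ ia1)// ler_nat.
Qed.

Lemma m_re_inv : ((m_re)%:R - 1)^-1 <= 2 * a ^+ 2.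
Proof.
have h : (a ^+ 2)^-1 / 2 <= m_re%:R - 1.
  have /andP[_ t] := truncn_itv (ltW (lt_le_trans (ltr0n _ 16) ia1)).
  by rewrite -natr1 in t; move: ia1; rewrite /m_re; lra.
have -> : 2 * a ^+ 2 = ((a ^+ 2)^-1 / 2)^-1 by rewrite invfM !invrK mulrC.
have p1 : 0 < (a ^+ 2)^-1 / 2 by rewrite divr_gt0// invr_gt0.
by rewrite lef_pV2// posrE// (lt_le_trans p1).
Qed.

Let sb0 : 0 < sb. Proof. exact: small_ball_rate_gt0. Qed.

Let isb1 : 1 <= sb / (4 * a ^+ 2).
Proof.
have [a4 asb] := arate_small; rewrite ler_pdivlMr ?mulr_gt0// mul1r.
apply: le_trans asb; rewrite ler_pM2l// expr2 ler_piMr ?(ltW a0)//; lra.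
Qed.

Lemma m_sb_le : (m_sb)%:R <= sb / (4 * a ^+ 2).
Proof. by rewrite truncn_le (le_trans _ isb1). Qed.

Lemma m_sb_gt0 : (0 < m_sb)%N.
Proof. by rewrite truncn_gt0. Qed.

Lemma m_sb_inv : (m_sb)%:R^-1 <= 8 * a ^+ 2 / sb.
Proof.
have h := truncn_half isb1.
have -> : 8 * a ^+ 2 / sb = (sb / (4 * a ^+ 2) / 2)^-1.
  by field; rewrite (gt_eqF sb0) (gt_eqF a0).
have p1 : 0 < sb / (4 * a ^+ 2) / 2 by rewrite divr_gt0// (lt_le_trans ltr01 isb1).
by rewrite lef_pV2// posrE// (lt_le_trans p1).
Qed.

(** Outside this event [emp_form_le_norm1] applies to every vector at once, hence to errors that
    depend on the whole sample. *)
Definition re_event : set (Omega S) :=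
  [set w | exists t : m_re.-tuple ('I_p * bool), norm_event Kx (\sum_(k <- t) sgn_basis k) w].
Definition excess_event : set (Omega S) :=
  [set w | exists k : 'I_K, norm_event Kx (excess k) w].
Definition approx_event : set (Omega S) :=
  [set w | exists t : m_sb.-tuple 'I_K,
     ball_event Kx kappal Kbeta (m_sb%:R^-1 *: \sum_(k <- t) excess k) w].
Definition excess_grad_event : set (Omega S) :=
  [set w | exists k : 'I_K,
     grad_event L Lu Kx Ky Kbeta predT (excess k) (2 * smax S) a w].
Definition coord_grad_event : set (Omega S) :=
  [set w | exists mj : 'I_J * 'I_p,
     grad_event L Lu Kx Ky Kbeta (fun i => fold_of i == mj.1) (delta_mx mj.2 0) 1 a w].
Definition far_event : set (Omega S) :=
  [set w | exists mk : 'I_J * 'I_K,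
     (~` close_event (@Bhat_cv _ _ _ _ S mk.1) mk.2 q C0 (2 * a)) w].

Let pKinv : R := ((p * K)%:R)^-1.

Let pK0 : (0 : R) < (p * K)%:R.
Proof. by rewrite ltr0n; apply: leq_trans (pK_ge2 K2 s0). Qed.

Let pKE : (p * K)%:R = expR (n%:R * a ^+ 2) :> R.
Proof. by rewrite -[LHS]invrK -(expR_arate K2 s0) expRN invrK. Qed.

Let pKX (m : nat) : (p * K)%:R ^+ m = expR (m%:R * (n%:R * a ^+ 2)) :> R.
Proof. by rewrite pKE -expRM_natl. Qed.

Let K_le_pK : K%:R <= (p * K)%:R :> R.
Proof. by rewrite ler_nat leq_pmull// (pdim_gt0 K2 s0). Qed.

Let p_le_pK : p%:R <= (p * K)%:R :> R.
Proof. by rewrite ler_nat leq_pmulr// (leq_trans _ K2). Qed.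

Let a1 : a <= 1. Proof. by have [] := arate_small; lra. Qed.

Let na2 : n%:R * a ^+ 2 <= n%:R.
Proof. by rewrite ler_piMr// expr_le1// ltW. Qed.

Let inv2 : expR (- (2 * n%:R * a ^+ 2)) = pKinv * pKinv.
Proof. by rewrite /pKinv -(expR_arate K2 s0) -expRD; congr expR; ring. Qed.

Let pKinvK (x : R) : x <= (p * K)%:R -> x * (pKinv * pKinv) <= pKinv.
Proof.
move=> h; have i0 : 0 < pKinv by rewrite invr_gt0.
rewrite mulrA ler_piMl ?(ltW i0)//.
by rewrite -[leRHS](mulfV (_ : (p * K)%:R != 0 :> R)) ?gt_eqF// ler_wpM2r// ltW.
Qed.

Lemma re_event_prob : (P re_event <= (expR (- n%:R))%:E)%E.
Proof.
apply: le_trans (prob_exists_le (fun t => norm_event_measurable Kx data _)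
  (fun t => norm_event_prob Kx0 data sub _)) _.
rewrite lee_fin card_tuple card_prod card_ord card_bool natrX.
(* [K >= 2] absorbs the two signs, so the family has at most [(p * K) ^+ m_re <= expR n] members. *)
apply: (@le_trans _ _ ((p * K)%:R ^+ m_re * expR (- (2 * n%:R)))).
  rewrite ler_wpM2r ?expR_ge0// lerXn2r ?nnegrE ?ler0n//.
  by rewrite ler_nat leq_mul2l K2 orbT.
rewrite pKX -expRD ler_expR.
have := ler_wpM2r (ltW (mulr_gt0 nR a2)) m_re_le.
rewrite (_ : (a ^+ 2)^-1 * _ = n%:R); first by lra.
by field; rewrite (gt_eqF a0).
Qed.

Lemma excess_event_prob : (P excess_event <= (expR (- n%:R))%:E)%E.
Proof.
apply: le_trans (prob_exists_le (fun k => norm_event_measurable Kx data _)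
  (fun k => norm_event_prob Kx0 data sub _)) _.
rewrite lee_fin card_ord; apply: (@le_trans _ _ ((p * K)%:R * expR (- (2 * n%:R)))).
  by rewrite ler_wpM2r ?expR_ge0.
by rewrite pKE -expRD ler_expR; move: na2; lra.
Qed.

Lemma approx_sqr_le (t : m_sb.-tuple 'I_K) (B : R) :
  (forall k : 'I_K, dotp (excess k) (excess k) <= B) ->
  let b : 'cV[R]_p := m_sb%:R^-1 *: \sum_(k <- t) excess k in dotp b b <= B.
Proof.
move=> hB /=; rewrite scaler_sumr big_tuple.
have mR : (m_sb)%:R != 0 :> R by rewrite pnatr_eq0 -lt0n m_sb_gt0.
apply: (dotp_convex_le (om := fun=> m_sb%:R^-1)) => //.
by rewrite sumr_const card_ord -[LHS]mulr_natr mulVf.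
Qed.

Lemma approx_event_prob : (P approx_event <= (expR (- (sb / 4 * n%:R)))%:E)%E.
Proof.
have ex4 (k : 'I_K) : dotp (excess k) (excess k) <= 4 * Kbeta ^+ 2.
  by apply: le_trans (excess_sqr_le k) _; rewrite ler_pM2l// smax_sqr_le.
apply: le_trans (prob_exists_le (fun t => ball_event_measurable Kx kappal Kbeta data _)
  (fun t => ball_event_prob Kx0 kap0 Kb0 data sub beta_star_sqr_le (approx_sqr_le t ex4))) _.
rewrite lee_fin card_tuple card_ord natrX.
(* [m_sb] is chosen so that the tuples cost at most [expR (sb / 4 * n)], half of the available
   exponent. *)
apply: (@le_trans _ _ ((p * K)%:R ^+ m_sb * expR (- (sb / 2 * n%:R)))).
  by rewrite ler_wpM2r ?expR_ge0// lerXn2r ?nnegrE ?ler0n.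
rewrite pKX -expRD ler_expR.
have := ler_wpM2r (ltW (mulr_gt0 nR a2)) m_sb_le.
have -> : sb / (4 * a ^+ 2) * (n%:R * a ^+ 2) = sb / 4 * n%:R.
  by field; rewrite (gt_eqF a0).
lra.
Qed.

Let nondeg := nondegenerate_risk data corr uniq_min k0_wrong.

Let a01 : 0 < a <= 1. Proof. by rewrite a0 a1. Qed.

Lemma excess_grad_event_prob : (P excess_grad_event <= (2 * pKinv)%:E)%E.
Proof.
have s20 : 0 < 2 * smax S by rewrite mulr_gt0.
have ex (k : 'I_K) : dotp (excess k) (excess k) <= (2 * smax S) ^+ 2.
  by apply: le_trans (excess_sqr_le k) _; rewrite exprMn -natrX.
apply: le_trans (prob_exists_le
  (fun k => grad_event_measurable Lu Kx Ky Kbeta mL dL1 dL2 data _ _ _ _)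
  (fun k => grad_event_prob Lu0 Kx0 Ky0 Kb0 mL dL1 dL2 lip data sub
     (beta_tail_eq0 corr) beta_star_sqr_le nondeg predT s20 (ex k) a01)) _.
rewrite lee_fin card_ord mulrCA inv2 ler_pM2l//; exact: pKinvK.
Qed.

Lemma coord_grad_event_prob : (P coord_grad_event <= (2 * J%:R * pKinv)%:E)%E.
Proof.
have ex (j : 'I_p) : dotp (delta_mx j 0) (delta_mx j 0 : 'cV[R]_p) <= 1 ^+ 2.
  by rewrite dotp_delta mxE !eqxx expr1n.
apply: le_trans (prob_exists_le
  (fun mj => grad_event_measurable Lu Kx Ky Kbeta mL dL1 dL2 data _ _ _ _)
  (fun mj => grad_event_prob Lu0 Kx0 Ky0 Kb0 mL dL1 dL2 lip data sub
     (beta_tail_eq0 corr) beta_star_sqr_le nondeg (fun i => fold_of i == mj.1) ltr01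
     (ex mj.2) a01)) _.
rewrite lee_fin card_prod !card_ord natrM inv2.
rewrite (_ : _ * _ * _ = 2 * J%:R * (p%:R * (pKinv * pKinv))); last by ring.
by apply: ler_wpM2l; [exact: mulr_ge0|exact: pKinvK].
Qed.

Lemma close_event_measurable (m : 'I_J) (k : 'I_K) (delta : R) :
  measurable (close_event (@Bhat_cv _ _ _ _ S m) k q C0 delta).
Proof.
have mB : forall j, measurable_fun setT
    (fun w : Omega S => (col k (Bhat_cv m w) - col k (Bstar S)) j 0).
  move=> j; under eq_fun do rewrite !mxE.
  by apply: measurable_funB => //; case: est => -[_ []].
by apply: measurableI; apply: measurable_ler_set => //; exact: lqnorm_measurable.
Qed.

Lemma n_train_ge : n%:R <= 2 * (n_train S)%:R :> R.
Proof.
by rewrite -natrM ler_nat; exact: leq_double_subn_divn.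
Qed.

(** A training set has at least [n / 2] observations since [J >= 2], so [delta = 2 * a] gives each
    failure a probability of order [(p * K) ^- 2]. *)
Lemma far_event_prob : (P far_event <= (4 * J%:R * pKinv)%:E)%E.
Proof.
have [a4 _] := arate_small.
have d01 : 0 < 2 * a < 1 by rewrite mulr_gt0//=; lra.
have pr (mk : 'I_J * 'I_K) :
    (P (~` close_event (@Bhat_cv _ _ _ _ S mk.1) mk.2 q C0 (2 * a))
      <= (4 * (pKinv * pKinv))%:E)%E.
  rewrite probability_setC; last exact: close_event_measurable.
  have [_ _ /(_ mk.2 mk.1 _ d01) h] := rates.
  apply: (@le_trans _ _ (1 - (1 - 4 * expR (- ((n_train S)%:R * (2 * a) ^+ 2)))%:E)%E).
    exact: leeB.
  rewrite -EFinB lee_fin opprB addrC subrK ler_pM2l// -inv2 ler_expR lerN2.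
  have := ler_wpM2r (ltW a2) n_train_ge; rewrite exprMn; lra.
apply: le_trans (prob_exists_le (fun mk => measurableC (close_event_measurable _ _ _)) pr) _.
rewrite lee_fin card_prod !card_ord natrM.
rewrite (_ : _ * _ * _ = 4 * J%:R * (K%:R * (pKinv * pKinv))); last by ring.
by apply: ler_wpM2l; [exact: mulr_ge0|exact: pKinvK].
Qed.

Definition bad_event : set (Omega S) :=
  re_event `|` excess_event `|` approx_event `|` excess_grad_event
  `|` coord_grad_event `|` far_event.

Lemma bad_event_measurable : measurable bad_event.
Proof.
rewrite /bad_event; apply: measurableU; last first.
  by apply: bigcup_fin_measurable => mk; apply: measurableC; exact: close_event_measurable.
apply: measurableU; last first.
  by apply: bigcup_fin_measurable => mj; exact: (grad_event_measurable _ _ _ _ mL dL1 dL2 data).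
apply: measurableU; last first.
  by apply: bigcup_fin_measurable => k; exact: (grad_event_measurable _ _ _ _ mL dL1 dL2 data).
apply: measurableU; last first.
  by apply: bigcup_fin_measurable => t; exact: (ball_event_measurable _ _ _ data).
by apply: measurableU; apply: bigcup_fin_measurable => t; exact: (norm_event_measurable _ data).
Qed.

Lemma bad_event_prob : (P bad_event <=
  ((2 + 6 * J%:R) * pKinv + (2 * expR (- n%:R) + expR (- (sb / 4 * n%:R))))%:E)%E.
Proof.
rewrite (_ : _ + _ = expR (- n%:R) + expR (- n%:R) + expR (- (sb / 4 * n%:R))
  + 2 * pKinv + 2 * J%:R * pKinv + 4 * J%:R * pKinv); last by ring.
have M1 := bigcup_fin_measurable (fun t : m_re.-tuple ('I_p * bool) =>
  norm_event_measurable Kx data (\sum_(k <- t) sgn_basis k)).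
have M2 := bigcup_fin_measurable (fun k : 'I_K => norm_event_measurable Kx data (excess k)).
have M3 := bigcup_fin_measurable (fun t : m_sb.-tuple 'I_K =>
  ball_event_measurable Kx kappal Kbeta data (m_sb%:R^-1 *: \sum_(k <- t) excess k)).
have M4 := bigcup_fin_measurable (fun k : 'I_K =>
  grad_event_measurable Lu Kx Ky Kbeta mL dL1 dL2 data predT (excess k) (2 * smax S) a).
have M5 := bigcup_fin_measurable (fun mj : 'I_J * 'I_p =>
  grad_event_measurable Lu Kx Ky Kbeta mL dL1 dL2 data (fun i => fold_of i == mj.1)
  (delta_mx mj.2 0) 1 a).
have M6 := bigcup_fin_measurable (fun mk : 'I_J * 'I_K =>
  measurableC (close_event_measurable mk.1 mk.2 (2 * a))).
apply: prob_setU_le; [do 4 apply: measurableU => //|exact: M6| |exact: far_event_prob].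
apply: prob_setU_le; [do 3 apply: measurableU => //|exact: M5| |exact: coord_grad_event_prob].
apply: prob_setU_le; [do 2 apply: measurableU => //|exact: M4| |exact: excess_grad_event_prob].
apply: prob_setU_le; [apply: measurableU => //|exact: M3| |exact: approx_event_prob].
by apply: prob_setU_le; [exact: M1|exact: M2|exact: re_event_prob|exact: excess_event_prob].
Qed.

Notation cl := (kappal / (8 * cap_scale Kx kappal Kbeta)).

(** [81 = 3 * (9 + 2 * 9)]: 3 from [norm_event], 9 from the squared rates at [2 * a], 2 from
    [m_re_inv]. *)
Definition Dconst : R := 81 * (2 * Kx) ^+ 2 * C0 ^+ 2.
(** One summand for each lower bound on [C] in [deterministic_bound]: training errors, size of the
    directions, gradient along them, gradient along the training errors. *)
Definition Cconst : R := 4 * J%:R * Dconst + 12 * (2 * Kx) ^+ 2 * Kbeta ^+ 2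
  + 2 * Crho * Cg + 6 * J%:R * Cg * C0.

Hypothesis c1_eps : c1 * (1152 * (2 * Kx) ^+ 2 * Crho) <= cl * sb.
Hypothesis c1_C : 24 * Cconst * c1 <= cl.

Variables (eta : R).
Hypothesis eta0 : 0 < eta.
Hypothesis curv : forall y u v, `|u| <= trunc_level Kx kappal Kbeta + 1 ->
  eta * Num.min `|v - u| 1 ^+ 2 <= L y v - L y u - dL L y u * (v - u).
Hypothesis d2L_gt0 : forall mu, 0 < inf_d2L L mu.

Let Cg0 : 0 < Cg. Proof. by rewrite divr_gt0// grad_scale_gt0. Qed.
Let k2 : 0 < (2 * Kx) ^+ 2. Proof. by rewrite exprn_gt0// mulr_gt0. Qed.
Let JR : (1 : R) <= J%:R. Proof. by rewrite ler1n ltnW. Qed.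

Let cl0 : 0 < cl.
Proof. by rewrite divr_gt0// mulr_gt0// (lt_le_trans ltr01)// cap_scale_ge1. Qed.
Let C0' : 0 <= C0. Proof. exact: ltW. Qed.

Let part1 : 0 <= 4 * J%:R * Dconst.
Proof. by rewrite mulr_ge0// mulr_ge0 ?sqr_ge0// mulr_ge0// ltW. Qed.
Let part2 : 0 <= 12 * (2 * Kx) ^+ 2 * Kbeta ^+ 2.
Proof. by rewrite mulr_ge0 ?sqr_ge0// mulr_ge0// ltW. Qed.
Let part3 : 0 <= 2 * Crho * Cg.
Proof. by apply: mulr_ge0; [apply: mulr_ge0 => //; exact: sqr_ge0|exact: ltW]. Qed.
Let part4 : 0 <= 6 * J%:R * Cg * C0.
Proof. by apply: mulr_ge0 => //; apply: mulr_ge0; [exact: mulr_ge0|exact: ltW]. Qed.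

Let Cconst_ge : [/\ 4 * J%:R * Dconst <= Cconst, 12 * (2 * Kx) ^+ 2 * Kbeta ^+ 2 <= Cconst,
  2 * Crho * Cg <= Cconst & 6 * J%:R * Cg * C0 <= Cconst].
Proof.
move: part1 part2 part3 part4; rewrite /Cconst.
move: (4 * J%:R * Dconst) (12 * (2 * Kx) ^+ 2 * Kbeta ^+ 2) (2 * Crho * Cg) (6 * J%:R * Cg * C0).
by move=> u v x y; split; lra.
Qed.

Lemma Cconst_gt0 : 0 < Cconst.
Proof.
have [_ _ Cc3 _] := Cconst_ge; apply: lt_le_trans Cc3.
by rewrite mulr_gt0// mulr_gt0// exprn_gt0// addr_gt0.
Qed.

(** The form required by [deterministic_bound]: one sum over observations, each estimate written as
    its target plus an error. *)
Lemma CV_sum (om : Omega S) (w : 'I_K -> R) :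
  CV L om (\col_k w k) = \sum_i L (Yobs i om)
    (dotp (\sum_k w k *: (col k (Bstar S) + (col k (Bhat_cv (fold_of i) om) - col k (Bstar S))))
          (Xobs i om)).
Proof.
rewrite [RHS](partition_big (@fold_of _ _ _ _ S) predT)//=.
apply: eq_bigr => m _; apply: eq_bigr => i /eqP ->; congr (L _ (dotp _ _)).
apply/matrixP => j l; rewrite (ord1 l) mxE summxE; apply: eq_bigr => k _.
by rewrite !mxE addrC subrK mulrC.
Qed.

Lemma good_event_bound (om : Omega S) : ~ bad_event om ->
  eta * (cl * phi2 S / 6) * wrong_weight om <= (2 + 3 * Lu) * Cconst * Tn S q.
Proof.
move=> good.
have good1 (t : m_re.-tuple ('I_p * bool)) : ~ norm_event Kx (\sum_(k <- t) sgn_basis k) om.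
  by move=> h; apply: good; do 5 left; exists t.
have good2 (k : 'I_K) : ~ norm_event Kx (excess k) om.
  by move=> h; apply: good; do 4 left; right; exists k.
have good3 (t : m_sb.-tuple 'I_K) :
    ~ ball_event Kx kappal Kbeta (m_sb%:R^-1 *: \sum_(k <- t) excess k) om.
  by move=> h; apply: good; do 3 left; right; exists t.
have good4 (k : 'I_K) : ~ grad_event L Lu Kx Ky Kbeta predT (excess k) (2 * smax S) a om.
  by move=> h; apply: good; do 2 left; right; exists k.
have good5 (m : 'I_J) (j : 'I_p) :
    ~ grad_event L Lu Kx Ky Kbeta (fun i => fold_of i == m) (delta_mx j 0) 1 a om.
  by move=> h; apply: good; left; right; exists (m, j).
have good6 (m : 'I_J) (k : 'I_K) : close_event (@Bhat_cv _ _ _ _ S m) k q C0 (2 * a) om.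
  by apply: contrapT => h; apply: good; right; exists (m, k).
pose del (m : 'I_J) k := col k (Bhat_cv m om) - col k (Bstar S).
pose X (i : 'I_n) := Xobs i om.
have empE b : emp_form X b b = \sum_i dotp b (Xobs i om) ^+ 2.
  by apply: eq_bigr => i _; rewrite expr2.
have Tp : 0 < Tn S q := T0; set T := Tn S q in Tp *.
have T1 : T <= 1 := Tn_le1.
have T20 : 0 <= T ^+ 2 by exact: sqr_ge0.
have D3 : 0 <= 3 * (2 * Kx) ^+ 2 * n%:R.
  by rewrite mulr_ge0// mulr_ge0// ltW.
have re v : emp_form X v v <= 3 * (2 * Kx) ^+ 2 * n%:R * (dotp v v + norm1 v ^+ 2 * (2 * a ^+ 2)).
  have h := emp_form_le_norm1 (X := X) m_re_gt1 D3.
  apply: (le_trans (h _ v)); last first.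
    by rewrite ler_wpM2l// lerD2l ler_wpM2l ?sqr_ge0// m_re_inv.
  move=> t /=; have /negP := good1 t; rewrite -leNgt -empE.
  by move=> /le_trans; apply; rewrite mulrAC.
have del2 m k : dotp (del m k) (del m k) <= 9 * C0 ^+ 2 * T ^+ 2.
  have [h _] := good6 m k; have {}h := le_trans h (rate2_le q01 C00 K2 s0).
  have b0 : 0 <= 3 * C0 * T by rewrite mulr_ge0 ?(ltW Tp)// mulr_ge0.
  rewrite -(sqr_sqrtr (dotp_ge0 (del m k))) -lqnorm2E.
  have -> : 9 * C0 ^+ 2 * T ^+ 2 = (3 * C0 * T) ^+ 2 by ring.
  by rewrite ler_pXn2r ?nnegrE// powR_ge0.
have del1 m k : norm1 (del m k) * a <= 3 * C0 * T ^+ 2.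
  have [_ h] := good6 m k; rewrite lqnorm1E in h.
  apply: le_trans (rate1_le q01 C00 K2 s0); apply: ler_wpM2r; [exact: ltW|exact: h].
have norm10 (v : 'cV[R]_p) : 0 <= norm1 v by rewrite sumr_ge0.
have Hdel m k : emp_form X (del m k) (del m k) <= Dconst * n%:R * T ^+ 2.
  apply: le_trans (re _) _.
  have -> : Dconst * n%:R * T ^+ 2 = 3 * (2 * Kx) ^+ 2 * n%:R * (27 * C0 ^+ 2 * T ^+ 2).
    by rewrite /Dconst; ring.
  apply: ler_wpM2l => //.
  have h1 : (norm1 (del m k) * a) ^+ 2 <= 9 * C0 ^+ 2 * T ^+ 2.
    have -> : 9 * C0 ^+ 2 * T ^+ 2 = (3 * C0 * T) ^+ 2 by ring.
    have d0 : 0 <= norm1 (del m k) * a by rewrite mulr_ge0// ltW.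
    have b0 : 0 <= 3 * C0 * T by rewrite mulr_ge0 ?(ltW Tp)// mulr_ge0.
    rewrite ler_pXn2r ?nnegrE//; apply: le_trans (del1 m k) _.
    by apply: ler_wpM2l; [exact: mulr_ge0|rewrite expr2 ler_piMr// ltW].
  have h2 := del2 m k; rewrite exprMn in h1; lra.
have Hx k : emp_form X (excess k) (excess k) <= 12 * (2 * Kx) ^+ 2 * smax S ^+ 2 * n%:R.
  have /negP := good2 k; rewrite -leNgt -empE => /le_trans; apply.
  have := ler_wpM2l D3 (excess_sqr_le k); lra.
have Ta : smax S * a <= Crho * T.
  exact: (smax_arate q01 c10 lqnorm2_Bstar K2 s0 phi2_le_smax Psi_le c1_small).
have bnd0 : 0 <= Cg * n%:R by rewrite mulr_ge0// ltW.
have [Cc1 Cc2 Cc3 Cc4] := Cconst_ge.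
have C0c : 0 <= Cconst by exact: le_trans part1 Cc1.
have wwE : wrong_weight om = 1 - \sum_(k | in_correct_range k) what om k 0 by [].
have [_ _ _ /(_ om)[[wh01 wh1] whopt]] := est.
rewrite wwE.
(* [eps = cl / 12] splits the allowance [cl * phi2 S / 6] evenly. The Maurey error [12 * 8 = 96]
   against [cl / 12] gives the 1152 of [c1_eps], and [2 * C * T ^+ 2] against the other half the 24
   of [c1_C]. *)
apply: (@deterministic_bound R n p K J X (@fold_of _ _ _ _ S) (fun k => col k (Bstar S))
  (beta_star S) del (@in_correct_range _ _ _ _ S) (kstar S) (fun k => what om k 0)
  (fun i => L (Yobs i om)) (fun i => dL L (Yobs i om)) eta Lu
  (trunc_level Kx kappal Kbeta) T (phi2 S) cl (cl / 12) Dconst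
  (12 * (2 * Kx) ^+ 2 * smax S ^+ 2) (Cg * n%:R * a) Cconst m_sb) => //.
- exact: kstar_correct.
- by move=> k; exact: col_correct.
- by move=> k; have /andP[] := wh01 k.
- move=> w w0 w1; rewrite -!CV_sum.
  rewrite (_ : \col_k what om k 0 = what om); last first.
    by apply/matrixP => k l; rewrite (ord1 l) mxE.
  apply: whopt; split=> [k|]; last by under eq_bigr do rewrite mxE.
  by rewrite mxE w0/= -w1 (bigD1 k)//= lerDl sumr_ge0.
- exact: nobs_gt0.
- exact: m_sb_gt0.
- exact: ltW.
- by move=> i u v hu; exact: curv.
- by move=> i u v; exact: loss_gap_ge0.
- move=> t tc; have /negP := good3 t; rewrite -leNgt; apply: le_trans.
  rewrite mulrAC; apply: ler_wpM2r => //; apply: ler_wpM2l; first exact: (ltW cl0).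
  exact: (phi2_le_average data corr uniq_min m_sb_gt0 tc).
- move=> k; have /negP := good4 k; rewrite -leNgt.
  under eq_bigr do rewrite grad_obs; move=> /le_trans; apply.
  apply: (@le_trans _ _ (2 * Crho * Cg * n%:R * T)); last first.
    apply: ler_wpM2r; first exact: ltW.
    exact: ler_wpM2r.
  by have := ler_wpM2l bnd0 Ta; lra.
- move=> m j; have /negP := good5 m j; rewrite -leNgt mul1r.
  under eq_bigr do rewrite grad_obs dotp_delta.
  by [].
- move=> m k.
  apply: (@le_trans _ _ (6 * J%:R * Cg * C0 * n%:R * T)).
    have := ler_wpM2l (mulr_ge0 (ler0n R J) bnd0) (del1 m k).
    have h : T ^+ 2 <= T by rewrite expr2 ler_piMr// ltW.
    have := ler_wpM2l (mulr_ge0 (mulr_ge0 (ler0n R J) bnd0) C0') h; lra.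
  apply: ler_wpM2r; first exact: ltW.
  exact: ler_wpM2r.
- by apply: le_trans Cc2; apply: ler_wpM2l smax_sqr_le; rewrite mulr_ge0// ltW.
- exact: ltnW.
- by rewrite mulr_ge0 ?sqr_ge0// mulr_ge0// ltW.
- have h1 : smax S ^+ 2 * a <= Crho * (c1 * phi2 S).
    apply: le_trans (smax_sqr_arate q01 lqnorm2_Bstar K2 s0) _.
    by apply: ler_wpM2l; [exact: sqr_ge0|exact: Psi_le].
  have P0 := phi2_gt0.
  have s20 : 0 <= smax S ^+ 2 by exact: sqr_ge0.
  have ks0 : 0 <= 12 * (2 * Kx) ^+ 2 * smax S ^+ 2 by rewrite mulr_ge0// mulr_ge0// ltW.
  apply: le_trans (ler_wpM2l ks0 m_sb_inv) _.
  rewrite mulrA ler_pdivrMr//.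
  have h2 : smax S ^+ 2 * a ^+ 2 <= smax S ^+ 2 * a.
    by apply: ler_wpM2l => //; rewrite expr2 ler_piMl// ltW.
  have h3 := ler_wpM2l (ltW k2) (le_trans h2 h1).
  have := ler_wpM2r (ltW P0) c1_eps; lra.
- have h1 : T ^+ 2 <= c1 * phi2 S.
    apply: (@le_trans _ _ T); first by rewrite expr2 ler_piMr// ltW.
    exact: (Tn_le K2 s0 Psi_le).
  have h2 := ler_wpM2l C0c h1.
  have := ler_wpM2r (ltW phi2_gt0) c1_C; lra.
Qed.

Lemma wrong_weight_measurable : measurable_fun setT (@wrong_weight _ _ _ _ S).
Proof.
apply: measurable_funB => //; apply: measurable_sum_cond => k.
by case: est => -[_ [_ h]] _ _ _.
Qed.

Lemma wrong_weight_prob (C1 : R) : C1 = 6 * ((2 + 3 * Lu) * Cconst) / (eta * cl) ->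
  ((1 - ((2 + 6 * J%:R) * (p * K)%:R^-1 + (2 * expR (- n%:R) + expR (- (sb / 4 * n%:R)))))%:E
    <= P [set w | (wrong_weight w <= C1 * (Tn S q / phi2 S))%R])%E.
Proof.
move=> C1E; set target := [set w | _].
have mt : measurable target by exact: measurable_ler_set wrong_weight_measurable _.
have sub_bad : ~` target `<=` bad_event.
  move=> w /=; apply: contra_notP => good; rewrite /target/=.
  have := good_event_bound good; have P0 := phi2_gt0.
  rewrite (_ : eta * (cl * phi2 S / 6) * _ = (eta * cl * phi2 S / 6) * wrong_weight w);
    last by ring.
  have e0 : 0 < eta * cl * phi2 S / 6 by rewrite divr_gt0// mulr_gt0// mulr_gt0.
  rewrite -ler_pdivlMl// => /le_trans; apply.
  rewrite le_eqVlt; apply/orP; left; apply/eqP; rewrite C1E.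
  move: cl cl0 (phi2 S) P0 => c c_gt0 f f_gt0.
  by field; rewrite !gt_eqF.
have : (P (~` target) <= ((2 + 6 * J%:R) * (p * K)%:R^-1 +
    (2 * expR (- n%:R) + expR (- (sb / 4 * n%:R))))%:E)%E.
  apply: le_trans bad_event_prob; apply: le_measure => //; rewrite inE.
    exact: measurableC.
  exact: bad_event_measurable.
have := probability_setC P (measurableC mt); rewrite setCK => -> h.
by rewrite EFinB leeB.
Qed.

End high_probability.

(** * Choice of the constants and conclusion *)

Lemma exists_small_factor {R : realType} (a1 a2 a3 b1 b2 b3 : R) :
  0 < a1 -> 0 < a2 -> 0 < a3 -> 0 < b1 -> 0 < b2 -> 0 < b3 ->
  exists2 c : R, 0 < c & [/\ c * a1 <= b1, c * a2 <= b2 & c * a3 <= b3].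
Proof.
move=> a10 a20 a30 b10 b20 b30; exists (Num.min (b1 / a1) (Num.min (b2 / a2) (b3 / a3))).
  by rewrite !lt_min !divr_gt0.
by split; rewrite -ler_pdivlMr// !ge_min lexx ?orbT.
Qed.

(** The demands on [c1]: two make [4 * a] at most 1 and at most the small-ball rate, the third
    controls the Maurey error, the fourth the training errors. *)
Lemma exists_rate_constant {R : realType} (r k s c A : R) :
  0 < r -> 0 < k -> 0 < s -> 0 < c -> 0 < A ->
  exists2 c1 : R, 0 < c1 & [/\ 16 * c1 * r <= 1, 16 * c1 * r <= s,
    c1 * (1152 * k * r) <= c * s & 24 * A * c1 <= c].
Proof.
move=> r0 k0 s0 c0 A0.
have n16 : (0 : R) < 16 by [].
have n24 : (0 : R) < 24 by [].
have n1152 : (0 : R) < 1152 by rewrite ltr0n.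
move: (16 : R) n16 (24 : R) n24 (1152 : R) n1152 => x x0 y y0 z z0.
have m0 : 0 < Num.min 1 s by rewrite lt_min ltr01.
have [c1 c10 [h1 h2 h3]] := exists_small_factor (mulr_gt0 x0 r0)
  (mulr_gt0 (mulr_gt0 z0 k0) r0) (mulr_gt0 y0 A0) m0 (mulr_gt0 c0 s0) c0.
move: h1; rewrite le_min => /andP[h1 h1'].
by exists c1 => //; split=> //; [rewrite -mulrA mulrCA..|rewrite mulrC].
Qed.

Lemma phi2_ge0 {R : realType} {dY : measure_display} {Ycal : measurableType dY} {J : nat}
  (S : experiment R Ycal J) : 0 <= phi2 S.
Proof.
rewrite /phi2; set E := [set _ | _ in _]; have [->|E0] := eqVneq E set0; first by rewrite inf0.
apply: lb_le_inf; first exact/set0P.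
by move=> _ [D _ <-]; rewrite divr_ge0// sqr_ge0.
Qed.

Lemma wrong_weight_eq0 {R : realType} {dY : measure_display} {Ycal : measurableType dY} {J : nat}
    (L : Ycal -> R -> R) (S : experiment R Ycal J) (w : Omega S) : estimators L S ->
  (forall k, in_correct_range (S := S) k) -> wrong_weight w = 0.
Proof.
move=> [_ _ _ /(_ w)[[_ w1] _]] all_in; rewrite /wrong_weight -w1.
by rewrite [X in _ - X](eq_bigl predT) ?subrr// => k; exact: all_in.
Qed.

Theorem theorem7 (R : realType) (dY : measure_display)
    (Ycal : measurableType dY) (L : Ycal -> R -> R) (J : nat)
    (q Lu Kx Ky kappal Kbeta C0 : R) :
  (2 <= J)%N -> 0 <= q < 1 ->
  0 < Lu -> 0 < Kx -> 0 < Ky -> 0 < kappal -> 0 < Kbeta -> 0 < C0 ->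
  (forall mu, measurable_fun setT (L^~ mu)) ->
  (forall y, convex_function setT (L y : R^o -> R^o)) ->
  (forall y mu, derivable (L y : R -> R^o) mu 1) ->
  (forall y mu, derivable (dL L y : R -> R^o) mu 1) ->
  (forall mu, 0 < inf_d2L L mu) ->
  continuous (inf_d2L L : R -> R) ->
  (forall y mu1 mu2, `|dL L y mu1 - dL L y mu2| <= Lu * `|mu1 - mu2|) ->
  exists c0 c1 c C1 C2 : R,
    [/\ 0 < c0, 0 < c1, 0 < c, 0 < C1 & 0 < C2] /\
    forall S : experiment R Ycal J,
      data_model L S -> group_sizes S -> fold_sizes S ->
      estimators L S -> pseudo_true L S ->
      (forall k, correct k <-> in_correct_range (S := S) k) ->
      wtilde_unique_min L S ->
      subgaussian_design L S Kx Ky kappal ->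
      estimation_rates S q C0 Kbeta ->
      (strong_convexity L \/ sparsity S q c0) ->
      Psin S q <= c1 * phi2 S ->
      ((1 - C2 * (pdim S * nmod S)%:R^-1 - C2 * expR (- (c * (nobs S)%:R)))%:E
        < Prob S [set w | (wrong_weight w <= C1 * (Tn S q / phi2 S))%R])%E.
Proof.
move=> J2 q01 Lu0 Kx0 Ky0 kap0 Kb0 C00 mL _ dL1 dL2 d2L_gt0 d2L_cont lip.
pose sb := small_ball_rate Kx kappal Kbeta.
pose cl := kappal / (8 * cap_scale Kx kappal Kbeta).
pose A := @Cconst R J Lu Kx Ky Kbeta C0.
have sb0 : 0 < sb by exact: small_ball_rate_gt0.
have cl0 : 0 < cl.
  by rewrite divr_gt0// mulr_gt0// (lt_le_trans ltr01)// cap_scale_ge1.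
have A0 : 0 < A by exact: Cconst_gt0.
have rho0 : 0 < (1 + Kbeta) ^+ 2 by rewrite exprn_gt0// addr_gt0.
have k0 : 0 < (2 * Kx) ^+ 2 by rewrite exprn_gt0// mulr_gt0.
have M0 : 0 <= trunc_level Kx kappal Kbeta + 1.
  by rewrite addr_ge0// (le_trans ler01)// trunc_level_ge1.
have [eta eta0 curv] := loss_curvature dL1 dL2 d2L_gt0 d2L_cont M0.
have [c1 c10 [c1_a c1_sb c1_eps c1_C]] := exists_rate_constant rho0 k0 sb0 cl0 A0.
pose C1 := 6 * ((2 + 3 * Lu) * A) / (eta * cl).
have C10 : 0 < C1.
  apply: divr_gt0 (mulr_gt0 eta0 cl0); apply: mulr_gt0 => //; apply: mulr_gt0 => //.
  by apply: addr_gt0 => //; exact: mulr_gt0.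
(* The slower of the two exponential rates in [bad_event_prob]. *)
pose c := Num.min 1 (sb / 4).
have c_gt0 : 0 < c by rewrite lt_min ltr01 divr_gt0.
(* [C2] exceeds both [2 + 6 * J] and the 3 of the exponentials; the surplus gives the strict
   inequality, through the exponential since the inverse of [p * K] is 0 when [p = 0]. *)
exists 1, c1, c, C1, (4 + 6 * J%:R); split; first by split=> //; exact: ltr_wpDr.
move=> S data _ _ est _ corr uniq_min sub rates _ Psi_le.
have pK0 : 0 <= (pdim S * nmod S)%:R^-1 :> R by rewrite invr_ge0.
have e0 : 0 < expR (- (c * (nobs S)%:R)) by exact: expR_gt0.
have J0 : (0 : R) <= J%:R by [].
(* Without wrong models a single merged model remains, [phi2 S] is [inf set0 = 0] and the quotient
   by it is 0; the bound holds surely because the wrong weight is 0 too. *)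
have [k0_wrong|all_in] := pselect (exists k, ~~ in_correct_range (S := S) k); last first.
  have in_range k : in_correct_range (S := S) k.
    by apply: contrapT => /negP nk; apply: all_in; exists k.
  rewrite (_ : [set w | _] = setT); last first.
    apply/seteqP; split=> // w _ /=; rewrite (wrong_weight_eq0 w est in_range).
    rewrite mulr_ge0 ?(ltW C10)// divr_ge0 ?phi2_ge0//.
    by rewrite /Tn; case: ifP => _; rewrite mulr_ge0 ?sqrtr_ge0 ?powR_ge0.
  rewrite probability_setT lte_fin.
  have := mulr_ge0 J0 pK0; have := mulr_ge0 J0 (ltW e0); lra.
have [k k_wrong] := k0_wrong.
apply: lt_le_trans (wrong_weight_prob J2 q01 Lu0 Kx0 Ky0 kap0 Kb0 C00 c10 mL dL1 dL2 lip
  data est corr uniq_min sub rates Psi_le k_wrong c1_a c1_sb c1_eps c1_C eta0 curv d2L_gt0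
  (erefl C1)).
have c1n : expR (- (nobs S)%:R) <= expR (- (c * (nobs S)%:R)) :> R.
  by rewrite ler_expR lerN2 ler_piMl// ge_min lexx.
have csb : expR (- (sb / 4 * (nobs S)%:R)) <= expR (- (c * (nobs S)%:R)).
  by rewrite ler_expR lerN2 ler_wpM2r// ge_min lexx orbT.
rewrite lte_fin.
have := mulr_ge0 J0 (ltW e0); lra.
Qed.
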